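(* Let $X=\{X_s\}_{s\ge0}$ and $Y=\{Y_t\}_{t\ge0}$ be real-valued Lévy processes with characteristic exponents $\Phi$ and $\Psi$ respectively, and let $\hat Y_t=-Y_t$ be the dual process of $Y$. Let $\mathcal F$ be the Fourier transform on $L^2(\mathbb R,\mathrm dx)$. Assume that $s:[0,1]\to[0,\infty)$ and $t:[0,1]\to[0,\infty)$ are two increasing and right-continuous functions such that $s(0)=t(0)=0$. For $f\in L^2(\mathbb R,\mathrm dx)$ define $$\mathsf F(x)=\mathbb E\Big[e^{-\int_{(0,1]}\Psi(X_{s(w-)})\,\mathrm dt(w)}f(X_{s(1)})\,\Big|\,X_0=x\Big],$$ $$\mathsf G(y)=\mathbb E\Big[e^{-\int_{(0,1]}\Phi(\hat Y_{t(w)})\,\mathrm ds(w)}\,\mathcal Ff(\hat Y_{t(1)})\,\Big|\,\hat Y_0=y\Big].$$ Then $\mathsf F$ and $\mathsf G$ are in $L^2(\mathbb R,\mathrm dx)$ and $\mathsf G=\mathcal F\,\mathsf F$.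
   Context: The characteristic exponent $\Phi$ of a Lévy process $X$ is defined by $\mathbb E[e^{\mathrm iyX_s}\mid X_0=0]=e^{-s\Phi(y)}$, $s\ge0$, $y\in\mathbb R$ (similarly $\Psi$ for $Y$). Lévy processes are allowed to start from a non-zero fixed value: under $X_0=x$ the process has the law of $x+X$ with $X$ started at $0$; $\hat Y_0=y$ means $Y_0=-y$. $\mathcal F$ is the unitary operator on $L^2(\mathbb R,\mathrm dx)$ (complex-valued functions) extending $\mathcal Ff(z)=\frac1{\sqrt{2\pi}}\int_{\mathbb R}f(x)e^{-\mathrm izx}\,\mathrm dx$ from Schwartz functions. $s(w-)$ denotes the left limit of $s$ at $w$, and the integrals in the exponents are Lebesgue–Stieltjes integrals. Convention on expectations: for a bounded path functional $\xi$ and $f\in L^2(\mathbb R,\mathrm dx)$, the function $x\mapsto\mathbb E[\xi f(X_{s})\mid X_0=x]$ is understood as the value at $f$ of the unique continuous extension to $L^2(\mathbb R,\mathrm dx)$ of the operator $f\mapsto\mathbb E[\xi f(X_s)\mid X_0=\cdot]$ originally defined on bounded functions in $L^2(\mathbb R,\mathrm dx)$; similarly for $\hat Y$. Equalities are in $L^2(\mathbb R,\mathrm dx)$. *)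

(* Defs.v *)
From HB Require Import structures.
From mathcomp Require Import all_boot all_order all_algebra.
From mathcomp Require Import all_classical all_reals all_analysis.
From mathcomp Require Import complex.

Set Implicit Arguments.
Unset Strict Implicit.
Unset Printing Implicit Defensive.

Import Order.TTheory GRing.Theory Num.Theory.
Import numFieldNormedType.Exports.

Local Open Scope classical_set_scope.
Local Open Scope complex_scope.
Local Open Scope ring_scope.

Section complex_valued.
Context {R : realType}.

Definition cexp (z : R[i]) : R[i] :=
  (expR (complex.Re z))%:C * (cos (complex.Im z) +i* sin (complex.Im z)).

Definition cintegral d (T : measurableType d) (mu : {measure set T -> \bar R})
    (D : set T) (f : T -> R[i]) : R[i] :=
  Rintegral mu D (fun x => complex.Re (f x)) +i*
  Rintegral mu D (fun x => complex.Im (f x)).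

(* Elements of L^2(R, dx) are represented by Borel functions; equality in
   L^2(R, dx) is almost everywhere equality. *)
Definition L2 (f : R -> R[i]) : Prop :=
  (fun x => complex.Re (f x)) \in Lfun (@lebesgue_measure R) 2%:E /\
  (fun x => complex.Im (f x)) \in Lfun (@lebesgue_measure R) 2%:E.

Definition L2norm (f : R -> R[i]) : \bar R :=
  Lnorm (@lebesgue_measure R) 2%:E (fun x => (Normc.normc (f x))%:E).

Definition L2inner (f g : R -> R[i]) : R[i] :=
  cintegral lebesgue_measure setT (fun x => f x * conjc (g x)).

Definition bounded (f : R -> R[i]) : Prop :=
  exists M : R, forall x, Normc.normc (f x) <= M.

Definition L2_continuous (A : (R -> R[i]) -> R -> R[i]) : Prop :=
  forall f, L2 f -> forall e : R, 0 < e -> exists2 delta : R, 0 < delta &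
    forall g, L2 g -> (L2norm (f \- g)%R < delta%:E)%E ->
      (L2norm (A f \- A g)%R < e%:E)%E.

(* A is a continuous operator on L^2 that agrees with op on the bounded
   functions of L^2. *)
Definition continuous_L2_extension (op A : (R -> R[i]) -> R -> R[i]) : Prop :=
  [/\ forall f, L2 f -> L2 (A f),
      L2_continuous A &
      forall f, L2 f -> bounded f -> A f = op f %[ae @lebesgue_measure R]].

Definition unique_continuous_L2_extension
    (op A : (R -> R[i]) -> R -> R[i]) : Prop :=
  continuous_L2_extension op A /\
  forall A', continuous_L2_extension op A' ->
    forall f, L2 f -> A' f = A f %[ae @lebesgue_measure R].

Definition L2_unitary (U : (R -> R[i]) -> R -> R[i]) : Prop :=
  [/\ forall f, L2 f -> L2 (U f),
      forall (a : R[i]) f g, L2 f -> L2 g ->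
        U (fun x => a * f x + g x) = (fun x => a * U f x + U g x)
          %[ae @lebesgue_measure R],
      forall f g, L2 f -> L2 g -> L2inner (U f) (U g) = L2inner f g &
      forall g, L2 g -> exists2 f, L2 f & U f = g %[ae @lebesgue_measure R]].

Definition schwartz_real (g : R -> R) : Prop :=
  (forall n x, derivable (derive1n n g) x 1) /\
  (forall m n, exists C : R, forall x, `|x ^+ m * derive1n n g x| <= C).

Definition schwartz (f : R -> R[i]) : Prop :=
  schwartz_real (fun x => complex.Re (f x)) /\
  schwartz_real (fun x => complex.Im (f x)).

Definition fourier_transform (F : (R -> R[i]) -> R -> R[i]) : Prop :=
  L2_unitary F /\
  forall f, schwartz f ->
    F f = (fun z => ((Num.sqrt (2 * pi))^-1)%:C *
             cintegral lebesgue_measure setT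
               (fun x => f x * cexp (- ((z * x) *i))))
      %[ae @lebesgue_measure R].

End complex_valued.

Section levy.
Context {R : realType} {d : measure_display} {T : measurableType d}
  {P : probability T R}.

Definition increment_in (X : R -> {RV P >-> R}) (u v : R) (B : set R) : set T :=
  [set w | B (X v w - X u w)].

(* Only the times u >= 0 matter; X is started at 0, and under X_0 = x the
   process is x + X. *)
Definition levy_process (X : R -> {RV P >-> R}) : Prop :=
  [/\ \forall w \ae P, X 0 w = 0,
      forall (n : nat) (u : nat -> R) (B : nat -> set R),
        0 <= u 0%N -> {homo u : i j / (i <= j)%N >-> i <= j} ->
        (forall i, measurable (B i)) ->
        P (\bigcap_(i < n) increment_in X (u i) (u i.+1) (B i)) =
        (\prod_(i < n) P (increment_in X (u i) (u i.+1) (B i)))%E,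
      forall (u h : R) (B : set R), 0 <= u -> 0 <= h -> measurable B ->
        P (increment_in X u (u + h)%R B) = P (X h @^-1` B) &
      \forall w \ae P,
        (forall u : R, 0 <= u -> X v w @[v --> u^'+] --> X u w) /\
        (forall u : R, 0 < u -> cvg (X v w @[v --> u^'-]))].

Definition characteristic_exponent (X : R -> {RV P >-> R})
    (Phi : R -> R[i]) : Prop :=
  forall u y : R, 0 <= u ->
    cintegral P setT (fun w => cexp ((y * X u w) *i)) =
    cexp (- (u%:C * Phi y)).

End levy.

(* Only the values on [0, 1] matter; they are nonnegative because the function
   vanishes at 0 and is nondecreasing. *)
Record time_change (R : realType) := TimeChange {
  time_change_fun :> R -> R ;
  time_change0 : time_change_fun 0 = 0 ;
  time_change_nd :
    {in `[0, 1] &, {homo time_change_fun : x y / x <= y}} ;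
  time_change_rc : {in `[0, 1[, forall w,
    time_change_fun v @[v --> w^'+] --> time_change_fun w} }.

(* Lebesgue-Stieltjes measures are built from functions on the whole line: the
   time change is made constant on ]-oo, 0] and on [1, +oo[. *)
Definition extend01 (R : realType) (s : time_change R) (x : R) : R :=
  s (Num.max 0 (Num.min x 1)).

Section extend01_cumulative.
Context (R : realType) (s : time_change R).

Let clamp_itv (x : R) : Num.max 0 (Num.min x 1) \in `[0, 1].
Proof. by rewrite in_itv/= le_max lexx/= ge_max ler01/= ge_min lexx orbT. Qed.

Let extend01_nd : nondecreasing (extend01 s).
Proof.
move=> x y xy; apply: time_change_nd; [exact: clamp_itv..|].
by rewrite le_max2//; rewrite le_min2.
Qed.

Let extend01_rc : right_continuous (extend01 s).
Proof.
move=> x; have [x0|x0] := ltP x 0.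
  apply: cvg_near_cst; near=> y.
  have y0 : y <= 0 by near: y; exact: nbhs_right_le.
  by rewrite /extend01 !min_l ?max_l// ltW// (le_lt_trans _ ltr01)// ltW.
have [x1|x1] := ltP x 1; last first.
  apply: cvg_near_cst; near=> y.
  have xy : x <= y by near: y; exact: nbhs_right_ge.
  by rewrite /extend01 !min_r// (le_trans x1).
have -> : extend01 s x = s x by rewrite /extend01 min_l ?max_r// ltW.
apply: cvg_trans (@time_change_rc _ s x _); last by rewrite in_itv/= x0.
apply: near_eq_cvg; near=> y.
have xy : x <= y by near: y; exact: nbhs_right_ge.
have y1 : y <= 1 by near: y; exact: nbhs_right_le.
by rewrite /extend01 min_l// max_r// (le_trans x0).
Unshelve. all: by end_near. Qed.

HB.instance Definition _ :=
  @isCumulative.Build R _ R (extend01 s) extend01_nd extend01_rc.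

End extend01_cumulative.

Section stieltjes.
Context {R : realType}.

Definition stieltjes_integral (s : time_change R) (f : R -> R[i]) : R[i] :=
  cintegral (lebesgue_stieltjes_measure (extend01 s)) `]0, 1] f.

Definition left_limit (s : time_change R) (w : R) : R :=
  lim (s v @[v --> w^'-]).

End stieltjes.

Section operators.
Context {R : realType} {d : measure_display} {T : measurableType d}
  {P : probability T R}.
Implicit Types (X Y : R -> {RV P >-> R}) (s t : time_change R).

Definition forward_operator X (Psi : R -> R[i]) s t
    (f : R -> R[i]) (x : R) : R[i] :=
  cintegral P setT (fun omega =>
    cexp (- stieltjes_integral t (fun w => Psi (x + X (left_limit s w) omega)))
    * f (x + X (s 1) omega)).

(* The dual process started at y is y - Y, where Y is started at 0. *)
Definition dual_operator Y (Phi : R -> R[i]) s t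
    (g : R -> R[i]) (y : R) : R[i] :=
  cintegral P setT (fun omega =>
    cexp (- stieltjes_integral s (fun w => Phi (y - Y (t w) omega)))
    * g (y - Y (t 1) omega)).

End operators.

(* Main.v *)
(* Given the path of X, independence of increments of Y turns
     exp (- sum_k Psi(x + X_(s_k)) (t_(k+1) - t_k))
   into the Y-average of exp (i sum_k (x + X_(s_k)) (Y_(t_(k+1)) - Y_(t_k))).  The
   discretized forward operator is thus an average, over X and Y, of unimodular
   constants times the unitaries f |-> exp (i b x) f(x + a) with a = X_(s(1)) and
   b = Y_(t(1)).  The Fourier transform exchanges translations and modulations, and
   summation by parts shows that the result is the same average read with the roles
   of X and Y exchanged: it is the discretized dual operator.  The discretized
   operators converge weakly, by dominated convergence: on the forward side because
   X has almost surely no jump at the fixed time s(w-), on the dual side because Y o t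
   is right-continuous.  By Jensen's inequality both operators are contractions of
   L^2, hence are their own continuous extensions. *)

From HB Require Import structures.
Require Import Defs.
From mathcomp Require Import all_boot all_order all_algebra.
From mathcomp Require Import all_classical all_reals all_analysis.
From mathcomp Require Import measurable_realfun complex ring lra.

Set Implicit Arguments.
Unset Strict Implicit.
Unset Printing Implicit Defensive.

Import Order.TTheory GRing.Theory Num.Theory.
Import numFieldNormedType.Exports.

Local Open Scope classical_set_scope.
Local Open Scope complex_scope.
Local Open Scope ring_scope.

Local Notation Re := complex.Re.
Local Notation Im := complex.Im.
Local Notation normc := Normc.normc.

(** * Complex-valued integrals *)

(** Three obstacles shape the proof. The passage to the limit requires exponents that are
    continuous, locally bounded and of nonnegative real part, whereas Phi and Psi are known only
    through exp(- u Phi), whose logarithm is ambiguous; considering all small times u at once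
    removes the ambiguity. The absence of a jump at s(w-) is almost sure for each w separately,
    while the Stieltjes integral along one path needs it for almost every w simultaneously; a
    Tonelli argument exchanges the two. Finally the Fourier transform is explicit only on Schwartz
    functions: the commutation with translations and modulations is computed on Gaussians and
    reaches L^2 through unitarity, because the defect is F k with k orthogonal to all Gaussians, and
    Gaussians are total. Surjectivity of F likewise turns the weak identity between the two
    operators into an equality almost everywhere. The processes are constrained only up to a null
    set and at nonnegative times; they are replaced by versions all of whose paths are cadlag,
    through congruences of integrals that hold for arbitrary integrands. *)

Lemma ae_imply2 d (T : measurableType d) (R : realType)
    (mu : {measure set T -> \bar R}) (P Q S : T -> Prop) :
  (forall x, P x -> Q x -> S x) ->
  {ae mu, forall x, P x} -> {ae mu, forall x, Q x} -> {ae mu, forall x, S x}.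
Proof. by move=> PQS mP mQ; apply: filterS2 mP mQ. Qed.

Lemma ae_imply d (T : measurableType d) (R : realType)
    (mu : {measure set T -> \bar R}) (P S : T -> Prop) :
  (forall x, P x -> S x) -> {ae mu, forall x, P x} -> {ae mu, forall x, S x}.
Proof. by move=> PS aeP; apply: (ae_imply2 _ aeP aeP) => x + _; exact: PS. Qed.

Section null_insensitive.
Local Open Scope ereal_scope.
Context d (T : measurableType d) (R : realType).
Variable mu : {measure set T -> \bar R}.

Import HBNNSimple.

(* No measurability is needed: the integral of a nonnegative function is the
   supremum of the integrals of the simple functions below it, and these can be
   cut off on a null set. *)
Lemma ge0_integral_negligible_le (f g : T -> \bar R) :
  (forall x, 0 <= f x) -> (forall x, 0 <= g x) ->
  {ae mu, forall x, f x = g x} -> \int[mu]_x f x <= \int[mu]_x g x.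
Proof.
move=> f0 g0 [N [mN N0 fgN]]; rewrite !ge0_integralTE//.
have fg x : ~ N x -> f x = g x.
  by move=> Nx; apply: contrapT => fgx; apply: Nx; exact: fgN.
apply: ge_ereal_sup => _ [h /= hf <-].
have mC : measurable (~` N) by exact: measurableC.
have pE x : (proj_nnsfun h mC : T -> R) x =
    ((h : T -> R) \_ (~` N))%R x by rewrite mrestrict.
apply: ereal_sup_ubound => /=; exists (proj_nnsfun h mC) => [x|].
  rewrite pE patchE; case: ifPn => [|xN] //; rewrite inE => xN.
  by rewrite -fg.
rewrite -!integralT_nnsfun; apply: ge0_ae_eq_integral => //.
- by apply/measurable_EFinP; exact: measurable_funP.
- by apply/measurable_EFinP; exact: measurable_funP.
- by move=> x _; rewrite lee_fin; exact: fun_ge0.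
- by move=> x _; rewrite lee_fin; exact: fun_ge0.
- exists N; split => // x hx; apply: contrapT => nN; apply: hx => _ /=.
  by congr EFin; rewrite [LHS]pE patchE mem_set.
Qed.

Lemma integral_negligible_congr D (f g : T -> \bar R) :
  {ae mu, forall x, D x -> f x = g x} ->
  \int[mu]_(x in D) f x = \int[mu]_(x in D) g x.
Proof.
move=> fg; rewrite integral_mkcond [RHS]integral_mkcond.
have {}fg : {ae mu, forall x, (f \_ D) x = (g \_ D) x}.
  apply: filterS fg => x fg; rewrite !patchE; case: ifPn => //.
  by rewrite inE; exact: fg.
have gf : {ae mu, forall x, (g \_ D) x = (f \_ D) x}.
  by apply: filterS fg => x ->.
rewrite integralE [RHS]integralE; congr (_ - _); apply/eqP; rewrite eq_le;
  apply/andP; split; apply: ge0_integral_negligible_le => //.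
- by apply: filterS fg => x fgx; rewrite !funeposE fgx.
- by apply: filterS fg => x fgx; rewrite !funeposE fgx.
- by apply: filterS fg => x fgx; rewrite !funenegE fgx.
- by apply: filterS fg => x fgx; rewrite !funenegE fgx.
Qed.

End null_insensitive.

Section complex_arithmetic.
Context {R : realType}.
Implicit Types (z w : R[i]) (x y : R).

(** Squared modulus. Being polynomial in the two parts, it is within reach of [ring], unlike
    [normc]. *)
Definition nsq z : R := Re z ^+ 2 + Im z ^+ 2.

Lemma complex_eqP z w : Re z = Re w -> Im z = Im w -> z = w.
Proof. by case: z w => [a b] [c e] /= -> ->. Qed.

Lemma Re_mul z w : Re (z * w) = Re z * Re w - Im z * Im w.
Proof. by case: z w => [a b] [c e]. Qed.

Lemma Im_mul z w : Im (z * w) = Re z * Im w + Im z * Re w.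
Proof. by case: z w => [a b] [c e]. Qed.

Lemma Re_add z w : Re (z + w) = Re z + Re w.
Proof. by case: z w => [a b] [c e]. Qed.

Lemma Im_add z w : Im (z + w) = Im z + Im w.
Proof. by case: z w => [a b] [c e]. Qed.

Lemma Re_opp z : Re (- z) = - Re z.
Proof. by case: z. Qed.

Lemma Im_opp z : Im (- z) = - Im z.
Proof. by case: z. Qed.

Lemma normc_sqrt z : normc z = Num.sqrt (nsq z).
Proof. by case: z. Qed.

Lemma nsq_ge0 z : 0 <= nsq z.
Proof. by rewrite addr_ge0// sqr_ge0. Qed.

Lemma nsqE z : nsq z = normc z ^+ 2.
Proof. by rewrite normc_sqrt sqr_sqrtr// nsq_ge0. Qed.

Lemma normc_ge0 z : 0 <= normc z.
Proof. by rewrite normc_sqrt sqrtr_ge0. Qed.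

Lemma nsqM z w : nsq (z * w) = nsq z * nsq w.
Proof. by rewrite /nsq Re_mul Im_mul; ring. Qed.

Lemma nsq_conj z : nsq (conjc z) = nsq z.
Proof. by case: z => a b; rewrite /nsq/= sqrrN. Qed.

Lemma normc_conj z : normc (conjc z) = normc z.
Proof. by rewrite !normc_sqrt nsq_conj. Qed.

Lemma normc_Re z : `|Re z| <= normc z.
Proof. by rewrite normc_sqrt -sqrtr_sqr ler_wsqrtr// /nsq lerDl sqr_ge0. Qed.

Lemma normc_Im z : `|Im z| <= normc z.
Proof. by rewrite normc_sqrt -sqrtr_sqr ler_wsqrtr// /nsq lerDr sqr_ge0. Qed.

Lemma normc_le_add z : normc z <= `|Re z| + `|Im z|.
Proof.
rewrite normc_sqrt -[leRHS]ger0_norm ?addr_ge0// -sqrtr_sqr ler_wsqrtr// /nsq.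
by rewrite sqrrD !real_normK ?num_real// lerD2r lerDl mulrn_wge0// mulr_ge0.
Qed.

Lemma nsq_eq0 z : nsq z = 0 -> z = 0.
Proof.
move/eqP; rewrite paddr_eq0 ?sqr_ge0// !sqrf_eq0 => /andP[/eqP a /eqP b].
exact: complex_eqP.
Qed.

Lemma mulc_conj z : z * conjc z = (nsq z)%:C.
Proof. by case: z => a b; apply: complex_eqP; rewrite /nsq/=; ring. Qed.

Lemma nsqD_le z w : nsq (z + w) <= 2 * nsq z + 2 * nsq w.
Proof.
rewrite -subr_ge0; have -> : 2 * nsq z + 2 * nsq w - nsq (z + w) = nsq (z - w).
  by rewrite /nsq !Re_add !Im_add !Re_opp !Im_opp; ring.
exact: nsq_ge0.
Qed.

(** Expansion of a square. This pointwise bound replaces the Cauchy-Schwarz inequality below: it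
    supplies the integrable bounds for products of L^2 functions. *)
Lemma normcM_le z w : 2 * normc (z * w) <= nsq z + nsq w.
Proof.
rewrite Normc.normcM !nsqE -subr_ge0.
have -> : normc z ^+ 2 + normc w ^+ 2 - 2 * (normc z * normc w) =
  (normc z - normc w) ^+ 2 by ring.
exact: sqr_ge0.
Qed.

Lemma cexpE z : cexp z = (expR (Re z) * cos (Im z)) +i* (expR (Re z) * sin (Im z)).
Proof. by apply: complex_eqP; rewrite /cexp/=; ring. Qed.

Lemma cexp0 : cexp 0 = 1 :> R[i].
Proof. by rewrite cexpE/= expR0 cos0 sin0 mulr1 mulr0. Qed.

Lemma cexpD z w : cexp (z + w) = cexp z * cexp w.
Proof.
rewrite !cexpE; apply: complex_eqP; rewrite ?Re_mul ?Im_mul /=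
  Re_add Im_add expRD (cosD,sinD); ring.
Qed.

Lemma nsq_cexp z : nsq (cexp z) = expR (Re z) ^+ 2.
Proof.
by rewrite cexpE /nsq/= !exprMn -mulrDr cos2Dsin2 mulr1.
Qed.

Lemma normc_cexp z : normc (cexp z) = expR (Re z).
Proof. by rewrite normc_sqrt nsq_cexp sqrtr_sqr ger0_norm// expR_ge0. Qed.

Lemma normc_cexp_le1 z : Re z <= 0 -> normc (cexp z) <= 1.
Proof. by move=> z0; rewrite normc_cexp -expR0 ler_expR. Qed.

End complex_arithmetic.

Section complex_convergence.
Context {R : realType}.
Implicit Types (u v : nat -> R[i]) (l m : R[i]).

(** Convergence by components, so that the limit theorems for real sequences and real integrals
    apply directly. *)
Definition ccvg u l :=
  ((fun n => Re (u n)) @ \oo --> Re l) /\ ((fun n => Im (u n)) @ \oo --> Im l).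

Lemma ccvg_unique u l m : ccvg u l -> ccvg u m -> l = m.
Proof.
move=> [a b] [c e]; apply: complex_eqP.
  by apply: cvg_unique a c => //; exact: norm_hausdorff.
by apply: cvg_unique b e => //; exact: norm_hausdorff.
Qed.

Lemma ccvg_cst l : ccvg (fun=> l) l.
Proof. by split; exact: cvg_cst. Qed.

Lemma ccvgM u v l m : ccvg u l -> ccvg v m -> ccvg (fun n => u n * v n) (l * m).
Proof.
move=> [a b] [c e]; split.
  rewrite Re_mul; under eq_fun do rewrite Re_mul.
  by apply: cvgB; exact: cvgM.
rewrite Im_mul; under eq_fun do rewrite Im_mul.
by apply: cvgD; exact: cvgM.
Qed.

Lemma ccvgN u l : ccvg u l -> ccvg (fun n => - u n) (- l).
Proof.
move=> [a b]; split.
  by rewrite Re_opp; under eq_fun do rewrite Re_opp; exact: cvgN.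
by rewrite Im_opp; under eq_fun do rewrite Im_opp; exact: cvgN.
Qed.

Lemma ccvg_cexp u l : ccvg u l -> ccvg (fun n => cexp (u n)) (cexp l).
Proof.
move=> [a b]; split.
  rewrite cexpE/=; have -> : (fun n => Re (cexp (u n))) =
      fun n => expR (Re (u n)) * cos (Im (u n)).
    by apply/funext => n; rewrite cexpE.
  apply: cvgM; first exact: (continuous_cvg _ (@continuous_expR R _) a).
  exact: (continuous_cvg _ (@continuous_cos R _) b).
rewrite cexpE/=; have -> : (fun n => Im (cexp (u n))) =
    fun n => expR (Re (u n)) * sin (Im (u n)).
  by apply/funext => n; rewrite cexpE.
apply: cvgM; first exact: (continuous_cvg _ (@continuous_expR R _) a).
exact: (continuous_cvg _ (@continuous_sin R _) b).
Qed.

End complex_convergence.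

Section complex_measurability.
Context d (T : measurableType d) {R : realType}.
Implicit Types (D : set T) (f g : T -> R[i]).

Definition cmeas D f := measurable_fun D (fun x => Re (f x)) /\
  measurable_fun D (fun x => Im (f x)).

Lemma cmeasD D f g : cmeas D f -> cmeas D g -> cmeas D (fun x => f x + g x).
Proof.
move=> [a b] [c e]; split.
  by under eq_fun do rewrite Re_add; exact: measurable_funD.
by under eq_fun do rewrite Im_add; exact: measurable_funD.
Qed.

Lemma cmeasN D f : cmeas D f -> cmeas D (fun x => - f x).
Proof.
move=> [a b]; split.
  by under eq_fun do rewrite Re_opp; exact: measurable_funN.
by under eq_fun do rewrite Im_opp; exact: measurable_funN.
Qed.

Lemma cmeasM D f g : cmeas D f -> cmeas D g -> cmeas D (fun x => f x * g x).
Proof.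
move=> [a b] [c e]; split.
  under eq_fun do rewrite Re_mul.
  by apply: measurable_funB; exact: measurable_funM.
under eq_fun do rewrite Im_mul.
by apply: measurable_funD; exact: measurable_funM.
Qed.

Lemma cmeas_conj D f : cmeas D f -> cmeas D (fun x => conjc (f x)).
Proof.
move=> [a b]; split.
  by rewrite (_ : (fun x => Re _) = fun x => Re (f x))//; apply/funext => x; case: (f x).
rewrite (_ : (fun x => Im _) = fun x => - Im (f x)).
  exact: measurable_funN.
by apply/funext => x; case: (f x).
Qed.

Lemma cmeas_cexp D f : cmeas D f -> cmeas D (fun x => cexp (f x)).
Proof.
move=> [a b]; split.
  under eq_fun do rewrite cexpE; rewrite /=.
  apply: measurable_funM; first by apply: measurableT_comp.
  apply: measurableT_comp => //.
  by apply: continuous_measurable_fun; exact: continuous_cos.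
under eq_fun do rewrite cexpE; rewrite /=.
apply: measurable_funM; first by apply: measurableT_comp.
apply: measurableT_comp => //.
by apply: continuous_measurable_fun; exact: continuous_sin.
Qed.

Lemma measurable_nsq D f : cmeas D f -> measurable_fun D (fun x => nsq (f x)).
Proof. by move=> [a b]; apply: measurable_funD; exact: measurable_funX. Qed.

Lemma measurable_normc D f : cmeas D f -> measurable_fun D (fun x => normc (f x)).
Proof.
move=> mf; under eq_fun do rewrite normc_sqrt.
apply: measurableT_comp (measurable_nsq mf).
by apply: continuous_measurable_fun; exact: sqrt_continuous.
Qed.

End complex_measurability.

Lemma cmeas_comp d d' (T : measurableType d) (T' : measurableType d')
    (R : realType) (D : set T) (phi : T -> T') (f : T' -> R[i]) :
  cmeas setT f -> measurable_fun D phi -> cmeas D (fun x => f (phi x)).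
Proof. move=> [a b] mphi; split.
  exact: (@measurableT_comp _ _ _ _ _ _ (fun x => Re (f x)) _ phi).
exact: (@measurableT_comp _ _ _ _ _ _ (fun x => Im (f x)) _ phi). Qed.

Section complex_integration.
Context d (T : measurableType d) {R : realType}.
Variable mu : {measure set T -> \bar R}.
Implicit Types (D : set T) (f g : T -> R[i]).

Definition cint D f := mu.-integrable D (fun x => (Re (f x))%:E) /\
  mu.-integrable D (fun x => (Im (f x))%:E).

Lemma cint_meas D f : cint D f -> cmeas D f.
Proof. by move=> [/measurable_int a /measurable_int b]; split; exact/measurable_EFinP. Qed.

Lemma cint_le D f (g : T -> R) : measurable D -> cmeas D f ->
  mu.-integrable D (EFin \o g) -> (forall x, D x -> normc (f x) <= g x) ->
  cint D f.
Proof.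
move=> mD [a b] ig fg; split; apply: (le_integrable mD _ _ ig);
  try exact/measurable_EFinP.
  move=> x Dx /=; rewrite lee_fin (le_trans (normc_Re _))//.
  by rewrite (le_trans (fg _ Dx)) ?ler_norm.
move=> x Dx /=; rewrite lee_fin (le_trans (normc_Im _))//.
by rewrite (le_trans (fg _ Dx)) ?ler_norm.
Qed.

Lemma integrable_normc D f : measurable D -> cint D f ->
  mu.-integrable D (fun x => (normc (f x))%:E).
Proof.
move=> mD cf; have [a b] := cf; have mf := cint_meas cf.
apply: (le_integrable mD _ _ (integrableD mD (integrable_abse a) (integrable_abse b))).
  by apply/measurable_EFinP; exact: measurable_normc.
move=> x Dx /=; rewrite lee_fin ger0_norm ?normc_ge0//.
by rewrite (le_trans (normc_le_add _))// ler_norm.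
Qed.

Lemma cintD D f g : measurable D -> cint D f -> cint D g ->
  cint D (fun x => f x + g x).
Proof.
move=> mD [a b] [c e]; split.
  by under eq_fun do rewrite Re_add EFinD; exact: integrableD.
by under eq_fun do rewrite Im_add EFinD; exact: integrableD.
Qed.

Lemma cintMl D z f : measurable D -> cint D f -> cint D (fun x => z * f x).
Proof.
move=> mD [a b]; split.
  under eq_fun do rewrite Re_mul EFinB !EFinM.
  by apply: integrableB => //; exact: integrableZl.
under eq_fun do rewrite Im_mul EFinD !EFinM.
by apply: integrableD => //; exact: integrableZl.
Qed.

Lemma cintegralD D f g : measurable D -> cint D f -> cint D g ->
  cintegral mu D (fun x => f x + g x) = cintegral mu D f + cintegral mu D g.
Proof.
move=> mD [a b] [c e]; apply: complex_eqP; rewrite /=.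
  by rewrite -RintegralD//; apply: eq_Rintegral => x _; rewrite Re_add.
by rewrite -RintegralD//; apply: eq_Rintegral => x _; rewrite Im_add.
Qed.

Lemma cintegralMl D z f : measurable D -> cint D f ->
  cintegral mu D (fun x => z * f x) = z * cintegral mu D f.
Proof.
move=> mD [a b]; apply: complex_eqP; rewrite ?Re_mul ?Im_mul /=.
  rewrite -!RintegralZl// -RintegralB//.
  - by apply: eq_Rintegral => x _; rewrite Re_mul.
  - by apply: (integrableZl _ _ a).
  - by apply: (integrableZl _ _ b).
rewrite -!RintegralZl// -RintegralD//.
- by apply: eq_Rintegral => x _; rewrite Im_mul.
- by apply: (integrableZl _ _ b).
- by apply: (integrableZl _ _ a).
Qed.

Lemma cintegralMr D z f : measurable D -> cint D f ->
  cintegral mu D (fun x => f x * z) = cintegral mu D f * z.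
Proof.
move=> mD cf; rewrite mulrC -cintegralMl//.
by congr (cintegral _ _ _); apply/funext => x; rewrite mulrC.
Qed.

Lemma cintegralN D f : measurable D -> cint D f ->
  cintegral mu D (fun x => - f x) = - cintegral mu D f.
Proof.
move=> mD cf; rewrite -mulN1r -cintegralMl//.
by congr (cintegral _ _ _); apply/funext => x; rewrite mulN1r.
Qed.

Lemma cintN D f : measurable D -> cint D f -> cint D (fun x => - f x).
Proof.
by move=> mD cf; under eq_fun do rewrite -mulN1r; exact: cintMl.
Qed.

Lemma cintegralB D f g : measurable D -> cint D f -> cint D g ->
  cintegral mu D (fun x => f x - g x) = cintegral mu D f - cintegral mu D g.
Proof. by move=> mD cf cg; rewrite cintegralD ?cintegralN//; exact: cintN. Qed.

Lemma eq_cintegral D f g : {in D, f =1 g} -> cintegral mu D f = cintegral mu D g.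
Proof.
by move=> fg; apply: complex_eqP; apply: eq_Rintegral => x xD; rewrite fg.
Qed.

Lemma cintegral_negligible_congr D f g : {ae mu, forall x, D x -> f x = g x} ->
  cintegral mu D f = cintegral mu D g.
Proof.
move=> fg; apply: complex_eqP; congr fine; apply: integral_negligible_congr;
by apply: filterS fg => x fg /fg ->.
Qed.

Lemma Re_cintegral D f : Re (cintegral mu D f) = \int[mu]_(x in D) Re (f x).
Proof. by []. Qed.

(* Rotate the value of the integral onto the real axis. *)
Lemma nsq_cintegral D f : measurable D -> cint D f ->
  nsq (cintegral mu D f) =
  \int[mu]_(x in D) Re (conjc (cintegral mu D f) * f x).
Proof.
move=> mD cf; rewrite -Re_cintegral cintegralMl// mulrC.
by rewrite mulc_conj.
Qed.

(** Multiplied by the modulus of the integral, the left side becomes [nsq], which [nsq_cintegral]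
    writes as the integral of a real part; that real part is bounded pointwise. *)
Lemma le_normc_cintegral D f : measurable D -> cint D f ->
  normc (cintegral mu D f) <= \int[mu]_(x in D) normc (f x).
Proof.
move=> mD cf; set c := cintegral mu D f.
have [c0|c0] := eqVneq (normc c) 0.
  by rewrite c0 Rintegral_ge0// => x _; exact: normc_ge0.
have cp : 0 < normc c by rewrite lt_neqAle eq_sym c0 normc_ge0.
rewrite -(ler_pM2l cp) -expr2 -nsqE /c nsq_cintegral// -/c.
have := integrable_normc mD cf => inf.
rewrite -RintegralZl//; apply: le_Rintegral => //.
- by have [] := cintMl (conjc c) mD cf.
- exact: (integrableZl mD (normc c) inf).
- move=> x Dx; rewrite (le_trans (ler_norm _))// (le_trans (normc_Re _))//.
  by rewrite Normc.normcM normc_conj.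
Qed.

Lemma cintegral_dct D (f_ : nat -> T -> R[i]) f (g : T -> R) :
  measurable D -> (forall n, cmeas D (f_ n)) -> cmeas D f ->
  mu.-integrable D (EFin \o g) ->
  {ae mu, forall x, D x -> ccvg (f_ ^~ x) (f x)} ->
  {ae mu, forall x n, D x -> normc (f_ n x) <= g x} ->
  ccvg (fun n => cintegral mu D (f_ n)) (cintegral mu D f).
Proof.
move=> mD mf_ mf ig cf fg.
have H (h : R[i] -> R) : (forall z, `|h z| <= normc z) ->
    (forall n, measurable_fun D (fun x => h (f_ n x))) ->
    measurable_fun D (fun x => h (f x)) ->
    {ae mu, forall x, D x -> (fun n => h (f_ n x)) @ \oo --> h (f x)} ->
    (fun n => \int[mu]_(x in D) h (f_ n x)) @ \oo --> \int[mu]_(x in D) h (f x).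
  move=> hn mh mhf ch.
  have [|||||ih _] := @dominated_convergence _ _ _ mu D mD
    (fun n x => (h (f_ n x))%:E) (fun x => (h (f x))%:E) (EFin \o g).
  - by move=> n; exact/measurable_EFinP.
  - exact/measurable_EFinP.
  - apply: filterS ch => x /[apply] ch; apply/fine_cvgP; split => //.
    exact: nearW.
  - by [].
  - apply: filterS fg => x fg n Dx /=; rewrite lee_fin.
    by rewrite (le_trans (hn _))// fg.
  - move=> H; apply: fine_cvg.
    by rewrite /Rintegral fineK//; exact: integrable_fin_num.
split; apply: H => //.
- exact: normc_Re.
- by move=> n; case: (mf_ n).
- by case: mf.
- by apply: filterS cf => x cf /cf[].
- exact: normc_Im.
- by move=> n; case: (mf_ n).
- by case: mf.
- by apply: filterS cf => x cf /cf[].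
Qed.

End complex_integration.

Section image_measure.
Context d d' (T : measurableType d) (T' : measurableType d') (R : realType).
Variables (mu : {measure set T -> \bar R}) (nu : {measure set T' -> \bar R}).
Variable phi : T -> T'.
Hypothesis mphi : measurable_fun setT phi.
Hypothesis nuE : forall A, measurable A -> nu A = mu (phi @^-1` A).

Lemma ge0_integral_image (f : T' -> \bar R) : measurable_fun setT f ->
  (forall y, 0 <= f y)%E -> (\int[nu]_y f y = \int[mu]_x f (phi x))%E.
Proof.
move=> mf f0.
rewrite (eq_measure_integral (pushforward mu phi)).
  by rewrite ge0_integral_pushforward//= preimage_setT.
by move=> A mA _; rewrite nuE.
Qed.

Lemma integral_image (f : T' -> \bar R) : measurable_fun setT f ->
  (\int[nu]_y f y = \int[mu]_x f (phi x))%E.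
Proof.
move=> mf; rewrite integralE [RHS]integralE.
congr (_ - _)%E.
  have := @ge0_integral_image f^\+%E (measurable_funepos mf) (fun=> funepos_ge0 _ _).
  by move=> ->; apply: eq_integral => x _; rewrite !funeposE.
have := @ge0_integral_image f^\-%E (measurable_funeneg mf) (fun=> funeneg_ge0 _ _).
by move=> ->; apply: eq_integral => x _; rewrite !funenegE.
Qed.

Lemma cintegral_image (f : T' -> R[i]) : cmeas setT f ->
  cintegral nu setT f = cintegral mu setT (fun x => f (phi x)).
Proof.
move=> [mf1 mf2]; apply: complex_eqP; rewrite /= /Rintegral.
  by rewrite integral_image//; exact/measurable_EFinP.
by rewrite integral_image//; exact/measurable_EFinP.
Qed.

End image_measure.

Section complex_fubini.
Context d1 d2 (T1 : measurableType d1) (T2 : measurableType d2) (R : realType).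
Variable m1 : {sigma_finite_measure set T1 -> \bar R}.
Variable m2 : {sigma_finite_measure set T2 -> \bar R}.
Variable f : T1 * T2 -> R[i].
Hypothesis fi : cint (m1 \x m2)%E setT f.

Let Rfubini1 (h : T1 * T2 -> R) : (m1 \x m2)%E.-integrable setT (EFin \o h) ->
  \int[m1]_x \int[m2]_y h (x, y) = \int[(m1 \x m2)%E]_z h z.
Proof.
move=> ih; rewrite /Rintegral -(integral12_prod_meas1 ih); congr fine.
(* The inner integral is finite for almost every x, and only there does [fine] preserve it. *)
apply: integral_negligible_congr; apply: filterS (ae_integrable1 ih) => x ihx _.
by rewrite fineK//; exact: integrable_fin_num.
Qed.

Let Rfubini2 (h : T1 * T2 -> R) : (m1 \x m2)%E.-integrable setT (EFin \o h) ->
  \int[m2]_y \int[m1]_x h (x, y) = \int[(m1 \x m2)%E]_z h z.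
Proof.
move=> ih; rewrite /Rintegral -(integral21_prod_meas1 ih); congr fine.
apply: integral_negligible_congr; apply: filterS (ae_integrable2 ih) => x ihx _.
by rewrite fineK//; exact: integrable_fin_num.
Qed.

Lemma cintegral_fubini1 : cintegral m1 setT (fun x => cintegral m2 setT (fun y => f (x, y))) =
  cintegral (m1 \x m2)%E setT f.
Proof. by have [a b] := fi; apply: complex_eqP; exact: Rfubini1. Qed.

Lemma cintegral_fubini2 : cintegral m2 setT (fun y => cintegral m1 setT (fun x => f (x, y))) =
  cintegral (m1 \x m2)%E setT f.
Proof. by have [a b] := fi; apply: complex_eqP; exact: Rfubini2. Qed.

End complex_fubini.

Section product_integrability.
Context d1 d2 (T1 : measurableType d1) (T2 : measurableType d2) (R : realType).
Variable m1 : {sigma_finite_measure set T1 -> \bar R}.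
Variable m2 : {sigma_finite_measure set T2 -> \bar R}.
Variable F : T1 * T2 -> R[i].
Hypothesis mF : cmeas setT F.

Let mnF : measurable_fun setT (fun z => (normc (F z))%:E).
Proof. by apply/measurable_EFinP; exact: measurable_normc. Qed.

Let nF0 z : (0 <= (normc (F z))%:E)%E.
Proof. by rewrite lee_fin normc_ge0. Qed.

Let cint_of_lt : (\int[m1 \x m2]_z (normc (F z))%:E < +oo)%E -> cint (m1 \x m2)%E setT F.
Proof.
move=> lty; apply: (@cint_le _ _ _ (m1 \x m2)%E setT _ (fun z => normc (F z))) => //.
apply/integrableP; split => //; apply: le_lt_trans lty.
rewrite le_eqVlt; apply/orP; left; apply/eqP; apply: eq_integral => z _.
by rewrite gee0_abs//; exact: nF0.
Qed.

Lemma cint_prod_le1 (g : T1 -> R) : m1.-integrable setT (EFin \o g) ->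
  (forall x, (\int[m2]_y (normc (F (x, y)))%:E <= (g x)%:E)%E) ->
  cint (m1 \x m2)%E setT F.
Proof.
move=> /integrableP[mg ig] Fg; apply: cint_of_lt.
rewrite (fubini_tonelli1 (fun z => (normc (F z))%:E))//.
apply: le_lt_trans ig; apply: ge0_le_integral => //.
- by move=> x _; apply: integral_ge0.
- exact: (measurable_fun_fubini_tonelli_F (fun z => (normc (F z))%:E)).
- exact: measurableT_comp.
- by move=> x _; rewrite (le_trans (Fg x))// lee_abs.
Qed.

Lemma cint_prod_le2 (g : T2 -> R) : m2.-integrable setT (EFin \o g) ->
  (forall y, (\int[m1]_x (normc (F (x, y)))%:E <= (g y)%:E)%E) ->
  cint (m1 \x m2)%E setT F.
Proof.
move=> /integrableP[mg ig] Fg; apply: cint_of_lt.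
rewrite (fubini_tonelli2 (fun z => (normc (F z))%:E))//.
apply: le_lt_trans ig; apply: ge0_le_integral => //.
- by move=> x _; apply: integral_ge0.
- exact: (measurable_fun_fubini_tonelli_G (fun z => (normc (F z))%:E)).
- exact: measurableT_comp.
- by move=> x _; rewrite (le_trans (Fg x))// lee_abs.
Qed.

End product_integrability.

(** * The space L^2 *)

Section L2_theory.
Context {R : realType}.
Local Notation leb := (@lebesgue_measure R).
Implicit Types (f g h : R -> R[i]).

Definition N2 f : \bar R := (\int[leb]_x (nsq (f x))%:E)%E.

Lemma N2_ge0 f : (0 <= N2 f)%E.
Proof. by apply: integral_ge0 => x _; rewrite lee_fin nsq_ge0. Qed.

Lemma L2normE f : L2norm f = (N2 f `^ 2^-1)%E.
Proof.
rewrite /L2norm unlock /N2; congr (_ `^ _)%E; apply: eq_integral => x _ /=.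
by rewrite ger0_norm ?normc_ge0// powR_mulrn ?normc_ge0// nsqE.
Qed.

Lemma L2norm_lt f (e : R) : 0 < e -> (L2norm f < e%:E)%E = (N2 f < (e ^+ 2)%:E)%E.
Proof.
move=> e0; rewrite L2normE.
have := N2_ge0 f; case: (N2 f) => [r|_|//].
  rewrite lee_fin => r0; rewrite poweR_EFin !lte_fin.
  rewrite powR12_sqrt// -[in LHS](ger0_norm (ltW e0)) -sqrtr_sqr.
  by rewrite ltr_sqrt// exprn_gt0.
by rewrite poweRyr// !ltNge !leey.
Qed.

Lemma L2P f : L2 f <-> cmeas setT f /\ (N2 f < +oo)%E.
Proof.
split=> [[a b]|[[a b] Nf]].
  have ma : measurable_fun setT (fun x => Re (f x)).
    by move: a; rewrite inE => /andP[]; rewrite inE.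
  have mb : measurable_fun setT (fun x => Im (f x)).
    by move: b; rewrite inE => /andP[]; rewrite inE.
  split => //; have /integrableP[_ ] :=
    integrableD measurableT (Lfun2_integrable_sqr a) (Lfun2_integrable_sqr b).
  apply: le_lt_trans; rewrite le_eqVlt; apply/orP; left; apply/eqP.
  by apply: eq_integral => x _ /=; rewrite ger0_norm// nsq_ge0.
have H (h : R[i] -> R) : measurable_fun setT (fun x => h (f x)) ->
    (forall z, h z ^+ 2 <= nsq z) -> (fun x => h (f x)) \in Lfun leb 2%:E.
  move=> mh hn; rewrite inE; apply/andP; split; rewrite inE//=.
  rewrite /finite_norm unlock poweR_lty//.
  apply: le_lt_trans Nf; apply: ge0_le_integral => //=.
  - apply/measurable_EFinP.
    apply: (measurableT_comp (measurable_powR _)) => //.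
    exact: measurableT_comp.
  - by apply/measurable_EFinP; apply: measurable_nsq.
  - by move=> x _; rewrite lee_fin powR_mulrn// real_normK ?num_real.
by split; apply: H => // z; rewrite /nsq ?lerDl ?lerDr sqr_ge0.
Qed.

Lemma L2_cmeas f : L2 f -> cmeas setT f.
Proof. by move/L2P => []. Qed.

Lemma integrable_nsq f : L2 f -> leb.-integrable setT (fun x => (nsq (f x))%:E).
Proof.
move/L2P => [mf Nf]; apply/integrableP; split.
  by apply/measurable_EFinP; exact: measurable_nsq.
apply: le_lt_trans Nf; rewrite le_eqVlt; apply/orP; left; apply/eqP.
by apply: eq_integral => x _ /=; rewrite ger0_norm// nsq_ge0.
Qed.

Lemma L2_nsq_le f (g : R -> R) : cmeas setT f ->
  leb.-integrable setT (EFin \o g) -> (forall x, nsq (f x) <= g x) -> L2 f.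
Proof.
move=> mf ig fg; apply/L2P; split => //.
have /integrableP[mg] := ig; apply: le_lt_trans; apply: ge0_le_integral => //.
- by move=> x _; rewrite lee_fin nsq_ge0.
- by apply/measurable_EFinP; exact: measurable_nsq.
- exact: measurableT_comp.
- by move=> x _; rewrite lee_fin (le_trans (fg x)) ?ler_norm.
Qed.

Lemma L2D f g : L2 f -> L2 g -> L2 (fun x => f x + g x).
Proof.
move=> Lf Lg; apply: (@L2_nsq_le _ (fun x => 2 * nsq (f x) + 2 * nsq (g x))).
- by apply: cmeasD; exact: L2_cmeas.
- apply: (@integrableD _ _ _ leb setT measurableT (fun x => (2 * nsq (f x))%:E)
    (fun x => (2 * nsq (g x))%:E)).
    by apply: (@integrableZl _ _ _ leb _ measurableT 2 (fun x => (nsq (f x))%:E));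
      exact: integrable_nsq.
  by apply: (@integrableZl _ _ _ leb _ measurableT 2 (fun x => (nsq (g x))%:E));
    exact: integrable_nsq.
- by move=> x; exact: nsqD_le.
Qed.

Lemma L2_mul_le1 f (m : R -> R[i]) : L2 f -> cmeas setT m ->
  (forall x, normc (m x) <= 1) -> L2 (fun x => m x * f x).
Proof.
move=> Lf mm m1; apply: (L2_nsq_le _ (integrable_nsq Lf)).
  by apply: cmeasM => //; exact: L2_cmeas.
move=> x /=; rewrite nsqM ler_piMl ?nsq_ge0// nsqE expr_le1//.
exact: normc_ge0.
Qed.

Lemma L2N f : L2 f -> L2 (fun x => - f x).
Proof.
move=> Lf; rewrite (_ : (fun x => - f x) = fun x => -1 * f x); last first.
  by apply/funext => x; rewrite mulN1r.
apply: L2_mul_le1 => //.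
by move=> _; rewrite normc_sqrt /nsq/= oppr0 expr0n addr0 sqrrN expr1n sqrtr1.
Qed.

Lemma L2B f g : L2 f -> L2 g -> L2 (fun x => f x - g x).
Proof. by move=> Lf Lg; apply: L2D => //; exact: L2N. Qed.

(** The right side is a measure in A with the right values on half-open intervals, and these
    determine Lebesgue measure. *)
Lemma lebesgue_translation (a : R) (A : set R) : measurable A ->
  leb A = leb ((fun x => x + a) @^-1` A).
Proof.
move=> mA.
rewrite -[RHS]/(pushforward leb (fun x : measurableTypeR R => x + a : measurableTypeR R) A).
apply: lebesgue_measure_unique => //=; first by apply: measurable_funD.
move=> _ _ [[p q]] _ <-; rewrite /pushforward /=.
rewrite (_ : _ @^-1` _ = `]p - a, q - a]%classic); last first.
  by apply/seteqP; split => x /=; rewrite !in_itv/= lerBrDr ltrBlDr.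
rewrite !lebesgue_measure_itv/= !lte_fin ltrD2r; case: ifPn => // _.
by rewrite -!EFinB; congr EFin; ring.
Qed.

Lemma ge0_integral_translation (a : R) (f : R -> \bar R) : measurable_fun setT f ->
  (forall x, 0 <= f x)%E -> (\int[leb]_x f (x + a)%R = \int[leb]_x f x)%E.
Proof.
move=> mf f0; apply/esym.
apply: (ge0_integral_image (phi := fun x : measurableTypeR R => x + a : measurableTypeR R)) => //.
  by apply: measurable_funD.
exact: lebesgue_translation.
Qed.

Lemma cintegral_translation (a : R) f : cmeas setT f ->
  cintegral leb setT (fun x => f (x + a)) = cintegral leb setT f.
Proof.
move=> mf; apply/esym.
apply: (cintegral_image (phi := fun x : measurableTypeR R => x + a : measurableTypeR R)) => //.
  by apply: measurable_funD.
exact: lebesgue_translation.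
Qed.

Lemma cmeas_translation (a : R) f : cmeas setT f -> cmeas setT (fun x : R => f (x + a)).
Proof. by move=> mf; apply: (cmeas_comp mf); apply: measurable_funD. Qed.

Lemma L2_translation (a : R) f : L2 f -> L2 (fun x => f (x + a)).
Proof.
move=> /L2P[mf Nf]; apply/L2P; split; first exact: cmeas_translation.
rewrite /N2 (ge0_integral_translation a (f := fun x => (nsq (f x))%:E))//.
  by apply/measurable_EFinP; exact: measurable_nsq.
by move=> x; rewrite lee_fin nsq_ge0.
Qed.

Lemma ae_translation (a : R) (S : set R) : {ae leb, forall x, S x} ->
  {ae leb, forall x, S (x + a)}.
Proof.
move=> [N [mN N0 SN]]; exists ((fun x => x + a) @^-1` N); split.
- rewrite -[X in measurable X]setTI.
  by apply: (_ : measurable_fun setT (fun x : R => x + a)) => //; apply: measurable_funD.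
- by rewrite -lebesgue_translation.
- by move=> x /= Sx; apply: SN.
Qed.

Lemma cint_inner f g : L2 f -> L2 g -> cint leb setT (fun x => f x * conjc (g x)).
Proof.
move=> Lf Lg; apply: (@cint_le _ _ _ leb setT _ (fun x => 2^-1 * (nsq (f x) + nsq (g x)))) => //.
- by apply: cmeasM; [exact: L2_cmeas|apply: cmeas_conj; exact: L2_cmeas].
- apply: (@integrableZl _ _ _ leb setT measurableT 2^-1
    (fun x => (nsq (f x) + nsq (g x))%:E)).
  apply: (@integrableD _ _ _ leb setT measurableT (fun x => (nsq (f x))%:E)
    (fun x => (nsq (g x))%:E)); exact: integrable_nsq.
- move=> x _; rewrite -(@ler_pM2l _ 2)// mulrA divff// mul1r.
  by rewrite -(nsq_conj (g x)); exact: normcM_le.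
Qed.

Lemma L2innerB f g h : L2 f -> L2 g -> L2 h ->
  L2inner (fun x => f x - g x) h = L2inner f h - L2inner g h.
Proof.
move=> Lf Lg Lh; rewrite /L2inner -cintegralB//; try exact: cint_inner.
by congr (cintegral _ _ _); apply/funext => x; rewrite mulrBl.
Qed.

Lemma L2inner_congr f f' g g' : f = f' %[ae leb] -> g = g' %[ae leb] ->
  L2inner f g = L2inner f' g'.
Proof.
move=> ff gg; apply: cintegral_negligible_congr.
apply: (ae_imply2 _ ff gg).
by move=> x fx gx _; rewrite fx// gx.
Qed.

Lemma N2_eq0 f : cmeas setT f -> N2 f = 0%E -> f = (fun=> 0) %[ae leb].
Proof.
move=> mf N0; have : ae_eq leb setT (fun x => (nsq (f x))%:E) (cst 0%E).
  apply/ae_eq_integral_abs => //; first by apply/measurable_EFinP; exact: measurable_nsq.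
  rewrite -[RHS]N0; apply: eq_integral => x _ /=.
  by rewrite ger0_norm// nsq_ge0.
by apply: filterS => x H _; apply: nsq_eq0; have [] := H I.
Qed.

Lemma L2inner_self f : L2 f -> L2inner f f = (fine (N2 f))%:C.
Proof.
move=> Lf; apply: complex_eqP; rewrite /=.
  by apply: eq_Rintegral => x _; rewrite mulc_conj.
by under eq_Rintegral do rewrite mulc_conj; rewrite Rintegral_cst// mul0r.
Qed.

Lemma L2inner_eq0 f : L2 f -> L2inner f f = 0 -> f = (fun=> 0) %[ae leb].
Proof.
move=> Lf; rewrite L2inner_self// => -[] f0; apply: N2_eq0; first exact: L2_cmeas.
apply/eqP; rewrite -fine_eq0 ?f0// ge0_fin_numE ?N2_ge0//.
by have /L2P[] := Lf.
Qed.

End L2_theory.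

(** * Density of bounded functions and uniqueness of continuous extensions *)

Section L2_extension.
Context {R : realType}.
Local Notation leb := (@lebesgue_measure R).
Implicit Types (f g : R -> R[i]).

Lemma N2_congr f g : f = g %[ae leb] -> N2 f = N2 g.
Proof.
move=> fg; apply: integral_negligible_congr.
by apply: (ae_imply2 _ fg fg) => x fgx _ _; rewrite fgx.
Qed.

Lemma N2D_le f g : cmeas setT f -> cmeas setT g ->
  (N2 (fun x => f x + g x)%R <= 2%:E * N2 f + 2%:E * N2 g)%E.
Proof.
move=> mf mg; rewrite /N2 -!ge0_integralZl//; first last.
- by move=> x _; rewrite lee_fin nsq_ge0.
- by apply/measurable_EFinP; exact: measurable_nsq.
- by move=> x _; rewrite lee_fin nsq_ge0.
- by apply/measurable_EFinP; exact: measurable_nsq.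
rewrite -ge0_integralD//; first last.
- by apply/measurable_EFinP; apply: measurable_funM => //; exact: measurable_nsq.
- by move=> x _; rewrite lee_fin mulr_ge0// nsq_ge0.
- by apply/measurable_EFinP; apply: measurable_funM => //; exact: measurable_nsq.
- by move=> x _; rewrite lee_fin mulr_ge0// nsq_ge0.
apply: ge0_le_integral => //.
- by move=> x _; rewrite lee_fin nsq_ge0.
- by apply/measurable_EFinP; apply: measurable_nsq; exact: cmeasD.
- apply: emeasurable_funD; apply/measurable_EFinP; apply: measurable_funM => //;
  exact: measurable_nsq.
- by move=> x _; rewrite -!EFinM -EFinD lee_fin nsqD_le.
Qed.

Lemma N2_subC f g : N2 (fun x => f x - g x) = N2 (fun x => g x - f x).
Proof.
apply: eq_integral => x _; congr EFin.
by rewrite /nsq !Re_add !Im_add !Re_opp !Im_opp; ring.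
Qed.

(** Values of modulus above n are sent to 0, not clamped: the difference with f is then everywhere 0
    or f, and |f|^2 dominates its square. *)
Definition trunc (n : nat) f (x : R) : R[i] :=
  (\1_[set y | normc (f y) <= n%:R] x)%:C * f x.

Lemma trunc_bounded n f : bounded (trunc n f).
Proof.
exists n%:R => x; rewrite /trunc indicE.
case: (boolP (x \in _)) => [/set_mem/= fx|_] /=; last by rewrite mul0r Normc.normc0.
by rewrite mul1r.
Qed.

Let cmeas_cut n f : cmeas setT f ->
  cmeas setT (fun x => (\1_[set y | normc (f y) <= n%:R] x)%:C : R[i]).
Proof.
move=> mf; split => /=; last exact: measurable_cst.
apply: measurable_indic.
have := measurable_normc mf measurableT (@measurable_itv _ `]-oo, n%:R]%R).
rewrite setTI; congr (measurable _); apply/seteqP.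
Qed.

Lemma L2_trunc n f : L2 f -> L2 (trunc n f).
Proof.
move=> Lf; apply: L2_mul_le1 => //; first by apply: cmeas_cut; exact: L2_cmeas.
move=> x; rewrite indicE; case: (_ \in _); rewrite ?Normc.normc0 ?ler01//.
by rewrite Normc.normc1.
Qed.

Lemma bounded_L2_dense f (e : R) : L2 f -> 0 < e ->
  exists g, [/\ L2 g, bounded g & (L2norm (f \- g)%R < e%:E)%E].
Proof.
move=> Lf e0.
have : (fun n => N2 (f \- trunc n f)%R) @ \oo --> 0%E.
  have mn n : cmeas setT (f \- trunc n f)%R.
    by apply: L2_cmeas; apply: L2B => //; exact: L2_trunc.
  have [|||||_ _] := @dominated_convergence _ _ _ leb setT measurableT
    (fun n x => (nsq ((f \- trunc n f)%R x))%:E) (cst 0%E)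
    (fun x => (nsq (f x))%:E).
  - by move=> n; apply/measurable_EFinP; exact: measurable_nsq (mn n).
  - exact: measurable_cst.
  - apply: aeW => x _; apply: cvg_near_cst; near=> n.
    rewrite /= /trunc indicE mem_set/=; last first.
      by near: n; exact: nbhs_infty_ger.
    by rewrite mul1r subrr /nsq/= expr0n addr0.
  - exact: integrable_nsq.
  - apply: aeW => x n _; rewrite /= lee_fin ger0_norm ?nsq_ge0//.
    rewrite /trunc indicE; case: (_ \in _); rewrite ?mul0r ?subr0//.
    by rewrite mul1r subrr /nsq/= expr0n addr0 nsq_ge0.
  by rewrite integral0.
move=> /fine_cvgP[_ /cvgrPdist_lt /(_ (e ^+ 2))].
have e20 : 0 < e ^+ 2 by rewrite exprn_gt0.
move=> /(_ e20)[n _ /(_ n (leqnn n))]; rewrite sub0r normrN => H.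
exists (trunc n f); split; [exact: L2_trunc|exact: trunc_bounded|].
rewrite L2norm_lt//.
have /L2P[_ N2f] : L2 (f \- trunc n f)%R by apply: L2B => //; exact: L2_trunc.
rewrite -[N2 _]fineK ?ge0_fin_numE ?N2_ge0// lte_fin.
exact: le_lt_trans (ler_norm _) H.
Unshelve. all: by end_near. Qed.

(** Take a bounded g close to f, where A and B agree almost everywhere; then A f - B f splits into A
    f - A g and B g - B f, both small by continuity at f. *)
Lemma continuous_L2_extension_unique op (A B : (R -> R[i]) -> R -> R[i]) f :
  continuous_L2_extension op A -> continuous_L2_extension op B -> L2 f ->
  A f = B f %[ae leb].
Proof.
move=> [LA cA opA] [LB cB opB] Lf.
have LAB : L2 (fun x => A f x - B f x) by apply: L2B; [exact: LA|exact: LB].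
suff N0 : N2 (fun x => A f x - B f x) = 0%E.
  have := N2_eq0 (L2_cmeas LAB) N0.
  by move=> H; apply: (ae_imply2 _ H H) => x + _ xT => /(_ xT)/eqP; rewrite subr_eq0 => /eqP.
apply/eqP; rewrite eq_le N2_ge0 andbT; apply/lee_addgt0Pr => r r0; rewrite add0e.
(* [N2D_le] costs a factor 2 on each of the two terms, and 2 e^2 + 2 e^2 = r. *)
pose e := Num.sqrt (r / 4); have e0 : 0 < e by rewrite sqrtr_gt0 divr_gt0.
have [a a0 Ha] := cA f Lf e e0; have [b b0 Hb] := cB f Lf e e0.
have ab0 : 0 < Num.min a b by rewrite lt_min a0.
have [g [Lg bg fg]] := bounded_L2_dense Lf ab0.
have {}Ha : (L2norm (A f \- A g)%R < e%:E)%E.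
  by apply: Ha => //; apply: lt_le_trans fg _; rewrite lee_fin ge_min lexx.
have {}Hb : (L2norm (B f \- B g)%R < e%:E)%E.
  by apply: Hb => //; apply: lt_le_trans fg _; rewrite lee_fin ge_min lexx orbT.
have AB : A g = B g %[ae leb].
  by apply: (ae_imply2 _ (opA _ Lg bg) (opB _ Lg bg)) => x + + xT => -> // ->.
have -> : N2 (fun x => A f x - B f x) =
    N2 (fun x => (A f x - A g x) + (B g x - B f x)).
  apply: N2_congr; apply: (ae_imply2 _ AB AB) => x ABx _ xT.
  by rewrite ABx// [RHS]addrA subrK.
have mA : cmeas setT (fun x => A f x - A g x).
  by apply: L2_cmeas; apply: L2B; exact: LA.
have mB : cmeas setT (fun x => B g x - B f x).
  by apply: L2_cmeas; apply: L2B; exact: LB.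
apply: (le_trans (N2D_le mA mB)).
rewrite L2norm_lt// in Ha; rewrite L2norm_lt// in Hb.
rewrite (N2_subC (B g)).
apply: (@le_trans _ _ (2%:E * (e ^+ 2)%:E + 2%:E * (e ^+ 2)%:E)%E).
  by apply: leeD; rewrite lee_pmul2l// ltW.
have -> : e ^+ 2 = r / 4 by rewrite sqr_sqrtr// divr_ge0// ltW.
rewrite -!EFinM -EFinD lee_fin; lra.
Qed.

Lemma contraction_L2_extension (op : (R -> R[i]) -> R -> R[i]) :
  (forall f, L2 f -> L2 (op f)) ->
  (forall f g, L2 f -> L2 g -> (N2 (op f \- op g)%R <= N2 (f \- g)%R)%E) ->
  unique_continuous_L2_extension op op.
Proof.
move=> Lop cop; have ext : continuous_L2_extension op op.
  split => //; last by move=> f Lf _; apply: aeW.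
  move=> f Lf e e0; exists e => // g Lg.
  by rewrite !L2norm_lt//; apply: le_lt_trans; exact: cop.
by split => // A Aext f Lf; exact: continuous_L2_extension_unique Aext ext Lf.
Qed.

End L2_extension.

Section probability_integrals.
Context d (T : measurableType d) (R : realType) (P : probability T R).

Lemma cint_bounded (f : T -> R[i]) (M : R) : cmeas setT f ->
  (forall x, normc (f x) <= M) -> cint P setT f.
Proof.
move=> mf fM; apply: (@cint_le _ _ _ P setT _ (fun=> M)) => //.
by apply: finite_measure_integrable_cst.
Qed.

Lemma Rintegral_probability_cst (r : R) : \int[P]_w r = r.
Proof.
rewrite Rintegral_cst// [X in fine X](_ : _ = 1%E) ?mulr1//.
exact: probability_setT.
Qed.

Lemma cintegral_probability_cst (z : R[i]) : cintegral P setT (fun=> z) = z.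
Proof. by apply: complex_eqP; exact: Rintegral_probability_cst. Qed.

Lemma normc_cexp_i (x : R) : normc (cexp (x *i)) = 1.
Proof. by rewrite normc_cexp/= expR0. Qed.

Lemma cmeas_cexp_i (g : T -> R) : measurable_fun setT g ->
  cmeas setT (fun w => cexp ((g w) *i) : R[i]).
Proof. by move=> mg; apply: cmeas_cexp; split => //=; exact: measurable_cst. Qed.

Lemma cint_cexp_i (g : T -> R) : measurable_fun setT g ->
  cint P setT (fun w => cexp ((g w) *i)).
Proof.
move=> mg; apply: (cint_bounded (M := 1)); first exact: cmeas_cexp_i.
by move=> x; rewrite normc_cexp_i.
Qed.

Lemma ccvg_cexp_i (u : nat -> R) (l : R) : u @ \oo --> l ->
  ccvg (fun n => cexp ((u n) *i)) (cexp (l *i)).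
Proof. by move=> ul; apply: ccvg_cexp; split => //=; exact: cvg_cst. Qed.

Lemma ccvg_charfun (g_ : nat -> T -> R) (g : T -> R) :
  (forall n, measurable_fun setT (g_ n)) -> measurable_fun setT g ->
  {ae P, forall w, (fun n => g_ n w) @ \oo --> g w} ->
  ccvg (fun n => cintegral P setT (fun w => cexp ((g_ n w) *i)))
       (cintegral P setT (fun w => cexp ((g w) *i))).
Proof.
move=> mg_ mg gg; apply: (@cintegral_dct _ _ _ P setT _ _ (fun=> 1)) => //.
- by move=> n; exact: cmeas_cexp_i.
- exact: cmeas_cexp_i.
- by apply: finite_measure_integrable_cst.
- by apply: filterS gg => w gw _; exact: ccvg_cexp_i.
- by apply: aeW => w n _; rewrite normc_cexp_i.
Qed.

End probability_integrals.

(** * Lévy processes *)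

Section regular_version.
Context d (T : measurableType d) (R : realType) (P : probability T R).

Definition cadlag (p : R -> R) := forall u,
  (p v @[v --> u^'+] --> p u) /\ cvg (p v @[v --> u^'-]).

(** The path conditions hold for every w and every real time, so that later pointwise arguments
    carry neither a null set nor a sign condition. Agreement with X is off a single null set for all
    times together, which permits substitution inside functionals of the whole path. *)
Definition regular_version (X : R -> T -> R) (X' : R -> T -> R) := [/\
  (forall u, measurable_fun setT (X' u)),
  (forall u w, u <= 0 -> X' u w = 0),
  (forall w, cadlag (X' ^~ w)) &
  {ae P, forall w, forall u, 0 <= u -> X u w = X' u w}].

(** Paths in a measurable null set containing all irregular ones are replaced by 0, and negative
    times are sent to time 0. Multiplication by the indicator of a measurable set keeps every X' u
    measurable. *)
Lemma levy_regular_version (X : R -> {RV P >-> R}) : levy_process X ->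
  exists X', regular_version X X'.
Proof.
move=> [[N0 [mN0 PN0 HN0]] _ _ [N1 [mN1 PN1 HN1]]].
pose N := N0 `|` N1.
have mN : measurable N by exact: measurableU.
have PN : P N = 0%E by rewrite null_set_setU.
have X00 w : ~ N w -> X 0 w = 0.
  by move=> Nw; apply: contrapT => h; apply: Nw; left; exact: HN0.
have Xc w : ~ N w ->
    (forall u : R, 0 <= u -> X v w @[v --> u^'+] --> X u w) /\
    (forall u : R, 0 < u -> cvg (X v w @[v --> u^'-])).
  by move=> Nw; apply: contrapT => h; apply: Nw; right; exact: HN1.
pose X' (u : R) w := \1_(~` N) w * X (Num.max 0 u) w.
have X'E u w : ~ N w -> X' u w = X (Num.max 0 u) w.
  by move=> Nw; rewrite /X' indicE mem_set// mul1r.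
have X'N u w : N w -> X' u w = 0.
  by move=> Nw; rewrite /X' indicE memNset ?mul0r//=; exact.
exists X'; split.
- move=> u; apply: measurable_funM => //.
  by apply: measurable_indic; exact: measurableC.
- move=> u w u0; have [/X'N->//|Nw] := pselect (N w).
  by rewrite X'E// max_l// X00.
- move=> w u; have [Nw|Nw] := pselect (N w).
    have -> : X' ^~ w = fun=> 0 by apply/funext => v; rewrite X'N.
    split; first by rewrite X'N//; exact: cvg_cst.
    exact: is_cvg_cst.
  have [Xr Xl] := Xc w Nw.
  have -> : X' ^~ w = fun v => X (Num.max 0 v) w by apply/funext => v; rewrite X'E.
  split.
    rewrite X'E//; have [u0|u0] := leP 0 u.
      apply: cvg_trans (Xr u u0); apply: near_eq_cvg.
      near=> v; have uv : u <= v by near: v; exact: nbhs_right_ge.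
      by rewrite max_r// (le_trans u0).
    rewrite X00//; apply: cvg_near_cst; near=> v.
    have v0 : v < 0 by near: v; exact: nbhs_right_lt.
    by rewrite max_l ?X00// ltW.
  have [u0|u0] := ltP 0 u.
    have /cvg_ex[l Hl] := Xl u u0.
    apply/cvg_ex; exists l; apply: cvg_trans Hl; apply: near_eq_cvg.
    near=> v; have v0 : 0 <= v by near: v; exact: nbhs_left_ge.
    by rewrite max_r.
  apply/cvg_ex; exists 0; apply: cvg_near_cst; near=> v.
  have vu : v <= u by near: v; exact: nbhs_left_le.
  by rewrite max_l ?X00// (le_trans vu).
- exists N; split => // w /= h; apply: contrapT => Nw; apply: h => u u0.
  by rewrite X'E// max_r.
Unshelve. all: by end_near. Qed.

(* A right-continuous process is the pointwise limit of its values at the next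
   point of the grid of mesh [1/(n+1)]. *)
Lemma regular_version_jointly_measurable (X X' : R -> T -> R) :
  regular_version X X' -> measurable_fun setT (fun z : R * T => X' z.1 z.2).
Proof.
move=> [mX X0 cX _].
pose k n (u : R) := Num.truncn (n.+1%:R * u).
pose g n (z : R * T) := X' ((k n z.1).+1%:R / n.+1%:R) z.2.
apply: (@measurable_fun_cvg _ _ _ setT g) => [n|[u w] _] /=.
  move=> _ B mB; rewrite setTI.
  have -> : g n @^-1` B = \bigcup_i ((k n @^-1` [set i]) `*`
      (X' (i.+1%:R / n.+1%:R) @^-1` B)).
    apply/seteqP; split => [[u w] /= gB|[u w] [i _ [/= <-]]//].
    by exists (k n u).
  apply: bigcup_measurable => i _; apply: measurableX.
    have mk : measurable_fun setT (fun u : R => (k n u)%:R : R).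
      apply: nondecreasing_measurable => // u v uv.
      by rewrite ler_nat le_truncn// ler_pM2l.
    have := mk measurableT _ (measurable_set1 i%:R); rewrite setTI.
    congr measurable; apply/seteqP; split => u /=; last by move=> ->.
    by move/eqP; rewrite eqr_nat => /eqP.
  rewrite -[X in measurable X]setTI; exact: mX.
have cvg_grid v : 0 <= v ->
    (k n v).+1%:R / n.+1%:R @[n --> \oo] --> v /\
    forall n, v < (k n v).+1%:R / n.+1%:R.
  move=> v0; have H n : v < (k n v).+1%:R / n.+1%:R.
    by rewrite ltr_pdivlMr// mulrC truncnS_gt.
  split => //; apply: (@squeeze_cvgr _ _ _ _ (fun=> v) (fun n => v + n.+1%:R^-1)).
  - apply: nearW => n; rewrite ltW//= ler_pdivrMr// mulrDl mulVf//.
    rewrite -natr1 lerD2r mulrC.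
    have /andP[] : (k n v)%:R <= n.+1%:R * v < (k n v).+1%:R.
      by rewrite truncn_itv// mulr_ge0.
    by [].
  - exact: cvg_cst.
  - rewrite -[X in _ --> X]addr0; apply: cvgD; first exact: cvg_cst.
    exact: cvg_harmonic.
have [u0|u0] := leP 0 u.
  have [H1 H2] := cvg_grid u u0.
  have [/cvg_at_rightP Xr _] := cX w u.
  by apply: (Xr (fun n => (k n u).+1%:R / n.+1%:R)).
(* For negative u the truncation is 0, so the samples are X' (1/(n+1)); they tend to X' 0, which is
   0 like X' u. *)
have k0 n : k n u = k n 0.
  rewrite /k mulr0 truncn0; apply/truncn0Pn; rewrite -ltNge.
  by rewrite (le_lt_trans _ ltr01)// mulr_ge0_le0// ltW.
have [H1 H2] := cvg_grid 0 (lexx 0).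
have [/cvg_at_rightP Xr _] := cX w 0.
rewrite X0 ?ltW// -(X0 0 w)// /g.
rewrite (_ : (fun n => _) = fun n => X' ((k n 0).+1%:R / n.+1%:R) w); last first.
  by apply/funext => n /=; rewrite k0.
by apply: (Xr (fun n => (k n 0).+1%:R / n.+1%:R)).
Qed.

(** Near x the path is bounded by |p x| + |l| + 1, where l is its left limit at x; compactness of
    the segment makes these local bounds uniform. *)
Lemma cadlag_bounded (p : R -> R) (a b : R) : cadlag p ->
  exists M, forall u, a <= u <= b -> `|p u| <= M.
Proof.
move=> cp; have := @segment_compact _ a b.
rewrite compact_near_coveringP.
move=> /(_ _ (pinfty_nbhs R) (fun (M : R) u => `|p u| <= M) _) ncov.
have [x _|M [_ HM]] := ncov.
  have [/cvgrPdist_le /(_ 1 ltr01) xr /cvg_ex[l /cvgrPdist_le /(_ 1 ltr01) xl]] := cp x.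
  pose M := `|p x| + `|l| + 1.
  exists ([set v | `|p v| <= M], [set i | M <= i]).
    split; last by apply: nbhs_pinfty_ge; exact: num_real.
    have xr' : \forall v \near x, x < v -> `|p x - p v| <= 1 by exact: xr.
    have xl' : \forall v \near x, v < x -> `|l - p v| <= 1 by exact: xl.
    apply: filterS2 xr' xl' => v hr hl /=.
    have [vx|vx|->] := ltgtP v x; last first.
    - by rewrite /M -addrA lerDl addr_ge0.
    - have := le_trans (ler_normB (p x) (p x - p v)) (lerD (lexx _) (hr vx)).
      rewrite opprB addrC subrK => /le_trans; apply.
      by rewrite /M lerD2r lerDl.
    - have := le_trans (ler_normB l (l - p v)) (lerD (lexx _) (hl vx)).
      rewrite opprB addrC subrK => /le_trans; apply.
      by rewrite /M lerD2r lerDr.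
  by move=> [v i] /= [pv]; exact: le_trans.
exists (M + 1) => u uab; apply: (HM (M + 1)); first by rewrite ltrDl.
by rewrite /= in_itv.
Qed.

End regular_version.

Section independence.
Context d (T : measurableType d) (R : realType) (P : probability T R).

(* [G] is a pi-system; independence extends to the generated sigma-algebra, and
   the joint law of [(id, D)] on [<<s G >> * borel] is a product measure. *)
Lemma cintegral_independentM (G : set (set T)) (D : T -> R) (Z : T -> R[i])
    (h : R -> R[i]) :
  (forall A, G A -> measurable A) -> setI_closed G -> G setT ->
  measurable_fun setT D ->
  (forall A B, G A -> measurable B ->
    P (A `&` D @^-1` B) = (P A * P (D @^-1` B))%E) ->
  cmeas setT (Z : g_sigma_algebraType G -> R[i]) -> cmeas setT h ->
  (forall x, normc (Z x) <= 1) -> (forall x, normc (h x) <= 1) ->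
  cintegral P setT (fun w => Z w * h (D w)) =
  cintegral P setT Z * cintegral P setT (fun w => h (D w)).
Proof.
move=> mG GI GT mD ind mZ mh Z1 h1.
pose TG : measurableType _ := g_sigma_algebraType G.
have sub (A : set T) : measurable (A : set TG) -> measurable A.
  by apply: smallest_sub => //; exact: sigma_algebra_measurable.
have mid : measurable_fun setT (id : T -> TG).
  by move=> _ A mA; rewrite setTI preimage_id; exact: sub.
have mpair : measurable_fun setT (fun w => (w, D w) : TG * R).
  exact: measurable_fun_pair mid mD.
have mDB B : measurable B -> measurable (D @^-1` B).
  by move=> mB; rewrite -[X in measurable X]setTI; exact: mD.
pose idM : {mfun T >-> TG} := HB.pack (id : T -> TG)
  (isMeasurableFun.Build _ _ _ _ _ mid).
pose DM : {mfun T >-> R} := HB.pack D (isMeasurableFun.Build _ _ _ _ _ mD).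
pose pM : {mfun T >-> (TG * R)%type} := HB.pack (fun w => (w, D w) : TG * R)
  (isMeasurableFun.Build _ _ _ _ _ mpair).
pose PG := distribution P idM; pose PD := distribution P DM.
pose PJ := distribution P pM.
have JE : forall A : set (TG * R), measurable A -> (PG \x PD)%E A = PJ A.
  apply: product_measure_unique => A B mA mB.
  change (P (A `&` D @^-1` B) = P A * P (D @^-1` B))%E.
  have PDB : P (D @^-1` B) \is a fin_num by apply: fin_num_measure; exact: mDB.
  have c0 : 0 <= fine (P (D @^-1` B)) by rewrite fine_ge0.
  rewrite [LHS](_ : _ = mrestr P (mDB _ mB) A)// (_ : P A * _ = mscale (NngNum c0) P A)%E.
    apply: (@g_sigma_algebra_measure_unique _ _ _ G _ (fun=> setT)) => //.
    - by rewrite -subTset => x _; exists 0%N.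
    - move=> C GC; rewrite [LHS](_ : _ = P (C `&` D @^-1` B))// ind//.
      by rewrite [RHS](_ : _ = (fine (P (D @^-1` B)))%:E * P C)%E// fineK// muleC.
    - move=> k; rewrite [X in (X < _)%E](_ : _ = P (setT `&` D @^-1` B))//.
      by rewrite setTI ltey_eq PDB.
  by rewrite [RHS](_ : _ = (fine (P (D @^-1` B)))%:E * P A)%E// fineK// muleC.
have mZh : cmeas setT (fun z : TG * R => Z z.1 * h z.2).
  apply: cmeasM.
    exact: (@cmeas_comp _ _ (TG * R)%type TG R setT fst Z mZ measurable_fst).
  exact: (@cmeas_comp _ _ (TG * R)%type R R setT snd h mh measurable_snd).
have iZh : cint (PG \x PD)%E setT (fun z : TG * R => Z z.1 * h z.2).
  apply: (@cint_bounded _ _ _ _ _ 1) => //.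
  by move=> x; rewrite Normc.normcM mulr_ile1// normc_ge0.
have iZ : cint PG setT (Z : TG -> R[i]).
  exact: (@cint_bounded _ _ _ _ _ 1).
have ih : cint PD setT h.
  exact: (@cint_bounded _ _ _ _ _ 1).
transitivity (cintegral (PG \x PD)%E setT (fun z : TG * R => Z z.1 * h z.2)).
  by apply/esym; apply: (@cintegral_image _ _ _ _ _ P (PG \x PD)%E (fun w => (w, D w) : TG * R)).
rewrite -cintegral_fubini1//.
transitivity (cintegral PG setT (fun x : TG => Z x * cintegral PD setT h)).
  by apply: eq_cintegral => x _; rewrite -cintegralMl.
rewrite cintegralMr//; congr (_ * _).
  by apply: (@cintegral_image _ _ _ _ _ P PG (id : T -> TG)).
exact: (@cintegral_image _ _ _ _ _ P PD D).
Qed.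

End independence.

(** * Characteristic functions of increments and regularity of the exponent *)

Section levy_characteristic.
Context d (T : measurableType d) (R : realType) (P : probability T R).
Variables (X : R -> {RV P >-> R}) (Phi : R -> R[i]).
Hypotheses (levyX : levy_process X) (expX : characteristic_exponent X Phi).

Lemma measurable_increment u v : measurable_fun setT (fun w => X v w - X u w).
Proof. exact: measurable_funB. Qed.

Lemma increment_charfun (u h y : R) : 0 <= u -> 0 <= h ->
  cintegral P setT (fun w => cexp ((y * (X (u + h)%R w - X u w)) *i)) =
  cexp (- (h%:C * Phi y)).
Proof.
move=> u0 h0; rewrite -expX//; have [_ _ stat _] := levyX.
have mc : cmeas setT (fun x : R => cexp ((y * x) *i)).
  by apply: cmeas_cexp_i; exact: measurable_funM.
rewrite -(@cintegral_image _ _ _ _ R P (distribution P (X h))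
  (fun w => X (u + h)%R w - X u w) _ _ (fun x => cexp ((y * x) *i)))//.
- by apply: (@cintegral_image _ _ _ _ R P (distribution P (X h)) (X h)).
- exact: measurable_increment.
- by move=> A mA; exact: (esym (stat u h A u0 h0 mA)).
Qed.

Section joint.
Variables (u c : nat -> R).
Hypotheses (u0 : 0 <= u 0%N) (nd_u : {homo u : i j / (i <= j)%N >-> i <= j}).

Let D i w := X (u i.+1) w - X (u i) w.

(** Cylinder sets over the first n increments: a pi-system generating the sigma-algebra of these
    increments, on which [levy_process] provides independence in product form. *)
Let G n : set (set T) := [set A | exists B : nat -> set R,
  (forall i, measurable (B i)) /\
  A = \bigcap_(i < n) increment_in X (u i) (u i.+1) (B i)].

Let G_preimage n i B : (i < n)%N -> measurable B -> G n (D i @^-1` B).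
Proof.
move=> ilen mB; exists (fun j => if j == i then B else setT); split.
  by move=> j; case: ifP.
apply/seteqP; split => w /=.
  by move=> Bw j /= _; rewrite /increment_in /=; case: ifPn => // /eqP ->.
by move=> /(_ i ilen); rewrite /increment_in /= eqxx.
Qed.

Let measurable_G n A : G n A -> measurable A.
Proof.
move=> [B [mB ->]]; apply: bigcap_measurableType => i _.
rewrite /increment_in -[X in measurable X]setTI.
by apply: measurable_increment.
Qed.

Let G_setI n : setI_closed (G n).
Proof.
move=> _ _ [B [mB ->]] [C [mC ->]]; exists (fun i => B i `&` C i); split.
  by move=> i; exact: measurableI.
by rewrite -bigcapI.
Qed.

Let G_setT n : G n setT.
Proof.
exists (fun=> setT); split => //.
by apply/esym; rewrite -subTset => w _ i _.
Qed.

(** The product formula for n+1 increments, with B as the last set, is divided into the formula for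
    the first n and the last factor. *)
Let G_independent n A B : G n A -> measurable B ->
  P (A `&` D n @^-1` B) = (P A * P (D n @^-1` B))%E.
Proof.
move=> [C [mC ->]] mB; have [_ ind _ _] := levyX.
pose C' i := if (i < n)%N then C i else B.
have mC' i : measurable (C' i) by rewrite /C'; case: ifP.
rewrite (ind n u C)//.
have := ind n.+1 u C' u0 nd_u mC'; rewrite big_ord_recr/=.
have -> : increment_in X (u n) (u n.+1) (C' n) = D n @^-1` B.
  by rewrite /C' ltnn.
have -> : (\prod_(i < n) P (increment_in X (u i) (u i.+1) (C' i)) =
    \prod_(i < n) P (increment_in X (u i) (u i.+1) (C i)))%E.
  by apply: eq_bigr => i _; rewrite /C' ltn_ord.
move=> <-; congr (P _); apply/seteqP; split => w /=.
  move=> [H Bw] i /=; rewrite ltnS leq_eqVlt /C' => /orP[/eqP ->|lin].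
    by rewrite ltnn.
  by rewrite lin; exact: H.
move=> H; split => [i /= lin|].
  by have := H i (ltnW lin); rewrite /C' lin.
by have := H n (ltnSn n); rewrite /C' ltnn.
Qed.

Lemma joint_increment_charfun n :
  cintegral P setT (fun w => cexp ((\sum_(i < n) c i * D i w) *i)) =
  cexp (- \sum_(i < n) ((u i.+1 - u i)%:C * Phi (c i))).
Proof.
elim: n => [|n ih].
  rewrite big_ord0 oppr0 cexp0.
  under [X in cintegral _ _ X]eq_fun do rewrite big_ord0.
  by rewrite cintegral_probability_cst cexp0.
rewrite big_ord_recr/= opprD cexpD -ih.
have -> : cexp (- ((u n.+1 - u n)%:C * Phi (c n))) =
    cintegral P setT (fun w => cexp ((c n * D n w) *i)).
  rewrite -(@increment_charfun (u n)) ?subr_ge0 ?nd_u//; last first.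
    by rewrite (le_trans u0)// nd_u.
  by rewrite addrC subrK.
rewrite -(@cintegral_independentM _ _ _ _ (G n) (D n)
  (fun w => cexp ((\sum_(i < n) c i * D i w) *i)) (fun x => cexp ((c n * x) *i))).
- apply: eq_cintegral => w _; rewrite -cexpD; congr cexp.
  by rewrite big_ord_recr/=; apply: complex_eqP; rewrite /= ?addr0.
- exact: measurable_G.
- exact: G_setI.
- exact: G_setT.
- exact: measurable_increment.
- exact: G_independent.
- apply: cmeas_cexp_i; apply: measurable_sum => i.
  apply: measurable_funM => //.
  move=> _ B mB; rewrite setTI; apply: sub_sigma_algebra.
  exact: G_preimage.
- by apply: cmeas_cexp_i; exact: measurable_funM.
- by move=> w; rewrite normc_cexp_i.
- by move=> w; rewrite normc_cexp_i.
Qed.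

End joint.

(** exp(- Re (Phi y)) is the modulus of the characteristic function of X 1, hence at most 1. *)
Lemma exponent_Re_ge0 y : 0 <= Re (Phi y).
Proof.
have mX : measurable_fun setT (fun w => y * X 1 w) by exact: measurable_funM.
have H := le_normc_cintegral measurableT (cint_cexp_i P mX).
rewrite (expX _ ler01) normc_cexp in H.
have E : \int[P]_w normc (cexp ((y * X 1 w) *i)) = 1.
  under eq_Rintegral do rewrite normc_cexp_i.
  exact: Rintegral_probability_cst.
move: H; rewrite E -[leRHS]expR0 ler_expR Re_opp Re_mul/= mul1r mul0r subr0.
by rewrite oppr_le0.
Qed.

Variable X' : R -> T -> R.
Hypothesis regX : regular_version P X X'.

Lemma joint_charfun (u c : nat -> R) n : 0 <= u 0%N ->
  {homo u : i j / (i <= j)%N >-> i <= j} ->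
  cintegral P setT (fun w =>
    cexp ((\sum_(i < n) c i * (X' (u i.+1) w - X' (u i) w)) *i)) =
  cexp (- \sum_(i < n) ((u i.+1 - u i)%:C * Phi (c i))).
Proof.
move=> u0 nd_u; rewrite -joint_increment_charfun//.
have ui i : 0 <= u i by rewrite (le_trans u0)// nd_u.
have [_ _ _ XX'] := regX.
apply: cintegral_negligible_congr; apply: filterS XX' => w XX' _.
by congr cexp; congr (_ *i); apply: eq_bigr => i _; rewrite !XX'.
Qed.

Lemma regular_charfun u y : 0 <= u ->
  cintegral P setT (fun w => cexp ((y * X' u w) *i)) = cexp (- (u%:C * Phi y)).
Proof.
move=> u0; rewrite -expX//; have [_ _ _ XX'] := regX.
by apply: cintegral_negligible_congr; apply: filterS XX' => w XX' _; rewrite XX'.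
Qed.

Lemma ccvg_cexp_exponent (u : R) (y_ : nat -> R) (y : R) : 0 <= u -> y_ @ \oo --> y ->
  ccvg (fun n => cexp (- (u%:C * Phi (y_ n)))) (cexp (- (u%:C * Phi y))).
Proof.
move=> u0 yy; rewrite -regular_charfun//.
under eq_fun do rewrite -regular_charfun//.
have [mX _ _ _] := regX.
apply: ccvg_charfun => [n||]; try exact: measurable_funM.
by apply: aeW => w; apply: cvgM => //; exact: cvg_cst.
Qed.

(** Otherwise some times u_n tending to 0 from the right and points y_n bounded by K violate
    positivity. By right continuity at 0 the variables y_n X'(u_n) tend to 0 pointwise, so their
    characteristic functions tend to 1, while their real parts stay nonpositive. *)
Lemma exponent_sector K : exists2 u0 : R, 0 < u0 &
  forall u y, 0 < u <= u0 -> `|y| <= K -> 0 < Re (cexp (- (u%:C * Phi y))).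
Proof.
apply: contrapT => H.
have {}H n : exists z : R * R, [/\ 0 < z.1 <= n.+1%:R^-1, `|z.2| <= K &
    Re (cexp (- (z.1%:C * Phi z.2))) <= 0].
  apply: contrapT => h; apply: H; exists n.+1%:R^-1; first by rewrite invr_gt0.
  move=> u y u0 yK; rewrite ltNge; apply/negP => le0.
  by apply: h; exists (u, y).
have [z Hz] := choice H.
have [mX X0 cX _] := regX.
have zu : (fun n => (z n).1) @ \oo --> 0.
  apply: (@squeeze_cvgr _ _ _ _ (fun=> 0) (fun n => n.+1%:R^-1)).
  - by apply: nearW => n; have [/andP[a b] _ _] := Hz n; rewrite ltW.
  - exact: cvg_cst.
  - exact: cvg_harmonic.
have K0 : 0 <= K by have [_ b _] := Hz 0%N; exact: le_trans b.
have : ccvg (fun n => cintegral P setT (fun w => cexp (((z n).2 * X' (z n).1 w) *i)))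
    (cintegral P setT (fun w => cexp ((0 : R) *i))).
  apply: ccvg_charfun => [n||]; [exact: measurable_funM|exact: measurable_cst|].
  apply: aeW => w.
  have Xz : (fun n => X' (z n).1 w) @ \oo --> 0.
    rewrite -(X0 0 w (lexx _)); have [/cvg_at_rightP Xr _] := cX w 0.
    by apply: Xr; split => // n; have [/andP[]] := Hz n.
  apply/norm_cvg0P.
  apply: (@squeeze_cvgr _ _ _ _ (fun=> 0) (fun n => K * `|X' (z n).1 w|)).
  - apply: nearW => n; rewrite normr_ge0 normrM ler_wpM2r//.
    by have [] := Hz n.
  - exact: cvg_cst.
  - rewrite -[X in _ --> X](mulr0 K); apply: cvgM; first exact: cvg_cst.
    by rewrite -(@normr0 _ R); exact: cvg_norm.
rewrite cexp0 cintegral_probability_cst => -[/= Hc _].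
suff : (1 : R) <= 0 by rewrite ler10.
apply: (cvgr_to_le Hc); apply: nearW => n.
have [/andP[zn0 _] _] := Hz n; by rewrite -(regular_charfun _ (ltW zn0)).
Qed.

(** At time 1 the squared modulus of exp(- Phi) is exp(- 2 Re Phi): it is positive and depends
    continuously on y, so the real logarithm recovers Re Phi. *)
Lemma cvg_exponent_Re (y_ : nat -> R) (y : R) : y_ @ \oo --> y ->
  (fun n => Re (Phi (y_ n))) @ \oo --> Re (Phi y).
Proof.
move=> /(ccvg_cexp_exponent ler01)[a b].
have nE z : Re (Phi z) = - (2^-1 * ln (nsq (cexp (- (1%:C * Phi z))))).
  rewrite nsq_cexp -expRM_natl expRK Re_opp Re_mul/= mul1r mul0r subr0.
  by rewrite mulrA mulVf// mul1r opprK.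
rewrite nE; under eq_fun do rewrite nE.
apply: cvgN; apply: cvgM; first exact: cvg_cst.
apply: continuous_cvg.
  by apply: continuous_ln; rewrite nsq_cexp exprn_gt0// expR_gt0.
by apply: cvgD; [under eq_fun do rewrite expr2|under eq_fun do rewrite expr2];
  rewrite expr2; exact: cvgM.
Qed.

(** The sector condition holds for all u in ]0, u0]. If |u0 Im (Phi y)| reached pi/2, the angle u Im
    (Phi y) would be pi/2 in absolute value for some u in this interval, where the cosine vanishes.
    Positivity at u0 alone would bound the angle only modulo 2 pi. *)
Lemma exponent_Im_bound K : exists2 u0 : R, 0 < u0 &
  forall y, `|y| <= K -> `|u0 * Im (Phi y)| < pi / 2.
Proof.
have [u0 u00 Hu] := exponent_sector K; exists u0 => // y yK.
have cosp u : 0 < u <= u0 -> 0 < cos (u * Im (Phi y)).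
  move=> uu; have := Hu u y uu yK.
  rewrite cexpE/= pmulr_rgt0 ?expR_gt0// Im_opp Im_mul/= mul0r addr0.
  by rewrite cosN.
rewrite ltNge; apply/negP; rewrite normrM gtr0_norm// => le.
have pi2 : 0 < pi / 2 :> R by rewrite divr_gt0// pi_gt0.
have th0 : 0 < `|Im (Phi y)|.
  rewrite lt_neqAle normr_ge0 andbT eq_sym; apply/eqP => th0.
  by move: le; rewrite th0 mulr0 leNgt pi2.
have := cosp (pi / 2 / `|Im (Phi y)|).
rewrite divr_gt0//= ler_pdivrMr// => /(_ le).
rewrite -cos_norm normrM ger0_norm; last by rewrite ltW// divr_gt0.
by rewrite divfK ?gt_eqF// cos_pihalf ltxx.
Qed.

(* Only [cexp (- u * Phi)] is readily seen to be continuous. For a small [u] its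
   values on a compact set stay in the right half-plane, where the arctangent
   recovers the imaginary part of [Phi]. *)
Lemma cvg_exponent_Im (y_ : nat -> R) (y : R) : y_ @ \oo --> y ->
  (fun n => Im (Phi (y_ n))) @ \oo --> Im (Phi y).
Proof.
move=> yy; have [u0 u00 Hu] := exponent_Im_bound (`|y| + 1).
have [a b] := ccvg_cexp_exponent (ltW u00) yy.
set w := fun n => _ in a; set l := cexp _ in a b.
have nE z : `|z| <= `|y| + 1 -> Im (Phi z) = - (u0^-1 *
    atan (Im (cexp (- (u0%:C * Phi z))) / Re (cexp (- (u0%:C * Phi z))))).
  move=> zy; rewrite cexpE/= Re_opp Im_opp Re_mul Im_mul/= !mul0r subr0 addr0.
  rewrite invfM mulrACA divff ?gt_eqF ?expR_gt0// mul1r -/(tan _) tanK.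
    by rewrite mulrN opprK mulrA mulVf ?gt_eqF// mul1r.
  by rewrite in_itv/= -ltr_norml normrN Hu.
have cosl : 0 < Re l.
  rewrite /l cexpE/= pmulr_rgt0 ?expR_gt0// Im_opp Im_mul/= mul0r addr0 cosN.
  by rewrite cos_gt0_pihalf// -ltr_norml Hu// lerDl.
rewrite nE ?lerDl//.
have H : (fun n => - (u0^-1 * atan (Im (cexp (- (u0%:C * Phi (y_ n)))) /
    Re (cexp (- (u0%:C * Phi (y_ n))))))) @ \oo --> - (u0^-1 * atan (Im l / Re l)).
  apply: cvgN; apply: cvgM; first exact: cvg_cst.
  apply: continuous_cvg; first exact: continuous_atan.
  by apply: cvgM => //; apply: cvgV => //; rewrite gt_eqF.
apply: cvg_trans H; apply: near_eq_cvg.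
have yn : \forall n \near \oo, `|y_ n| <= `|y| + 1.
  have /cvgrPdist_le /(_ 1 ltr01) := yy; apply: filterS => n yn.
  by have := ler_normB y (y - y_ n); rewrite subKr => /le_trans; apply; rewrite lerD2l.
by apply: filterS yn => n yn; rewrite nE.
Qed.

Lemma ccvg_exponent (y_ : nat -> R) (y : R) : y_ @ \oo --> y ->
  ccvg (fun n => Phi (y_ n)) (Phi y).
Proof. by move=> yy; split; [exact: cvg_exponent_Re|exact: cvg_exponent_Im]. Qed.

Lemma exponent_Re_continuous : continuous (fun y => Re (Phi y)).
Proof. by move=> y; apply/(@cvg_nbhsP _ R^o) => u; exact: cvg_exponent_Re. Qed.

Lemma exponent_Im_continuous : continuous (fun y => Im (Phi y)).
Proof. by move=> y; apply/(@cvg_nbhsP _ R^o) => u; exact: cvg_exponent_Im. Qed.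

Lemma exponent_cmeas : cmeas setT Phi.
Proof.
split; apply: continuous_measurable_fun.
  exact: exponent_Re_continuous.
exact: exponent_Im_continuous.
Qed.

Lemma exponent_bounded (K : R) : exists M, forall y, `|y| <= K -> normc (Phi y) <= M.
Proof.
have H (g : R -> R) : continuous g -> exists M, forall y, `|y| <= K -> `|g y| <= M.
  move=> cg; have : compact (g @` `[-K, K]).
    apply: continuous_compact; last exact: segment_compact.
    by apply: continuous_subspaceT.
  move=> /compact_bounded[M [_ /(_ (M + 1))]]; rewrite ltrDl => /(_ ltr01) HM.
  by exists (M + 1) => y yK; apply: HM; exists y => //=; rewrite in_itv/= -ler_norml.
have [M1 H1] := H _ exponent_Re_continuous.
have [M2 H2] := H _ exponent_Im_continuous.
exists (M1 + M2) => y yK; rewrite (le_trans (normc_le_add _))//.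
by rewrite lerD// ?H1 ?H2.
Qed.

(* All increments [X u - X v] have characteristic functions close to [1] as [v]
   increases to [u], so the jump at a fixed time [u] vanishes almost surely. *)
Lemma stochastic_continuity u : {ae P, forall w, X' v w @[v --> u] --> X' u w}.
Proof.
have [mX X0 cX _] := regX.
have [u0|u0] := leP u 0.
  apply: aeW => w; apply/left_right_continuousP; split; last by have [] := cX w u.
  rewrite X0//; apply: cvg_near_cst; near=> v.
  have vu : v <= u by near: v; exact: nbhs_left_le.
  by rewrite X0// (le_trans vu).
(* The scaling by u keeps these times nonnegative, where stationarity of the increments applies. *)
pose v n := u - u / n.+1%:R.
have vu n : v n < u by rewrite /v ltrBlDr ltrDl divr_gt0.
have v0 n : 0 <= v n.
  rewrite /v subr_ge0 ler_pdivrMr//; apply: ler_peMr; first exact: ltW.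
  by rewrite ler1n.
have vcvg : v @ \oo --> u.
  rewrite -[X in _ --> X](subr0 u); apply: cvgB; first exact: cvg_cst.
  rewrite -[X in _ --> X](mulr0 u); apply: cvgM; first exact: cvg_cst.
  exact: cvg_harmonic.
pose L w := lim (X' v w @[v --> u^'-]).
have XL w : X' v w @[v --> u^'-] --> L w by have [] := cX w u.
have XvL w : (fun n => X' (v n) w) @ \oo --> L w.
  by have /cvg_at_leftP := XL w; apply.
have mL : measurable_fun setT L.
  by apply: (@measurable_fun_cvg _ _ _ setT (fun n => X' (v n))) => // w _.
have charL y : cintegral P setT (fun w => cexp ((y * (X' u w - L w)) *i)) = 1.
  apply: (@ccvg_unique _ (fun n => cexp (- ((u - v n)%:C * Phi y)))); last first.
    rewrite -[X in ccvg _ X]cexp0; apply: ccvg_cexp.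
    rewrite -[X in ccvg _ X]oppr0; apply: ccvgN.
    rewrite -[X in ccvg _ X](mul0r (Phi y)); apply: ccvgM; last exact: ccvg_cst.
    split => /=; last exact: cvg_cst.
    by rewrite -(subrr u); apply: cvgB => //; exact: cvg_cst.
  have <- : (fun n => cintegral P setT (fun w => cexp ((y * (X' u w - X' (v n) w)) *i)))
      = (fun n => cexp (- ((u - v n)%:C * Phi y))).
    apply/funext => n; have uv0 : 0 <= u - v n by rewrite subr_ge0 ltW.
    rewrite -(increment_charfun y (v0 n) uv0).
    rewrite addrC subrK; have [_ _ _ XX'] := regX.
    apply: cintegral_negligible_congr; apply: filterS XX' => w XX' _.
    by rewrite !XX'// ltW.
  apply: ccvg_charfun => [n||].
  - by apply: measurable_funM => //; exact: measurable_funB.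
  - by apply: measurable_funM => //; exact: measurable_funB.
  - apply: aeW => w; apply: cvgM; first exact: cvg_cst.
    by apply: cvgB => //; exact: cvg_cst.
(* By [charL] the nonnegative variable 1 - cos has integral 0. *)
have cos1 y : {ae P, forall w, cos (y * (X' u w - L w)) = 1}.
  have mc : measurable_fun setT (fun w => y * (X' u w - L w)).
    by apply: measurable_funM => //; exact: measurable_funB.
  have [ic _] := cint_cexp_i P mc.
  have cE w : Re (cexp ((y * (X' u w - L w)) *i)) = cos (y * (X' u w - L w)).
    by rewrite cexpE/= expR0 mul1r.
  have mcos : measurable_fun setT (fun w => 1 - cos (y * (X' u w - L w))).
    apply: measurable_funB => //; under eq_fun do rewrite -cE.
    by case: (cmeas_cexp_i mc).
  have : ae_eq P setT (fun w => (1 - cos (y * (X' u w - L w)))%:E) (cst 0%E).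
    apply/ae_eq_integral_abs => //; first exact/measurable_EFinP.
    have -> : (\int[P]_x `|(1 - cos (y * (X' u x - L x)))%:E| =
        \int[P]_x (1%:E - (Re (cexp ((y * (X' u x - L x)) *i)))%:E))%E.
      apply: eq_integral => w _; rewrite cE -EFinB /= ger0_norm// subr_ge0 cos_le1.
    rewrite integralB//; last exact: finite_measure_integrable_cst.
    rewrite integral_cst// mul1e.
    rewrite [X in (X - _)%E](_ : _ = 1%E); last exact: probability_setT.
    rewrite -[X in (_ - X)%E]fineK; last exact: integrable_fin_num.
    have := congr1 (@complex.Re R) (charL y); rewrite /= /Rintegral => ->.
    by rewrite subee.
  apply: filterS => w /(_ I) [/eqP].
  by rewrite subr_eq0 => /eqP.
(* Countably many y share one null set. For the jump D, a suitable k brings D/(k+1) into [-1, 1],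
   where the cosine equals 1 only at 0. *)
have {}cos1 := ae_foralln (fun k => cos1 k.+1%:R^-1).
apply: filterS cos1 => w cos1.
have XuL : X' u w = L w.
  apply/eqP; rewrite -subr_eq0; apply/eqP; set D := X' u w - L w.
  pose k := Num.truncn `|D|.
  have Dk : `|k.+1%:R^-1 * D| <= 1.
    rewrite normrM ger0_norm ?invr_ge0// mulrC ler_pdivrMr// mul1r.
    by rewrite ltW// truncnS_gt.
  have ck := cos1 k; rewrite -/D -cos_norm in ck.
  have pi1 : 1 <= pi :> R by rewrite (le_trans _ (pi_ge2 _))// ler1n.
  have := @cos_inj R `|k.+1%:R^-1 * D| 0.
  rewrite !in_itv/= normr_ge0 lexx pi_ge0 (le_trans Dk)// cos0.
  move=> /(_ isT isT ck)/eqP.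
  by rewrite normr_eq0 mulf_eq0 invr_eq0 pnatr_eq0/= => /eqP.
apply/left_right_continuousP; split; last by have [] := cX w u.
by rewrite XuL.
Unshelve. all: by end_near. Qed.

End levy_characteristic.

(** * Gaussians and the Weyl relations *)

Section modulated_gaussian.
Context {R : realType}.
Local Notation leb := (@lebesgue_measure R).

Definition gaussian (c b x : R) : R := expR (- (c * (x - b) ^+ 2)).

(** A class that contains the real and imaginary parts of the modulated Gaussians and is closed
    under differentiation; all Schwartz seminorms then follow from one bound valid for the whole
    class. *)
Definition polytrig_gaussian (p q : {poly R}) (a c b x : R) : R :=
  (p.[x] * cos (a * x) + q.[x] * sin (a * x)) * gaussian c b x.

Lemma is_derive_polytrig_gaussian (p q : {poly R}) (a c b x : R) :
  is_derive x 1 (polytrig_gaussian p q a c b)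
    (polytrig_gaussian
       (p^`() + a *: q - (2 * c) *: (('X - b%:P) * p))
       (q^`() - a *: p - (2 * c) *: (('X - b%:P) * q)) a c b x).
Proof.
have da : is_derive x 1 (fun x : R => a * x) a.
  by apply: is_derive_eq; rewrite scaler1.
have dg : is_derive x 1 (gaussian c b) (- (2 * c * (x - b)) * gaussian c b x).
  have dq : is_derive x 1 (fun x : R => - (c * (x - b) ^+ 2)) (- (2 * c * (x - b))).
    by apply: is_derive_eq; rewrite /GRing.scale /=; ring.
  have := @is_derive1_comp R expR _ x _ _ (is_derive_expR _) dq.
  by move=> H; apply: is_derive_eq H _; rewrite mulrC.
have dc := @is_derive1_comp R cos _ x _ _ (is_derive_cos _) da.
have ds := @is_derive1_comp R sin _ x _ _ (is_derive_sin _) da.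
have dp := is_derive_poly p x; have dq := is_derive_poly q x.
apply: (is_derive_eq (@is_deriveM _ _ _ _ _ _ _ _
  (@is_deriveD _ _ _ _ _ _ _ _ _ (@is_deriveM _ _ _ _ _ _ _ _ dp dc)
    (@is_deriveM _ _ _ _ _ _ _ _ dq ds)) dg)).
rewrite /polytrig_gaussian !hornerE /GRing.scale /=.
set g := gaussian c b x.
rewrite [(_ + _) x](_ : _ = p.[x] * cos (a * x) + q.[x] * sin (a * x))//.
ring.
Qed.

Lemma derive1n_polytrig_gaussian (n : nat) (p q : {poly R}) (a c b : R) :
  exists p' q', derive1n n (polytrig_gaussian p q a c b) =
    polytrig_gaussian p' q' a c b.
Proof.
elim: n => [|n [p' [q' ih]]]; first by exists p, q.
exists (p'^`() + a *: q' - (2 * c) *: (('X - b%:P) * p')).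
exists (q'^`() - a *: p' - (2 * c) *: (('X - b%:P) * q')).
rewrite derive1nS ih; apply/funext => x; rewrite derive1E.
by apply: derive_val; exact: is_derive_polytrig_gaussian.
Qed.

Lemma pow_le_expR (n : nat) (x : R) : `|x| ^+ n <= n`!%:R * expR `|x|.
Proof.
case: n => [|n]; first by rewrite expr0 fact0 mul1r -expR0 ler_expR.
have := expR_ge1Dxn n (normr_ge0 x).
rewrite -ler_pdivrMl ?ltr0n ?fact_gt0// mulrC; apply: le_trans.
by rewrite lerDr.
Qed.

Lemma poly_le_expR (p : {poly R}) : exists2 C, 0 <= C &
  forall x, `|p.[x]| <= C * expR `|x|.
Proof.
exists (\sum_(i < size p) `|p`_i| * i`!%:R).
  by apply: sumr_ge0 => i _; rewrite mulr_ge0.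
move=> x; rewrite horner_coef (le_trans (ler_norm_sum _ _ _))// mulr_suml.
apply: ler_sum => i _; rewrite normrM normrX -mulrA ler_wpM2l//.
exact: pow_le_expR.
Qed.

Lemma expR_gaussian_bounded (c b : R) : 0 < c ->
  exists C, forall x, expR `|x| * gaussian c b x <= C.
Proof.
(* With y = |x - b| one has |x| <= |b| + y, and the maximum of y - c y^2 is 1/(4c), attained at
   1/(2c). *)
move=> c0; exists (expR (`|b| + (4 * c)^-1)) => x.
rewrite /gaussian -expRD ler_expR.
have H : `|x| <= `|b| + `|x - b| by rewrite -{1}(subrK b x) addrC ler_normD.
rewrite -(@real_normK _ (x - b)) ?num_real//.
set y := `|x - b| in H *.
apply: (@le_trans _ _ (`|b| + (y - c * y ^+ 2))); first by rewrite addrA lerD2r.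
rewrite lerD2l -subr_ge0.
have -> : (4 * c)^-1 - (y - c * y ^+ 2) = c * (y - (2 * c)^-1) ^+ 2.
  by field; rewrite gt_eqF.
by rewrite mulr_ge0 ?sqr_ge0// ltW.
Qed.

Lemma schwartz_polytrig_gaussian (p q : {poly R}) (a c b : R) : 0 < c ->
  schwartz_real (polytrig_gaussian p q a c b).
Proof.
move=> c0; split => [n x|m n].
  have [p' [q' ->]] := derive1n_polytrig_gaussian n p q a c b.
  by apply: ex_derive; exact: is_derive_polytrig_gaussian.
have [p' [q' ->]] := derive1n_polytrig_gaussian n p q a c b.
have [C1 C10 H1] := poly_le_expR ('X^m * p').
have [C2 C20 H2] := poly_le_expR ('X^m * q').
have [C3 H3] := expR_gaussian_bounded b c0.
exists ((C1 + C2) * C3) => x.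
have g0 : 0 <= gaussian c b x by exact: expR_ge0.
rewrite /polytrig_gaussian [X in `|X|]mulrA normrM (ger0_norm g0) mulrDr !mulrA.
rewrite (@le_trans _ _ ((C1 + C2) * expR `|x| * gaussian c b x))//; last first.
  by rewrite -mulrA ler_wpM2l ?addr_ge0.
rewrite ler_wpM2r// (le_trans (ler_normD _ _))// mulrDl lerD//.
  have := H1 x; rewrite hornerM hornerXn => H; rewrite normrM (le_trans _ H)//.
  by rewrite ler_piMr// ler_norml cos_geN1 cos_le1.
have := H2 x; rewrite hornerM hornerXn => H; rewrite normrM (le_trans _ H)//.
by rewrite ler_piMr// ler_norml sin_geN1 sin_le1.
Qed.

Lemma schwartz_modulated_gaussian (a c b : R) : 0 < c ->
  schwartz (fun x => cexp ((a * x) *i) * (gaussian c b x)%:C).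
Proof.
move=> c0; split.
  rewrite (_ : (fun x => _) = polytrig_gaussian 1 0 a c b).
    exact: schwartz_polytrig_gaussian.
  apply/funext => x; rewrite Re_mul cexpE/= expR0 /polytrig_gaussian !hornerE/=.
  ring.
rewrite (_ : (fun x => _) = polytrig_gaussian 0 1 a c b).
  exact: schwartz_polytrig_gaussian.
apply/funext => x; rewrite Im_mul cexpE/= expR0 /polytrig_gaussian !hornerE/=.
ring.
Qed.

Lemma measurable_gaussian (c b : R) : measurable_fun setT (gaussian c b).
Proof.
apply: measurableT_comp => //; apply: measurable_funN; apply: measurable_funM => //.
by apply: measurable_funX; exact: measurable_funB.
Qed.

Lemma integrable_gaussian (c b : R) : 0 < c ->
  leb.-integrable setT (fun x => (gaussian c b x)%:E).
Proof.
(* The normal density of mean b and variance 1/(2c) is a constant multiple of [gaussian c b]. *)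
move=> c0; pose s := Num.sqrt (2 * c)^-1.
have s0 : s != 0 by rewrite gt_eqF// sqrtr_gt0 invr_gt0 mulr_gt0.
have := @integrable_normal_pdf R b s.
move=> /(@integrableZl _ _ _ leb setT measurableT (normal_peak s)^-1).
apply: eq_integrable => // x _; rewrite -EFinM normal_pdfE// mulrA mulVf; last first.
  by rewrite gt_eqF// normal_peak_gt0.
rewrite mul1r /normal_fun /gaussian; congr (expR _)%:E.
rewrite /s sqr_sqrtr; last by rewrite ltW// invr_gt0 mulr_gt0.
by field; rewrite gt_eqF.
Qed.

Lemma cmeas_gaussian (c b : R) : cmeas setT (fun x => (gaussian c b x)%:C : R[i]).
Proof. by split => /=; [exact: measurable_gaussian|exact: measurable_cst]. Qed.

Lemma normc_real (r : R) : normc (r%:C) = `|r|.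
Proof. by rewrite normc_sqrt /nsq/= expr0n addr0 sqrtr_sqr. Qed.

Lemma L2_gaussian (c b : R) : 0 < c -> L2 (fun x => (gaussian c b x)%:C).
Proof.
move=> c0; have c20 : 0 < 2 * c by rewrite mulr_gt0.
apply: (L2_nsq_le (cmeas_gaussian c b) (integrable_gaussian b c20)) => x /=.
rewrite /nsq/= expr0n addr0 /gaussian -expRM_natl le_eqVlt; apply/orP; left.
by apply/eqP; congr expR; ring.
Qed.

End modulated_gaussian.

Lemma Rintegral0 d (T : measurableType d) (R : realType)
    (mu : {measure set T -> \bar R}) (D : set T) : \int[mu]_(x in D) 0 = 0 :> R.
Proof. by rewrite /Rintegral integral0. Qed.

(** * Gaussians are total in L^2 *)

Section gaussians_total.
Context {R : realType}.
Local Notation leb := (@lebesgue_measure R).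

Lemma lebesgue_affine (r x : R) (A : set R) : 0 < r -> measurable A ->
  (r%:E * leb A)%E = leb ((fun v => x + v / r) @^-1` A).
Proof.
move=> r0 mA; have ri0 : 0 <= r^-1 by rewrite invr_ge0 ltW.
pose phi := (fun v : measurableTypeR R => x + v / r : measurableTypeR R).
have mphi : measurable_fun setT phi.
  by apply: measurable_funD => //; exact: measurable_funM.
suff : leb A = (r^-1%:E * pushforward leb phi A)%E.
  by move=> ->; rewrite muleA -EFinM divff ?gt_eqF// mul1e.
pose m := mscale (NngNum ri0) (pushforward leb phi).
rewrite -[RHS]/(m mphi A); apply: lebesgue_measure_unique => // _ [[p q]] _ <-.
rewrite [RHS](_ : _ = (r^-1%:E * leb (phi @^-1` `]p, q]))%E)//.
rewrite (_ : _ @^-1` _ = `]r * (p - x), r * (q - x)]%classic); last first.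
  apply/seteqP; split => v /=; rewrite !in_itv/= /phi.
    by rewrite -ltrBlDl -lerBrDl ltr_pdivlMr// ler_pdivrMr// ![_ * r]mulrC.
  by rewrite -ltrBlDl -lerBrDl ltr_pdivlMr// ler_pdivrMr// ![_ * r]mulrC.
rewrite !lebesgue_measure_itv/= !lte_fin ltr_pM2l// ltrD2r.
case: ifPn => _; last by rewrite mule0.
rewrite -!EFinB -EFinM; congr EFin; field.
by rewrite gt_eqF.
Qed.

Lemma ge0_integral_affine (r x : R) (f : R -> \bar R) : 0 < r ->
  measurable_fun setT f -> (forall b, 0 <= f b)%E ->
  (\int[leb]_v f (x + v / r)%R = r%:E * \int[leb]_b f b)%E.
Proof.
move=> r0 mf f0; pose rn := NngNum (ltW r0).
have := @ge0_integral_mscale _ _ _ leb setT measurableT rn f mf (fun b _ => f0 b).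
move=> <-; apply/esym.
apply: (@ge0_integral_image _ _ _ _ R leb (mscale rn leb)
  (fun v : measurableTypeR R => x + v / r : measurableTypeR R)) => //.
  by apply: measurable_funD => //; exact: measurable_funM.
by move=> A mA; rewrite /= -(lebesgue_affine x r0).
Qed.

Definition halfline (q : R) : R -> R := \1_`]-oo, q].

Lemma measurable_halfline q : measurable_fun setT (halfline q).
Proof. by apply: measurable_indic. Qed.

Lemma halfline_ge0 q x : 0 <= halfline q x.
Proof. by rewrite /halfline indicE. Qed.

Lemma halfline_le1 q x : halfline q x <= 1.
Proof. by rewrite /halfline indicE; case: (_ \in _). Qed.

(** Convolution of the half-line indicator with (n+1) exp(- (n+1)^2 u^2), a kernel of mass sqrt(pi),
    written in the variable v = (n+1)(b - x). In this form the weight does not depend on n and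
    dominates the integrands. *)
Definition smoothed_halfline (q : R) (n : nat) (x : R) : R :=
  \int[leb]_v (gauss_fun v * halfline q (x + v / n.+1%:R)).

Let mgh q n x : measurable_fun setT (fun v => gauss_fun v * halfline q (x + v / n.+1%:R)).
Proof.
apply: measurable_funM; first exact: measurable_gauss_fun.
apply: measurableT_comp; first exact: measurable_halfline.
by apply: measurable_funD => //; exact: measurable_funM.
Qed.

Let gh_le q n x v : `|gauss_fun v * halfline q (x + v / n.+1%:R)| <= gauss_fun v.
Proof.
rewrite ger0_norm ?mulr_ge0 ?gauss_fun_ge0 ?halfline_ge0//.
by rewrite ler_piMr ?gauss_fun_ge0 ?halfline_le1.
Qed.

Let igh q n x : leb.-integrable setT
  (EFin \o (fun v => gauss_fun v * halfline q (x + v / n.+1%:R))).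
Proof.
apply: (@le_integrable _ _ _ leb setT measurableT _ (EFin \o gauss_fun));
  last exact: integrableT_gauss.
  by apply/measurable_EFinP; exact: mgh.
move=> v _; rewrite /= lee_fin (le_trans (gh_le _ _ _ _))// ler_norm//.
Qed.

Let gauss_mass : \int[leb]_v gauss_fun v = Num.sqrt pi.
Proof. by rewrite /Rintegral integralT_gauss. Qed.

Lemma smoothed_halfline_bounded q n x : `|smoothed_halfline q n x| <= Num.sqrt pi.
Proof.
rewrite -gauss_mass (le_trans (le_normr_Rintegral _ (igh q n x)))//.
apply: le_Rintegral => //.
- by apply: integrable_norm; exact: igh.
- exact: integrableT_gauss.
Qed.

Lemma measurable_smoothed_halfline q n : measurable_fun setT (smoothed_halfline q n).
Proof.
apply: measurableT_comp => //.
apply: (@measurable_fun_fubini_tonelli_F _ _ _ _ R leb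
  (fun z : R * R => (gauss_fun z.2 * halfline q (z.1 + z.2 / n.+1%:R))%:E)) => //.
  apply/measurable_EFinP; apply: measurable_funM.
    by apply: measurableT_comp; [exact: measurable_gauss_fun|exact: measurable_snd].
  apply: measurableT_comp; first exact: measurable_halfline.
  apply: measurable_funD; first exact: measurable_fst.
  by apply: measurable_funM => //; exact: measurable_snd.
by move=> z; rewrite lee_fin mulr_ge0 ?gauss_fun_ge0 ?halfline_ge0.
Qed.

Lemma cvg_smoothed_halfline q x : x != q ->
  (fun n => smoothed_halfline q n x) @ \oo --> Num.sqrt pi * halfline q x.
Proof.
move=> xq; have -> : Num.sqrt pi * halfline q x =
    \int[leb]_v (gauss_fun v * halfline q x).
  by rewrite RintegralZr// ?gauss_mass//; exact: integrableT_gauss.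
have [|||||_ _] := @dominated_convergence _ _ _ leb setT measurableT
  (fun n v => (gauss_fun v * halfline q (x + v / n.+1%:R))%:E)
  (fun v => (gauss_fun v * halfline q x)%:E) (EFin \o gauss_fun).
- by move=> n; apply/measurable_EFinP; exact: mgh.
- apply/measurable_EFinP; apply: measurable_funM => //.
  exact: measurable_gauss_fun.
- apply: aeW => v _.
  have xv : (fun n => x + v / n.+1%:R) @ \oo --> x.
    rewrite -[X in _ --> X]addr0; apply: cvgD; first exact: cvg_cst.
    rewrite -[X in _ --> X](mulr0 v); apply: cvgM; first exact: cvg_cst.
    exact: cvg_harmonic.
  apply: cvg_near_cst; rewrite /halfline.
  have [xltq|qltx|xeq] := ltgtP x q; last by rewrite xeq eqxx in xq.
    have H : \forall n \near \oo, x + v / n.+1%:R < q by exact: (cvgr_lt x).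
    apply: filterS H => n xn.
    by rewrite !indicE !mem_set//= in_itv/= ltW.
  have H : \forall n \near \oo, q < x + v / n.+1%:R by exact: (cvgr_gt x).
  apply: filterS H => n xn.
  by rewrite !indicE !memNset//= in_itv/=; apply/negP; rewrite -ltNge.
- exact: integrableT_gauss.
- by apply: aeW => v n _; rewrite /= lee_fin.
- move=> H; apply: fine_cvg.
  rewrite [X in _ --> X](_ : _ = (\int[leb]_v (gauss_fun v * halfline q x)%:E)%E)//.
  rewrite /Rintegral fineK//; apply: integrable_fin_num => //.
  under eq_fun do rewrite EFinM.
  by apply: integrableZr => //; exact: integrableT_gauss.
Qed.

Variable h : R -> R[i].
Hypothesis L2h : L2 h.
Hypothesis h_gaussian : forall c b, 0 < c ->
  L2inner h (fun x => (gaussian c b x)%:C) = 0.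

(** The fixed Gaussian factor makes h integrable, as pairing with bounded functions, Fubini and
    differentiation of the primitive all require; since it never vanishes, K = 0 gives h = 0. *)
Let K x := h x * (gaussian 1 0 x)%:C.

Let cintK : cint leb setT K.
Proof.
have := cint_inner L2h (L2_gaussian 0 ltr01).
by under eq_fun do rewrite conjc_real.
Qed.

(* The product of two Gaussians is a multiple of a Gaussian. *)
Let K_gaussian (n : nat) (b : R) :
  cintegral leb setT (fun x => K x * (gaussian (n.+1%:R ^+ 2) b x)%:C) = 0.
Proof.
set c : R := n.+1%:R ^+ 2; have c0 : 0 < c by rewrite exprn_gt0.
have c1 : 0 < c + 1 by rewrite addr_gt0.
have gE x : gaussian 1 0 x * gaussian c b x =
    expR (- (c * b ^+ 2 / (c + 1))) * gaussian (c + 1) (c * b / (c + 1)) x.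
  by rewrite /gaussian -!expRD; congr expR; field; rewrite gt_eqF.
have -> : (fun x => K x * (gaussian c b x)%:C) =
    fun x => (expR (- (c * b ^+ 2 / (c + 1))))%:C *
      (h x * conjc (gaussian (c + 1) (c * b / (c + 1)) x)%:C).
  apply/funext => x; rewrite /K conjc_real -mulrA -rmorphM gE rmorphM/=.
  by rewrite mulrCA.
rewrite cintegralMl//; last exact: cint_inner L2h (L2_gaussian _ c1).
by rewrite -/(L2inner _ _) h_gaussian// mulr0.
Qed.

Let gaussian_halfline_integral (n : nat) (q x : R) :
  (\int[leb]_b (gaussian (n.+1%:R ^+ 2) x b * halfline q b)%:E =
  (n.+1%:R^-1 * smoothed_halfline q n x)%:E)%E.
Proof.
have n0 : 0 < n.+1%:R :> R by [].
have := @ge0_integral_affine n.+1%:R x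
  (fun b => (gaussian (n.+1%:R ^+ 2) x b * halfline q b)%:E) n0.
have -> : (fun v => (gaussian (n.+1%:R ^+ 2) x (x + v / n.+1%:R) *
    halfline q (x + v / n.+1%:R))%:E) =
    (fun v => (gauss_fun v * halfline q (x + v / n.+1%:R))%:E).
  apply/funext => v; congr (_ * _)%:E; rewrite /gaussian /gauss_fun.
  by congr expR; field.
move=> H; rewrite EFinM /smoothed_halfline /Rintegral fineK; last first.
  by apply: integrable_fin_num => //; exact: igh.
rewrite H; first by rewrite muleA -EFinM mulVf// mul1e.
  apply/measurable_EFinP; apply: measurable_funM; first exact: measurable_gaussian.
  exact: measurable_halfline.
by move=> b; rewrite lee_fin mulr_ge0 ?expR_ge0 ?halfline_ge0.
Qed.

(* Integrate [K_gaussian] over the centres [b <= q]. *)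
Let K_smoothed_halfline (n : nat) (q : R) :
  cintegral leb setT (fun x => K x * (smoothed_halfline q n x)%:C) = 0.
Proof.
set c : R := n.+1%:R ^+ 2; have c0 : 0 < c by rewrite exprn_gt0.
pose E (z : R * R) := gaussian c z.1 z.2 * halfline q z.2.
have mE : measurable_fun setT E.
  apply: measurable_funM.
    apply: measurableT_comp => //; apply: measurable_funN.
    apply: measurable_funM => //; apply: measurable_funX.
    by apply: measurable_funB; [exact: measurable_snd|exact: measurable_fst].
  by apply: measurableT_comp; [exact: measurable_halfline|exact: measurable_snd].
have E0 z : 0 <= E z by rewrite mulr_ge0 ?expR_ge0 ?halfline_ge0.
pose F (z : R * R) := K z.1 * (E z)%:C.
have mF : cmeas setT F.
  apply: cmeasM; last by split => //=; exact: measurable_cst.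
  by apply: (cmeas_comp (cint_meas cintK)); exact: measurable_fst.
have [mK1 mK2] := cint_meas cintK.
have nF z : normc (F z) = normc (K z.1) * E z.
  by rewrite Normc.normcM normc_real ger0_norm.
have iE x : leb.-integrable setT (fun b => (E (x, b))%:E).
  apply/integrableP; split.
    by apply/measurable_EFinP; apply: measurableT_comp mE _; exact: measurable_pair1.
  under eq_integral do rewrite /= ger0_norm//.
  by rewrite gaussian_halfline_integral ltry.
have iF : cint (leb \x leb)%E setT F.
  apply: (@cint_prod_le1 _ _ _ _ R leb leb F mF
    (fun x => n.+1%:R^-1 * Num.sqrt pi * normc (K x))).
    exact: (integrableZl measurableT (n.+1%:R^-1 * Num.sqrt pi)
      (integrable_normc measurableT cintK)).
  move=> x; have -> : (\int[leb]_y (normc (F (x, y)))%:E =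
      \int[leb]_y ((normc (K x))%:E * (E (x, y))%:E))%E.
    by apply: eq_integral => y _; rewrite nF EFinM.
  rewrite ge0_integralZl ?lee_fin ?normc_ge0//; last 2 first.
    by have /integrableP[] := iE x.
    by move=> b _; rewrite lee_fin.
  rewrite gaussian_halfline_integral -EFinM lee_fin mulrC ler_wpM2r ?normc_ge0//.
  rewrite ler_wpM2l ?invr_ge0//.
  exact: le_trans (ler_norm _) (smoothed_halfline_bounded _ _ _).
have n0 : n.+1%:R != 0 :> R by rewrite pnatr_eq0.
have : cintegral leb setT (fun x => cintegral leb setT (fun b => F (x, b))) = 0.
  rewrite (cintegral_fubini1 iF) -(cintegral_fubini2 iF).
  transitivity (cintegral leb setT (fun _ : R => 0 : R[i])); last first.
    by apply: complex_eqP; exact: Rintegral0.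
  apply: eq_cintegral => b _.
  rewrite (_ : (fun x => F (x, b)) =
      fun x => (halfline q b)%:C * (K x * (gaussian c b x)%:C)); last first.
    apply/funext => x; rewrite /F /E/= (_ : gaussian c x b = gaussian c b x).
    case: (K x) => k1 k2; move: (gaussian c b x) (halfline q b) => g0 h0.
    by apply: complex_eqP => /=; ring.
  by rewrite /gaussian -(sqrrN (b - x)) opprB.
  rewrite cintegralMl ?K_gaussian ?mulr0//.
  apply: (@cint_le _ _ _ leb setT _ (fun x => normc (K x))) => //.
  - by apply: cmeasM; [exact: cint_meas cintK|exact: cmeas_gaussian].
  - exact: integrable_normc.
  - move=> x _; rewrite Normc.normcM normc_real ger0_norm ?expR_ge0//.
    rewrite ler_piMr ?normc_ge0// -expR0 ler_expR oppr_le0.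
    by rewrite mulr_ge0 ?sqr_ge0.
move=> H.
have cS : cint leb setT (fun x => K x * (smoothed_halfline q n x)%:C).
  apply: (@cint_le _ _ _ leb setT _ (fun x => Num.sqrt pi * normc (K x))) => //.
  - apply: cmeasM; first exact: cint_meas cintK.
    split => /=; last exact: measurable_cst.
    exact: measurable_smoothed_halfline.
  - exact: (integrableZl measurableT (Num.sqrt pi) (integrable_normc measurableT cintK)).
  - move=> x _; rewrite Normc.normcM normc_real mulrC ler_wpM2r ?normc_ge0//.
    exact: smoothed_halfline_bounded.
have : n.+1%:R^-1%:C * cintegral leb setT (fun x => K x * (smoothed_halfline q n x)%:C) = 0.
  rewrite -H -cintegralMl//; apply: eq_cintegral => x _.
  rewrite [RHS](_ : _ = cintegral leb setT (fun b => K x * (E (x, b))%:C))//.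
  rewrite cintegralMl//; last first.
    split; first exact: (iE x).
    exact: (@integrable0 _ _ _ leb setT).
  rewrite mulrCA -rmorphM; congr (_ * _).
  apply: complex_eqP; rewrite /=; last by rewrite Rintegral_cst// mul0r.
  by rewrite /Rintegral gaussian_halfline_integral.
by move/eqP; rewrite mulf_eq0 => /orP[|/eqP//]; rewrite eq_complex/= invr_eq0 (negbTE n0).
Qed.

(** Limit in n of [K_smoothed_halfline]. At x = q the smoothing tends to half the expected value,
    but a single point is negligible. *)
Let K_halfline (q : R) : cintegral leb setT (fun x => K x * (halfline q x)%:C) = 0.
Proof.
have mh : cmeas setT (fun x => (halfline q x)%:C : R[i]).
  by split => /=; [exact: measurable_halfline|exact: measurable_cst].
have spi : Num.sqrt pi != 0 :> R by rewrite gt_eqF// sqrtr_gt0 pi_gt0.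
have mKS n : cmeas setT (fun x => K x * (smoothed_halfline q n x)%:C).
  apply: cmeasM; first exact: cint_meas cintK.
  by split => /=; [exact: measurable_smoothed_halfline|exact: measurable_cst].
have iK := integrable_normc measurableT cintK.
have : ccvg (fun n => cintegral leb setT (fun x => K x * (smoothed_halfline q n x)%:C))
    (cintegral leb setT (fun x => K x * (Num.sqrt pi * halfline q x)%:C)).
  apply: (@cintegral_dct _ _ _ leb setT _ _ (fun x => Num.sqrt pi * normc (K x))) => //.
  - apply: cmeasM; first exact: cint_meas cintK.
    split => /=; last exact: measurable_cst.
    by apply: measurable_funM => //; exact: measurable_halfline.
  - exact: (integrableZl measurableT (Num.sqrt pi) iK).
  - exists [set q]; split => //; first exact: lebesgue_measure_set1.
    move=> x /= Hx; apply: contrapT => /eqP xq; apply: Hx => _.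
    apply: ccvgM; first exact: ccvg_cst.
    by split => /=; [exact: cvg_smoothed_halfline|exact: cvg_cst].
  - apply: aeW => x n _; rewrite Normc.normcM normc_real mulrC ler_wpM2r ?normc_ge0//.
    exact: smoothed_halfline_bounded.
under eq_fun do rewrite K_smoothed_halfline.
move=> /(ccvg_unique (ccvg_cst 0)) H.
have cK : cint leb setT (fun x => K x * (halfline q x)%:C).
  apply: (@cint_le _ _ _ leb setT _ (fun x => normc (K x))) => //.
  - by apply: cmeasM => //; exact: cint_meas cintK.
  - move=> x _; rewrite Normc.normcM normc_real ger0_norm ?halfline_ge0//.
    by rewrite ler_piMr ?normc_ge0 ?halfline_le1.
have : (Num.sqrt pi)%:C * cintegral leb setT (fun x => K x * (halfline q x)%:C) = 0.
  rewrite H -cintegralMl//; apply: eq_cintegral => x _.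
  by rewrite rmorphM/= mulrCA.
by move/eqP; rewrite mulf_eq0 => /orP[|/eqP//]; rewrite eq_complex/= (negbTE spi).
Qed.

(** The primitive of k from -oo vanishes identically, and by Lebesgue differentiation its derivative
    is k almost everywhere. *)
Let halfline_integrals_eq0 (k : R -> R) : leb.-integrable setT (EFin \o k) ->
  (forall q, \int[leb]_x (k x * halfline q x) = 0) -> {ae leb, forall x, k x = 0}.
Proof.
move=> ik k0; have loc : locally_integrable setT k by exact: open_integrable_locally openT ik.
have ik' y : leb.-integrable `]-oo, y] (EFin \o k).
  by apply: integrableS ik.
have F0 : (fun x : R => \int[leb]_(t in `]-oo, x]) k t) = cst 0.
  apply/funext => y /=; rewrite -(k0 y) [LHS]Rintegral_mkcond.
  apply: eq_Rintegral => u _; rewrite /halfline patchE indicE.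
  by case: ifP; rewrite ?mulr1 ?mulr0.
have := FTC1Ny ik' loc; rewrite /= F0 => H.
apply: (ae_imply2 _ H H) => x [_ <-] _; exact: derive1_cst.
Qed.

Lemma orthogonal_gaussians_eq0 : h = (fun=> 0) %[ae leb].
Proof.
have [iK1 iK2] := cintK.
have K1 q : \int[leb]_x (Re (K x) * halfline q x) = 0.
  have := congr1 (@complex.Re R) (K_halfline q); rewrite /= => <-.
  by apply: eq_Rintegral => x _; rewrite [RHS]Re_mul /= mulr0 subr0.
have K2 q : \int[leb]_x (Im (K x) * halfline q x) = 0.
  have := congr1 (@complex.Im R) (K_halfline q); rewrite /= => <-.
  by apply: eq_Rintegral => x _; rewrite [RHS]Im_mul /= mulr0 add0r.
apply: (ae_imply2 _ (halfline_integrals_eq0 iK1 K1) (halfline_integrals_eq0 iK2 K2)).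
move=> x a b _; have : K x = 0 by exact: complex_eqP.
move/eqP; rewrite mulf_eq0 => /orP[/eqP//|].
by rewrite eq_complex/= gt_eqF// expR_gt0.
Qed.

End gaussians_total.

(** * Weyl operators and the Fourier transform *)

Section fourier_weyl.
Context {R : realType}.
Local Notation leb := (@lebesgue_measure R).
Variable F : (R -> R[i]) -> R -> R[i].
Hypothesis fourierF : fourier_transform F.

Let LF f : L2 f -> L2 (F f). Proof. by have [[+ _ _ _] _] := fourierF; apply. Qed.

Lemma fourier_inner f g : L2 f -> L2 g -> L2inner (F f) (F g) = L2inner f g.
Proof. by have [[_ _ + _] _] := fourierF; apply. Qed.

Lemma fourier_onto g : L2 g -> exists2 f, L2 f & F f = g %[ae leb].
Proof. by have [[_ _ _ +] _] := fourierF; apply. Qed.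

Definition weyl (a b : R) (f : R -> R[i]) (x : R) : R[i] :=
  cexp ((x * b) *i) * f (x + a).

(** Conjugate of [weyl a b] by the Fourier transform. In [weyl] the translation acts before the
    modulation, so its phase a z is shifted along with f, to a (z - b). *)
Definition weyl_dual (a b : R) (f : R -> R[i]) (z : R) : R[i] :=
  cexp ((a * (z - b)) *i) * f (z - b).

Lemma L2_unimodular (u : R -> R) f : measurable_fun setT u -> L2 f ->
  L2 (fun x => cexp ((u x) *i) * f x).
Proof.
move=> mu Lf; apply: L2_mul_le1 => //; first exact: cmeas_cexp_i.
by move=> x; rewrite normc_cexp_i.
Qed.

Lemma L2_weyl a b f : L2 f -> L2 (weyl a b f).
Proof.
move=> Lf; apply: (@L2_unimodular (fun x => x * b)); last exact: L2_translation.
exact: measurable_funM.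
Qed.

Lemma L2_weyl_dual a b f : L2 f -> L2 (weyl_dual a b f).
Proof.
move=> Lf; apply: (@L2_unimodular (fun z => a * (z - b))).
  by apply: measurable_funM => //; exact: measurable_funB.
exact: L2_translation.
Qed.

Lemma gaussian_translation (c b a x : R) : gaussian c b (x + a) = gaussian c (b - a) x.
Proof. by rewrite /gaussian; congr (expR (- (_ * _ ^+ 2))); ring. Qed.

(** A Weyl operator sends a Gaussian to a modulated Gaussian, which is Schwartz, so both sides are
    given by the integral formula; translating the integration variable by a identifies them. *)
Lemma weyl_gaussian (a b c m : R) : 0 < c ->
  F (weyl a b (fun x => (gaussian c m x)%:C)) =
  weyl_dual a b (F (fun x => (gaussian c m x)%:C)) %[ae leb].
Proof.
move=> c0; have [_ schF] := fourierF.
pose ft (f : R -> R[i]) z := ((Num.sqrt (2 * pi))^-1)%:C *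
  cintegral leb setT (fun x => f x * cexp (- ((z * x) *i))).
have H1 : F (weyl a b (fun x => (gaussian c m x)%:C)) =
    ft (weyl a b (fun x => (gaussian c m x)%:C)) %[ae leb].
  apply: schF; rewrite (_ : weyl _ _ _ =
      fun x => cexp ((b * x) *i) * (gaussian c (m - a) x)%:C).
    exact: schwartz_modulated_gaussian.
  by apply/funext => x; rewrite /weyl gaussian_translation mulrC [x * b]mulrC mulrC.
have H2 : F (fun x => (gaussian c m x)%:C) = ft (fun x => (gaussian c m x)%:C) %[ae leb].
  apply: schF; have := schwartz_modulated_gaussian 0 m c0.
  by under eq_fun do rewrite mul0r cexp0 mul1r.
(* The formula for the plain Gaussian is used at z - b, so its exceptional null set is
   translated. *)
have H2' := ae_translation (- b) H2.
apply: (ae_imply2 _ H1 H2') => z H1z H2z zT; rewrite H1z// /weyl_dual H2z//.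
rewrite /ft mulrCA; congr (_ * _).
have mg := cmeas_gaussian c m.
have me u v : measurable_fun setT (fun x : R => u * x + v).
  by apply: measurable_funD => //; exact: measurable_funM.
rewrite -cintegralMl//; last first.
  apply: (@cint_le _ _ _ leb setT _ (gaussian c m)) => //.
  - apply: cmeasM => //; apply: cmeas_cexp; split => /=.
      by rewrite oppr0; exact: measurable_cst.
    by apply: measurable_funN; exact: measurable_funM.
  - exact: integrable_gaussian.
  - move=> x _; rewrite Normc.normcM normc_real ger0_norm ?expR_ge0// normc_cexp.
    by rewrite Re_opp /= oppr0 expR0 mulr1.
rewrite -(cintegral_translation (- a)); last first.
  apply: cmeasM; first exact: L2_cmeas (L2_weyl _ _ (L2_gaussian _ c0)).
  apply: cmeas_cexp; split => /=; first by rewrite oppr0; exact: measurable_cst.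
  by apply: measurable_funN; exact: measurable_funM.
apply: eq_cintegral => x _; rewrite /weyl subrK [RHS]mulrCA mulrAC mulrC.
congr (_ * _); rewrite -!cexpD; congr cexp; apply: complex_eqP => /=; ring.
Qed.

Lemma conjc_cexpM (y : R) (z : R[i]) :
  conjc (cexp (y *i) * z) = cexp ((- y) *i) * conjc z.
Proof.
by case: z => p q; rewrite !cexpE; apply: complex_eqP; rewrite /= expR0 cosN sinN; ring.
Qed.

Lemma cmeas_inner f g : L2 f -> L2 g -> cmeas setT (fun x : R => f x * conjc (g x)).
Proof.
by move=> Lf Lg; apply: cmeasM; [|apply: cmeas_conj]; exact: L2_cmeas.
Qed.

(** The adjoint is the operator with opposite parameters up to a phase, since translations and
    modulations do not commute. The phases here and in [weyl_inner] are inverse to each other and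
    cancel in [fourier_weyl]. *)
Lemma weyl_dual_inner a b f g : L2 f -> L2 g ->
  L2inner f (weyl_dual (- a) (- b) g) = cexp ((a * b) *i) * L2inner (weyl_dual a b f) g.
Proof.
move=> Lf Lg; rewrite /L2inner -cintegralMl//; last first.
  by apply: cint_inner => //; exact: L2_weyl_dual.
rewrite -[LHS](cintegral_translation (- b)); last first.
  by apply: cmeas_inner => //; exact: L2_weyl_dual.
apply: eq_cintegral => x _; rewrite /weyl_dual opprK subrK conjc_cexpM.
have -> : cexp ((- (- a * x)) *i) = cexp ((a * b) *i) * cexp ((a * (x - b)) *i).
  by rewrite -cexpD; congr cexp; apply: complex_eqP => /=; ring.
ring.
Qed.

Lemma weyl_inner a b f g : L2 f -> L2 g ->
  L2inner (weyl a b f) g = cexp (- ((a * b) *i)) * L2inner f (weyl (- a) (- b) g).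
Proof.
move=> Lf Lg; rewrite /L2inner -cintegralMl//; last first.
  by apply: cint_inner => //; exact: L2_weyl.
rewrite -[LHS](cintegral_translation (- a)); last first.
  by apply: cmeas_inner => //; exact: L2_weyl.
apply: eq_cintegral => x _; rewrite /weyl subrK conjc_cexpM.
have -> : cexp (((x - a) * b) *i) = cexp (- ((a * b) *i)) * cexp ((- (x * - b)) *i).
  by rewrite -cexpD; congr cexp; apply: complex_eqP => /=; ring.
ring.
Qed.

(** Surjectivity writes the defect as F k. Passing to adjoints in the pairing of k with a Gaussian
    leaves [weyl_gaussian] for the parameters (-a, -b), so the pairing is 0; by totality k = 0, and
    the defect has norm 0. *)
Lemma fourier_weyl a b f : L2 f -> F (weyl a b f) = weyl_dual a b (F f) %[ae leb].
Proof.
move=> Lf; have LW := LF (L2_weyl a b Lf); have LD := L2_weyl_dual a b (LF Lf).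
have Lh := L2B LW LD; have [k Lk Fk] := fourier_onto Lh.
have k_gaussian c m : 0 < c -> L2inner k (fun x => (gaussian c m x)%:C) = 0.
  move=> c0; have Lg := L2_gaussian m c0; set g := fun x => _ in Lg *.
  rewrite -fourier_inner// (L2inner_congr Fk (g' := F g)); last exact: aeW.
  rewrite L2innerB//; try exact: LF.
  rewrite fourier_inner//; last exact: L2_weyl.
  rewrite weyl_inner// -fourier_inner//; last exact: L2_weyl.
  rewrite (L2inner_congr (f' := F f) (g' := weyl_dual (- a) (- b) (F g))); last 2 first.
  - exact: aeW.
  - exact: weyl_gaussian.
  rewrite weyl_dual_inner; try exact: LF.
  rewrite mulrA -cexpD addNr cexp0 mul1r subrr//.
have k0 := orthogonal_gaussians_eq0 Lk k_gaussian.
have h0 : L2inner (fun x => F (weyl a b f) x - weyl_dual a b (F f) x)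
    (fun x => F (weyl a b f) x - weyl_dual a b (F f) x) = 0.
  rewrite -(L2inner_congr Fk Fk) fourier_inner// (L2inner_congr k0 k0).
  rewrite /L2inner mul0r; apply: complex_eqP; exact: Rintegral0.
have H := L2inner_eq0 Lh h0.
by apply: (ae_imply2 _ H H) => x + _ xT => /(_ xT)/eqP; rewrite subr_eq0 => /eqP.
Qed.

End fourier_weyl.

(** * Averaged translation operators *)

Section parametric_measurability.
Context d1 d2 (T1 : measurableType d1) (T2 : measurableType d2) (R : realType).
Variable m2 : {sigma_finite_measure set T2 -> \bar R}.

Lemma measurable_parametric_Rintegral (h : T1 * T2 -> R) : measurable_fun setT h ->
  measurable_fun setT (fun x => \int[m2]_y h (x, y)).
Proof.
move=> mh; apply: measurableT_comp => //.
have mH : measurable_fun setT (EFin \o h) by exact/measurable_EFinP.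
under eq_fun do rewrite integralE.
apply: emeasurable_funB.
  have := @measurable_fun_fubini_tonelli_F _ _ T1 T2 R m2 (EFin \o h)^\+%E
    (measurable_funepos mH) (fun=> funepos_ge0 _ _).
  congr measurable_fun; apply/funext => x; apply: eq_integral => y _.
  by rewrite !funeposE.
have := @measurable_fun_fubini_tonelli_F _ _ T1 T2 R m2 (EFin \o h)^\-%E
  (measurable_funeneg mH) (fun=> funeneg_ge0 _ _).
congr measurable_fun; apply/funext => x; apply: eq_integral => y _.
by rewrite !funenegE.
Qed.

Lemma cmeas_parametric_cintegral (f : T1 * T2 -> R[i]) : cmeas setT f ->
  cmeas setT (fun x => cintegral m2 setT (fun y => f (x, y))).
Proof.
move=> [mf1 mf2]; split.
  exact: (measurable_parametric_Rintegral mf1).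
exact: (measurable_parametric_Rintegral mf2).
Qed.

Lemma cmeas_parametric_cintegral_in (D : set T2) (f : T1 * T2 -> R[i]) :
  measurable D -> cmeas setT f ->
  cmeas setT (fun x => cintegral m2 D (fun y => f (x, y))).
Proof.
move=> mD mf; have -> : (fun x => cintegral m2 D (fun y => f (x, y))) =
    fun x => cintegral m2 setT (fun y => (\1_D y)%:C * f (x, y)).
  apply/funext => x; apply: complex_eqP; rewrite /= Rintegral_mkcond;
  apply: eq_Rintegral => y _; rewrite patchE ?Re_mul ?Im_mul indicE /= mul0r;
  by case: ifP => _; rewrite ?mul1r ?mul0r ?subr0 ?addr0.
apply: (cmeas_parametric_cintegral (f := fun z => (\1_D z.2)%:C * f z)).
apply: cmeasM => //; split => /=; last exact: measurable_cst.
by apply: (@measurableT_comp _ _ _ _ _ _ (\1_D : T2 -> R) _ snd) => //; exact: measurable_indic.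
Qed.

End parametric_measurability.

Section kernel_operator.
Context d (T : measurableType d) (R : realType) (P : probability T R).
Local Notation leb := (@lebesgue_measure R).
Implicit Types f g : R -> R[i].

Lemma integrable_normc_of_nsq (h : T -> R[i]) : cmeas setT h ->
  P.-integrable setT (fun w => (nsq (h w))%:E) -> cint P setT h.
Proof.
move=> mh ih.
apply: (@cint_le _ _ _ P setT _ (fun w => 1 + nsq (h w))) => //.
  have := @integrableD _ _ _ P setT measurableT (cst 1%E) (fun w => (nsq (h w))%:E).
  by apply => //; exact: finite_measure_integrable_cst.
move=> w _; rewrite nsqE -subr_ge0.
have -> : 1 + normc (h w) ^+ 2 - normc (h w) = (normc (h w) - 2^-1) ^+ 2 + 3 / 4 by field.
by rewrite addr_ge0 ?sqr_ge0// divr_ge0.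
Qed.

(** Jensen's inequality for the squared modulus: with c the mean of h, integrate 2 Re (conj c * h)
    <= |c|^2 + |h|^2, whose left side integrates to 2 |c|^2. If the right side is infinite there is
    nothing to prove. *)
Lemma nsq_cintegral_le (h : T -> R[i]) : cmeas setT h ->
  ((nsq (cintegral P setT h))%:E <= \int[P]_w (nsq (h w))%:E)%E.
Proof.
move=> mh; have mn : measurable_fun setT (fun w => (nsq (h w))%:E).
  by apply/measurable_EFinP; exact: measurable_nsq.
have I0 : (0 <= \int[P]_w (nsq (h w))%:E)%E.
  by apply: integral_ge0 => w _; rewrite lee_fin nsq_ge0.
have [lty|] := ltP (\int[P]_w (nsq (h w))%:E)%E +oo%E; last first.
  by rewrite leye_eq => /eqP ->; rewrite leey.
have ih : P.-integrable setT (fun w => (nsq (h w))%:E).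
  apply/integrableP; split => //; apply: le_lt_trans lty.
  rewrite le_eqVlt; apply/orP; left; apply/eqP; apply: eq_integral => w _.
  by rewrite gee0_abs// lee_fin nsq_ge0.
have ch := integrable_normc_of_nsq mh ih.
set c := cintegral P setT h.
have ic : P.-integrable setT (EFin \o (fun=> nsq c)).
  exact: finite_measure_integrable_cst.
have H : 2 * nsq c <= nsq c + \int[P]_w nsq (h w).
  have E1 : 2 * nsq c = \int[P]_w (2 * Re (conjc c * h w)).
    rewrite {1}/c nsq_cintegral// -/c RintegralZl//.
    by case: (cintMl (conjc c) measurableT ch).
  have E2 : nsq c + \int[P]_w nsq (h w) = \int[P]_w (nsq c + nsq (h w)).
    by rewrite RintegralD// Rintegral_probability_cst.
  rewrite E1 E2; apply: le_Rintegral => //.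
  - exact: (integrableZl measurableT 2 (cintMl (conjc c) measurableT ch).1).
  - exact: (@integrableD _ _ _ P setT measurableT (fun=> (nsq c)%:E) (fun w => (nsq (h w))%:E)).
  move=> w _; rewrite -(nsq_conj c); apply: le_trans (normcM_le _ _).
  by rewrite ler_pM2l// (le_trans (ler_norm _)) ?normc_Re.
rewrite -[leRHS]fineK ?ge0_fin_numE// lee_fin -/(Rintegral _ _ _); lra.
Qed.

Variables (A : R * T -> R[i]) (E : T -> R).
Hypotheses (mA : cmeas setT A) (A1 : forall z, normc (A z) <= 1).
Hypothesis mE : measurable_fun setT E.

(** Common form of the forward operator, the dual operator and their discretizations: a random
    translation weighted by a factor of modulus at most 1. *)
Definition kernel_operator f (x : R) : R[i] :=
  cintegral P setT (fun w => A (x, w) * f (x + E w)).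

Let mshift : measurable_fun setT (fun z : R * T => z.1 + E z.2).
Proof.
apply: measurable_funD; first exact: measurable_fst.
by apply: measurableT_comp => //; exact: measurable_snd.
Qed.

Let mfs f : cmeas setT f -> cmeas setT (fun z : R * T => f (z.1 + E z.2)).
Proof. by move=> mf; apply: (cmeas_comp mf). Qed.

Let mAf f : cmeas setT f -> cmeas setT (fun z => A z * f (z.1 + E z.2)).
Proof. by move=> mf; apply: cmeasM => //; exact: mfs. Qed.

Lemma cmeas_section2 (F : R * T -> R[i]) x : cmeas setT F -> cmeas setT (fun w => F (x, w)).
Proof. by move=> mF; apply: (cmeas_comp mF); exact: measurable_pair1. Qed.

Lemma cmeas_kernel_operator f : cmeas setT f -> cmeas setT (kernel_operator f).
Proof. by move=> mf; exact: (cmeas_parametric_cintegral P (mAf mf)). Qed.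

(** Integrate in x before w: by translation invariance every inner integral is [N2 f], and P has
    mass 1. *)
Lemma integral_nsq_shift f : cmeas setT f ->
  (\int[leb]_x \int[P]_w (nsq (f (x + E w)))%:E = N2 f)%E.
Proof.
move=> mf.
have mn : measurable_fun setT (fun z : R * T => (nsq (f (z.1 + E z.2)))%:E).
  by apply/measurable_EFinP; apply: measurable_nsq; exact: mfs.
rewrite -(fubini_tonelli1 (m1 := leb) (m2 := P) (fun z : R * T => (nsq (f (z.1 + E z.2)))%:E))//; last first.
  by move=> z; rewrite lee_fin nsq_ge0.
rewrite (fubini_tonelli2 (m1 := leb) (m2 := P))//; last first.
  by move=> z; rewrite lee_fin nsq_ge0.
rewrite /fubini_G /=.
under eq_integral => w _.
  rewrite (ge0_integral_translation (E w) (f := fun x => (nsq (f x))%:E)); last 2 first.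
    by apply/measurable_EFinP; exact: measurable_nsq.
    by move=> x; rewrite lee_fin nsq_ge0.
  over.
by rewrite integral_cst//= [X in (_ * X)%E]probability_setT mule1.
Qed.

(** A bound independent of the weight A, hence uniform along a sequence of weights. It is finite for
    almost every x, and at such x the integral defining the operator converges absolutely. *)
Definition shifted_energy f (x : R) : \bar R := (\int[P]_w (nsq (f (x + E w)))%:E)%E.

Lemma shifted_energy_ge0 f x : (0 <= shifted_energy f x)%E.
Proof. by apply: integral_ge0 => w _; rewrite lee_fin nsq_ge0. Qed.

Lemma integrable_shifted_energy f : L2 f -> leb.-integrable setT (shifted_energy f).
Proof.
move=> /L2P[mf fy]; apply/integrableP; split.
  apply: (@measurable_fun_fubini_tonelli_F _ _ _ _ _ P
    (fun z : R * T => (nsq (f (z.1 + E z.2)))%:E)).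
    by apply/measurable_EFinP; apply: measurable_nsq; exact: mfs.
  by move=> z; rewrite lee_fin nsq_ge0.
under eq_integral do rewrite gee0_abs ?shifted_energy_ge0//.
by rewrite integral_nsq_shift.
Qed.

Lemma nsq_kernel_le z (c : R[i]) : nsq (A z * c) <= nsq c.
Proof. by rewrite nsqM ler_piMl ?nsq_ge0// nsqE expr_le1 ?normc_ge0. Qed.

Lemma nsq_kernel_operator_le f x : cmeas setT f ->
  ((nsq (kernel_operator f x))%:E <= shifted_energy f x)%E.
Proof.
move=> mf; apply: le_trans (nsq_cintegral_le (cmeas_section2 x (mAf mf))) _.
apply: ge0_le_integral => //.
- by move=> w _; rewrite lee_fin nsq_ge0.
- by apply/measurable_EFinP; apply: measurable_nsq; exact: (cmeas_section2 x (mAf mf)).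
- by apply/measurable_EFinP; apply: measurable_nsq; exact: (cmeas_section2 x (mfs mf)).
by move=> w _; rewrite lee_fin nsq_kernel_le.
Qed.

Lemma N2_kernel_operator_le f : cmeas setT f -> (N2 (kernel_operator f) <= N2 f)%E.
Proof.
move=> mf; rewrite -(integral_nsq_shift mf); apply: ge0_le_integral => //.
- by move=> x _; rewrite lee_fin nsq_ge0.
- by apply/measurable_EFinP; apply: measurable_nsq; exact: cmeas_kernel_operator.
- apply: (@measurable_fun_fubini_tonelli_F _ _ _ _ _ P
    (fun z : R * T => (nsq (f (z.1 + E z.2)))%:E)).
    by apply/measurable_EFinP; apply: measurable_nsq; exact: mfs.
  by move=> z; rewrite lee_fin nsq_ge0.
by move=> x _; exact: nsq_kernel_operator_le.
Qed.

Lemma L2_kernel_operator f : L2 f -> L2 (kernel_operator f).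
Proof.
move=> /L2P[mf fy]; apply/L2P; split; first exact: cmeas_kernel_operator.
exact: le_lt_trans (N2_kernel_operator_le mf) fy.
Qed.

Lemma ae_shifted_energy_fin f : L2 f ->
  {ae leb, forall x, shifted_energy f x \is a fin_num}.
Proof.
move=> /integrable_shifted_energy/integrable_ae-/(_ measurableT).
by apply: ae_imply => x; apply.
Qed.

Lemma cint_shifted f x : cmeas setT f -> shifted_energy f x \is a fin_num ->
  cint P setT (fun w => f (x + E w)).
Proof.
move=> mf; rewrite ge0_fin_numE ?shifted_energy_ge0// => fx.
apply: integrable_normc_of_nsq; first exact: (cmeas_section2 x (mfs mf)).
apply/integrableP; split.
  by apply/measurable_EFinP; apply: measurable_nsq; exact: (cmeas_section2 x (mfs mf)).
apply: le_lt_trans fx; rewrite le_eqVlt; apply/orP; left; apply/eqP.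
by apply: eq_integral => w _; rewrite gee0_abs// lee_fin nsq_ge0.
Qed.

Lemma cint_kernel f x : cmeas setT f -> shifted_energy f x \is a fin_num ->
  cint P setT (fun w => A (x, w) * f (x + E w)).
Proof.
move=> mf fx; have if_ := integrable_normc measurableT (cint_shifted mf fx).
apply: (@cint_le _ _ _ P setT _ (fun w => normc (f (x + E w)))) => //.
  exact: (cmeas_section2 x (mAf mf)).
by move=> w _; rewrite !normc_sqrt ler_sqrt ?nsq_ge0// nsq_kernel_le.
Qed.

(** Only almost everywhere: where a shifted energy is infinite the integrals may take default
    values, which need not be additive. *)
Lemma kernel_operatorB f g : L2 f -> L2 g ->
  kernel_operator (fun x => f x - g x) =
  (fun x => kernel_operator f x - kernel_operator g x) %[ae leb].
Proof.
move=> Lf Lg; apply: (ae_imply2 _ (ae_shifted_energy_fin Lf) (ae_shifted_energy_fin Lg)).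
move=> x fx gx _; rewrite /kernel_operator -cintegralB//; last 2 first.
  by apply: cint_kernel => //; exact: L2_cmeas.
  by apply: cint_kernel => //; exact: L2_cmeas.
by apply: eq_cintegral => w _; rewrite mulrBr.
Qed.

Lemma kernel_operator_extension : unique_continuous_L2_extension kernel_operator kernel_operator.
Proof.
apply: contraction_L2_extension => [f|f g Lf Lg]; first exact: L2_kernel_operator.
rewrite (N2_congr (g := kernel_operator (fun x => f x - g x))).
  by apply: N2_kernel_operator_le; exact: L2_cmeas (L2B Lf Lg).
by have := kernel_operatorB Lf Lg; apply: ae_imply => x H _; rewrite H.
Qed.

Lemma kernel_operator_inner f g : L2 f -> L2 g ->
  L2inner (kernel_operator f) g =
  cintegral P setT (fun w => L2inner (fun x => A (x, w) * f (x + E w)) g).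
Proof.
move=> Lf Lg; have mf := L2_cmeas Lf; have mg := L2_cmeas Lg.
pose F (z : R * T) := A z * f (z.1 + E z.2) * conjc (g z.1).
have mF : cmeas setT F.
  by apply: cmeasM; [exact: mAf|apply: cmeas_conj; exact: (cmeas_comp mg)].
have Fi : cint (leb \x P)%E setT F.
  (* Integrating in x first gives, by translation invariance, a bound that is the same for every
     w. *)
  apply: (@cint_prod_le2 _ _ _ _ _ leb P F mF
    (fun=> fine (2^-1%:E * (N2 f + N2 g))%E)).
    exact: finite_measure_integrable_cst.
  move=> w; have [_ fy] := (L2P _).1 Lf; have [_ gy] := (L2P _).1 Lg.
  have nfw : (0 <= N2 f + N2 g)%E by rewrite adde_ge0 ?N2_ge0.
  have -> : (N2 f + N2 g)%E = (\int[leb]_x ((nsq (f (x + E w)))%:E + (nsq (g x))%:E))%E.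
    have mfw := measurable_nsq (cmeas_translation (E w) mf).
    rewrite ge0_integralD//.
    - rewrite (ge0_integral_translation (E w) (f := fun x => (nsq (f x))%:E))//.
        by apply/measurable_EFinP; exact: measurable_nsq.
      by move=> x; rewrite lee_fin nsq_ge0.
    - by move=> x _; rewrite lee_fin nsq_ge0.
    - exact/measurable_EFinP.
    - by move=> x _; rewrite lee_fin nsq_ge0.
    - by apply/measurable_EFinP; exact: measurable_nsq.
  have mS : measurable_fun setT (fun x : R => ((nsq (f (x + E w)))%:E + (nsq (g x))%:E)%E).
    apply: emeasurable_funD; apply/measurable_EFinP; apply: measurable_nsq => //.
    exact: cmeas_translation.
  rewrite fineK; last first.
    rewrite ge0_fin_numE; last first.
      by rewrite mule_ge0// integral_ge0// => x _; rewrite adde_ge0// lee_fin nsq_ge0.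
    rewrite lte_mul_pinfty//.
    rewrite ge0_integralD//.
    - rewrite (ge0_integral_translation (E w) (f := fun x => (nsq (f x))%:E))//.
      + exact: lte_add_pinfty.
      + by apply/measurable_EFinP; exact: measurable_nsq.
      by move=> x; rewrite lee_fin nsq_ge0.
    - by move=> x _; rewrite lee_fin nsq_ge0.
    - by apply/measurable_EFinP; apply: measurable_nsq; exact: cmeas_translation.
    - by move=> x _; rewrite lee_fin nsq_ge0.
    - by apply/measurable_EFinP; exact: measurable_nsq.
  rewrite -ge0_integralZl//; last by move=> x _; rewrite adde_ge0// lee_fin nsq_ge0.
  apply: ge0_le_integral => //.
  - by move=> x _; rewrite lee_fin normc_ge0.
  - apply/measurable_EFinP; apply: measurable_normc.
    by apply: (cmeas_comp mF); exact: measurable_pair2.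
  - exact: measurable_funeM.
  move=> x _; rewrite lee_fin ler_pdivlMl// (le_trans (normcM_le _ _))//.
  by rewrite nsq_conj lerD2r nsq_kernel_le.
transitivity (cintegral (leb \x P)%E setT F); last by rewrite -cintegral_fubini2.
rewrite -cintegral_fubini1//; apply: cintegral_negligible_congr.
have := ae_shifted_energy_fin Lf; apply: ae_imply => x fx _.
by rewrite -cintegralMr//; exact: cint_kernel.
Qed.

End kernel_operator.

Lemma integrable_fine d (T : measurableType d) (R : realType)
    (mu : {measure set T -> \bar R}) (h : T -> \bar R) :
  mu.-integrable setT h -> mu.-integrable setT (fun x => (fine (h x))%:E).
Proof.
move=> ih; apply: (le_integrable measurableT _ _ ih).
  by apply/measurable_EFinP; apply: measurableT_comp => //; case/integrableP: ih.
by move=> x _; case: (h x) => [r| |]//=; rewrite normr0 leey.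
Qed.

Section kernel_limit.
Context d (T : measurableType d) (R : realType) (P : probability T R).
Local Notation leb := (@lebesgue_measure R).
Variables (A_ : nat -> R * T -> R[i]) (A : R * T -> R[i]) (E : T -> R).
Hypotheses (mA_ : forall n, cmeas setT (A_ n)) (A_1 : forall n z, normc (A_ n z) <= 1).
Hypotheses (mA : cmeas setT A) (A1 : forall z, normc (A z) <= 1).
Hypothesis mE : measurable_fun setT E.
Hypothesis cvgA : forall x, {ae P, forall w, ccvg (fun n => A_ n (x, w)) (A (x, w))}.

Lemma ccvg_kernel_operator f x : cmeas setT f -> shifted_energy P E f x \is a fin_num ->
  ccvg (fun n => kernel_operator P (A_ n) E f x) (kernel_operator P A E f x).
Proof.
move=> mf fx; apply: (@cintegral_dct _ _ _ P setT _ _ (fun w => normc (f (x + E w)))) => //.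
- by move=> n; exact: cint_meas (cint_kernel (mA_ n) (A_1 n) mE mf fx).
- exact: cint_meas (cint_kernel mA A1 mE mf fx).
- exact: integrable_normc (cint_shifted mE mf fx).
- by have := cvgA x; apply: ae_imply => w H _; apply: ccvgM => //; exact: ccvg_cst.
apply: aeW => w n _; rewrite !normc_sqrt ler_sqrt ?nsq_ge0//.
exact: nsq_kernel_le.
Qed.

Lemma ccvg_kernel_operator_inner f g : L2 f -> L2 g ->
  ccvg (fun n => L2inner (kernel_operator P (A_ n) E f) g)
       (L2inner (kernel_operator P A E f) g).
Proof.
move=> Lf Lg; have mf := L2_cmeas Lf; have mg := L2_cmeas Lg.
(* Integrable bound common to all n, from [normcM_le] and Jensen; [fine] is harmless since the
   energy is finite almost everywhere. *)
pose h x := 2^-1 * (fine (shifted_energy P E f x) + nsq (g x)).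
have h_ge B x : cmeas setT B -> (forall z, normc (B z) <= 1) ->
    shifted_energy P E f x \is a fin_num ->
    normc (kernel_operator P B E f x * conjc (g x)) <= h x.
  move=> mB B1 fx; rewrite /h ler_pdivlMl// (le_trans (normcM_le _ _))//.
  by rewrite nsq_conj lerD2r -lee_fin fineK// nsq_kernel_operator_le.
have mK B : cmeas setT B -> cmeas setT (fun x => kernel_operator P B E f x * conjc (g x)).
  by move=> mB; apply: cmeasM; [exact: cmeas_kernel_operator|exact: cmeas_conj].
apply: (@cintegral_dct _ _ _ leb setT _ _ h) => //.
- by move=> n; exact: mK.
- exact: mK.
- have i1 := integrable_fine (integrable_shifted_energy P mE Lf).
  have i2 := integrable_nsq Lg.
  have := integrableZl measurableT 2^-1 (integrableD measurableT i1 i2).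
  by [].
- have := ae_shifted_energy_fin P mE Lf; apply: ae_imply => x fx _.
  by apply: ccvgM; [exact: ccvg_kernel_operator|exact: ccvg_cst].
have := ae_shifted_energy_fin P mE Lf; apply: ae_imply => x fx n _.
exact: h_ge.
Qed.

End kernel_limit.

(** Convergence at a point means that the measurable function limsup |V_n - V| vanishes there; its
    double integral over D is 0 in one order, hence in the other by Tonelli. This serves exceptional
    sets of paths that vary with u, when one path has to be controlled for almost every u. *)
Lemma ae_cvg_swap d1 d2 (T1 : measurableType d1) (T2 : measurableType d2) (R : realType)
    (m1 : {sigma_finite_measure set T1 -> \bar R})
    (m2 : {sigma_finite_measure set T2 -> \bar R})
    (D : set T1) (V_ : nat -> T1 * T2 -> R) (V : T1 * T2 -> R) :
  measurable D -> (forall n, measurable_fun setT (V_ n)) -> measurable_fun setT V ->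
  (forall u, D u -> {ae m2, forall w, (fun n => V_ n (u, w)) @ \oo --> V (u, w)}) ->
  {ae m2, forall w, {ae m1, forall u, D u -> (fun n => V_ n (u, w)) @ \oo --> V (u, w)}}.
Proof.
move=> mD mV_ mV VV.
pose e n z : \bar R := `|(V_ n z - V z)%:E|%E.
have me n : measurable_fun setT (e n).
  by apply: measurableT_comp => //; apply/measurable_EFinP; exact: measurable_funB.
pose h z := limn_esup (e ^~ z).
have mh : measurable_fun setT h by exact: measurable_fun_limn_esup.
have h0 z : (0 <= h z)%E.
  rewrite /h limn_esup_lim; apply: lime_ge; first exact: is_cvg_esups.
  apply: nearW => n; apply: (@le_trans _ _ (e n z)); first exact: abse_ge0.
  by apply: ereal_sup_ubound; exists n => /=.
have hP z : h z = 0%E <-> (fun n => V_ n z) @ \oo --> V z.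
  split=> [hz|Vz].
    have : e ^~ z @ \oo --> 0%E.
      by apply: limn_esup_le_cvg; [rewrite -/(h z) hz|move=> n; exact: abse_ge0].
    move=> /fine_cvgP[_] H; apply/subr_cvg0/norm_cvg0P; exact: H.
  suff : e ^~ z @ \oo --> 0%E by move=> /cvg_limn_einf_sup[_].
  apply: cvg_EFin; first exact: nearW.
  by apply/norm_cvg0P/subr_cvg0.
pose g z := ((\1_D z.1)%:E * h z)%E.
have mg : measurable_fun setT g.
  apply: emeasurable_funM => //; apply/measurable_EFinP.
  exact: (@measurableT_comp _ _ _ _ _ _ (\1_D : T1 -> R) _ fst).
have g0 z : (0 <= g z)%E by rewrite mule_ge0// lee_fin.
have g_eq0 u : (\int[m2]_w g (u, w) = 0)%E.
  have [Du|Du] := pselect (D u); last first.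
    apply: integral0_eq => w _; rewrite /g/= indicE memNset//= mul0e; reflexivity.
  rewrite -[RHS](integral0 m2 setT); apply: integral_negligible_congr.
  by apply: ae_imply (VV u Du) => w /hP H _; rewrite /g H mule0.
have gsum : (\int[m2]_w \int[m1]_u g (u, w) = 0)%E.
  rewrite -[LHS](fubini_tonelli (m1 := m1) (m2 := m2) g mg g0).
  by rewrite -[RHS](integral0 m1 setT); apply: eq_integral => u _; exact: g_eq0.
have mg2 : measurable_fun setT (fun w => \int[m1]_u g (u, w))%E.
  exact: (@measurable_fun_fubini_tonelli_G _ _ T1 T2 R m1 g mg g0).
have : ae_eq m2 setT (fun w => \int[m1]_u g (u, w))%E (cst 0%E).
  apply/ae_eq_integral_abs => //; rewrite -[RHS]gsum; apply: eq_integral => w _.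
  by rewrite gee0_abs// integral_ge0.
apply: ae_imply => w /(_ I) gw.
have : ae_eq m1 setT (fun u => g (u, w)) (cst 0%E).
  apply/ae_eq_integral_abs => //.
    by apply: (measurableT_comp mg); exact: measurable_pair2.
  by rewrite -[RHS]gw; apply: eq_integral => u _; rewrite gee0_abs.
apply: ae_imply => u /(_ I) gu Du; apply/hP.
by move: gu; rewrite /g/= indicE mem_set//= mul1e.
Qed.

(** * Discretization of the Stieltjes integrals *)

Section uniform_grid.
Context {R : realType}.
Implicit Types (u : R) (N k : nat).

Definition grid N k : R := k%:R / N.+1%:R.

Lemma grid0 N : grid N 0 = 0. Proof. by rewrite /grid mul0r. Qed.

Lemma grid_last N : grid N N.+1 = 1. Proof. by rewrite /grid divff. Qed.

Lemma grid_nd N : {homo grid N : i j / (i <= j)%N >-> i <= j}.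
Proof. by move=> i j ij; rewrite ler_pM2r ?invr_gt0// ler_nat. Qed.

Lemma gridS N k : grid N k.+1 = grid N k + N.+1%:R^-1.
Proof. by rewrite /grid -natr1 mulrDl mul1r. Qed.

(** Left-open cells tile ]0, 1] exactly, and their Stieltjes measure is the plain difference of the
    values at the endpoints. *)
Definition cell N k : set R := `]grid N k, grid N k.+1].

Lemma grid_cell N u : 0 < u -> u <= 1 -> exists2 k : 'I_N.+1, cell N k u & True.
Proof.
move=> u0 u1; have ex : exists k, u <= grid N k.+1 by exists N; rewrite grid_last.
pose k := ex_minn ex; have [ku kmin] : u <= grid N k.+1 /\ forall m, u <= grid N m.+1 -> (k <= m)%N.
  by rewrite /k; case: ex_minnP.
have kN : (k < N.+1)%N by rewrite ltnS kmin// grid_last.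
exists (Ordinal kN) => //; rewrite /cell /= in_itv/= ku andbT ltNge; apply/negP => uk.
case: k {kN ku} kmin uk => [|k] kmin uk; first by move: uk; rewrite grid0 leNgt u0.
by have := kmin _ uk; rewrite ltnn.
Qed.

Lemma cell_unique N k j u : cell N k u -> cell N j u -> k = j.
Proof.
rewrite /cell/= !in_itv/= => /andP[k1 k2] /andP[j1 j2].
apply/eqP; rewrite eqn_leq; apply/andP; split; rewrite leqNgt; apply/negP => /grid_nd-/(_ N) H.
  by have := lt_le_trans k1 (le_trans j2 H); rewrite ltxx.
by have := lt_le_trans j1 (le_trans k2 H); rewrite ltxx.
Qed.

Definition step N (a : nat -> R) u := \sum_(k < N.+1) \1_(cell N k) u * a k.

Lemma step_cell N a k u : (k < N.+1)%N -> cell N k u -> step N a u = a k.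
Proof.
move=> kN ku; rewrite /step (bigD1 (Ordinal kN))//= indicE mem_set// mul1r big1 ?addr0//.
move=> j jk; rewrite indicE memNset ?mul0r// => ju.
by move/negP : jk; apply; apply/eqP/val_inj/(cell_unique ju ku).
Qed.

Lemma measurable_cell N k : measurable (cell N k). Proof. exact: measurable_itv. Qed.

End uniform_grid.

(** * Stieltjes exponents along paths and along step functions *)

Section stieltjes_kernel.
Context {R : realType} (s : time_change R).
Local Notation mu := (lebesgue_stieltjes_measure (extend01 s)).
Local Notation D := (`]0%R, 1%R]%classic : set R).

Lemma stieltjes_itvoc (a b : R) : a <= b ->
  mu `]a, b]%classic = (extend01 s b - extend01 s a)%:E.
Proof.
move=> ab; rewrite /lebesgue_stieltjes_measure/= /measure_extension/=.
rewrite measurable_mu_extE/=; last exact: is_ocitv.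
by rewrite wlength_itv_bnd.
Qed.

Lemma extend01_id (u : R) : 0 <= u -> u <= 1 -> extend01 s u = s u.
Proof. by move=> u0 u1; rewrite /extend01 min_l// max_r. Qed.

Lemma extend01_nondecreasing : nondecreasing_fun (extend01 s).
Proof. exact: cumulative_is_nondecreasing. Qed.

Lemma extend01_le0 (u : R) : u <= 0 -> extend01 s u = 0.
Proof.
by move=> u0; rewrite /extend01 min_l ?(le_trans u0)// max_l// time_change0.
Qed.

Lemma extend01_ge0 (u : R) : 0 <= extend01 s u.
Proof.
have [u0|u0] := leP u 0; first by rewrite extend01_le0.
by rewrite -(extend01_le0 (lexx 0)) extend01_nondecreasing// ltW.
Qed.

Lemma extend01_le (u : R) : extend01 s u <= s 1.
Proof.
rewrite -[leRHS]extend01_id//; have [u1|u1] := leP u 1; first exact: extend01_nondecreasing.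
by rewrite /extend01 minxx (min_r (ltW u1)).
Qed.

Lemma integrable_unit_cst (r : R) : mu.-integrable D (EFin \o cst r).
Proof.
apply: measurable_bounded_integrable => //.
  by rewrite [ltLHS](stieltjes_itvoc ler01) ltry.
by exists `|r|; split; [exact: num_real|move=> x xr y _; exact: ltW].
Qed.

Variables (d : measure_display) (T : measurableType d) (Theta : R -> R[i]).
Hypotheses (mTheta : cmeas setT Theta) (Theta0 : forall y, 0 <= Re (Theta y)).
Hypothesis Theta_bounded : forall K : R, exists M, forall y, `|y| <= K -> normc (Theta y) <= M.
Hypothesis Theta_cvg : forall (y_ : nat -> R) (y : R), y_ @ \oo --> y ->
  ccvg (fun n => Theta (y_ n)) (Theta y).

Definition stieltjes_kernel (V : R * T -> R) (z : R * T) : R[i] :=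
  cexp (- stieltjes_integral s (fun u => Theta (z.1 + V (u, z.2)))).

Lemma cmeas_stieltjes_kernel V : measurable_fun setT V -> cmeas setT (stieltjes_kernel V).
Proof.
move=> mV; apply: cmeas_cexp; apply: cmeasN.
apply: (@cmeas_parametric_cintegral_in _ _ _ _ _ mu D
  (fun q : (R * T) * R => Theta (q.1.1 + V (q.2, q.1.2)))) => //.
apply: (cmeas_comp mTheta); apply: measurable_funD.
  by apply: measurableT_comp => //; exact: measurable_fst.
apply: (measurableT_comp mV); apply: measurable_fun_pair => /=; first exact: measurable_snd.
by apply: measurableT_comp; [exact: measurable_snd|exact: measurable_fst].
Qed.

Lemma normc_stieltjes_kernel_le1 V z : normc (stieltjes_kernel V z) <= 1.
Proof.
apply: normc_cexp_le1; rewrite Re_opp oppr_le0 /stieltjes_integral Re_cintegral.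
by apply: Rintegral_ge0 => u _; exact: Theta0.
Qed.

(** Dominated convergence in u along the single path w: all arguments x + V_n stay within |x| + M,
    where Theta is bounded by a constant, and constants are integrable because the Stieltjes measure
    of ]0, 1] is finite. *)
Lemma ccvg_stieltjes_kernel (V_ : nat -> R * T -> R) (V : R * T -> R) w (x M : R) :
  (forall n, measurable_fun setT (V_ n)) -> measurable_fun setT V ->
  (forall n u, D u -> `|V_ n (u, w)| <= M) ->
  {ae mu, forall u, D u -> (fun n => V_ n (u, w)) @ \oo --> V (u, w)} ->
  ccvg (fun n => stieltjes_kernel (V_ n) (x, w)) (stieltjes_kernel V (x, w)).
Proof.
move=> mV_ mV V_M VV; apply: ccvg_cexp; apply: ccvgN.
have [C HC] := Theta_bounded (`|x| + M).
have mT W : measurable_fun setT W -> cmeas D (fun u => Theta (x + W (u, w))).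
  move=> mW; apply: (cmeas_comp mTheta).
  apply: (@measurable_funS _ _ _ _ setT) => //; apply: measurable_funD => //.
  by apply: (measurableT_comp mW); exact: measurable_pair2.
apply: (@cintegral_dct _ _ _ mu D _ _ (cst C)) => //=.
- by move=> n; exact: mT.
- exact: mT.
- exact: integrable_unit_cst.
- apply: ae_imply VV => u H Du; apply: Theta_cvg; apply: cvgD; first exact: cvg_cst.
  exact: H.
apply: aeW => u n Du; apply: HC; apply: le_trans (ler_normD _ _) _.
by rewrite lerD2l; exact: V_M.
Qed.

Lemma cell_unit N k : (k < N.+1)%N -> cell N k `<=` D.
Proof.
move=> kN u; rewrite /cell/= !in_itv/= => /andP[ku uk]; apply/andP; split.
  by apply: le_lt_trans ku; rewrite -(grid0 N) grid_nd.
by apply: le_trans uk _; rewrite -(grid_last N) grid_nd.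
Qed.

Lemma cintegral_unit_steps N (c : nat -> R[i]) (n : nat) : (n <= N.+1)%N ->
  cint mu D (fun u => \sum_(k < n) (\1_(cell N k) u)%:C * c k) /\
  cintegral mu D (fun u => \sum_(k < n) (\1_(cell N k) u)%:C * c k) =
  \sum_(k < n) (extend01 s (grid N k.+1) - extend01 s (grid N k))%:C * c k.
Proof.
have ind k : (k < N.+1)%N ->
    cint mu D (fun u => (\1_(cell N k) u)%:C * c k) /\
    cintegral mu D (fun u => (\1_(cell N k) u)%:C * c k) =
    (extend01 s (grid N k.+1) - extend01 s (grid N k))%:C * c k.
  move=> kN.
  have i1 : cint mu D (fun u => (\1_(cell N k) u)%:C).
    apply: (@cint_le _ _ _ mu D _ (cst 1)) => //.
    - split => /=; last exact: measurable_cst.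
      by apply: measurable_indic; exact: measurable_cell.
    - exact: integrable_unit_cst.
    move=> u _; rewrite normc_sqrt /nsq/= expr0n addr0 sqrtr_sqr ger0_norm//.
  have i2 : cint mu D (fun u => (\1_(cell N k) u)%:C * c k).
    have := @cintMl _ _ _ mu D (c k) _ (measurable_itv _) i1.
    by congr cint; apply/funext => u; rewrite mulrC.
  split=> //; rewrite cintegralMr//; congr (_ * _).
  apply: complex_eqP; rewrite /= ?Rintegral0//.
  rewrite /Rintegral integral_indic//; last exact: measurable_cell.
  rewrite setIidl; last exact: cell_unit.
  by rewrite [X in fine X](stieltjes_itvoc (grid_nd N (leqnSn k))).
pose G m (u : R) := \sum_(k < m) (\1_(cell N k) u)%:C * c k.
rewrite -/(G n); elim: n => [_|n IH nN].
  have -> : G 0 = fun=> 0 by apply/funext => u; rewrite /G big_ord0.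
  split; first by split => /=; exact: integrable0.
  by rewrite big_ord0; apply: complex_eqP; rewrite /= Rintegral0.
have [IH1 IH2] := IH (ltnW nN); have [i1 i2] := ind n nN.
have -> : G n.+1 = fun u => G n u + (\1_(cell N n) u)%:C * c n.
  by apply/funext => u; rewrite /G big_ord_recr.
split; first exact: cintD.
by rewrite cintegralD// IH2 i2 big_ord_recr.
Qed.

Lemma stieltjes_kernel_step N (a : nat -> T -> R) (x : R) w :
  stieltjes_kernel (fun z => step N (a ^~ z.2) z.1) (x, w) =
  cexp (- \sum_(k < N.+1)
    ((extend01 s (grid N k.+1) - extend01 s (grid N k))%:C * Theta (x + a k w))).
Proof.
have [_ <-] := cintegral_unit_steps (fun k => Theta (x + a k w)) (leqnn N.+1).
congr (cexp (- _)); apply: eq_cintegral => u; rewrite inE/= in_itv/= => /andP[u0 u1].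
have [k ku _] := grid_cell N u0 u1.
rewrite (step_cell _ (ltn_ord k) ku) (bigD1 k)//= indicE mem_set// mul1r big1 ?addr0//.
move=> j jk; rewrite indicE memNset ?mul0r// => ju.
by move/negP : jk; apply; apply/eqP/val_inj/(cell_unique ju ku).
Qed.

Lemma measurable_step N (a : nat -> T -> R) : (forall k, measurable_fun setT (a k)) ->
  measurable_fun setT (fun z : R * T => step N (a ^~ z.2) z.1).
Proof.
move=> ma; rewrite /step; apply: measurable_sum => k; apply: measurable_funM.
  apply: (@measurableT_comp _ _ _ _ _ _ (\1_(cell N k) : R -> R) _ fst) => //.
  by apply: measurable_indic; exact: measurable_cell.
by apply: (measurableT_comp (ma k)); exact: measurable_snd.
Qed.

End stieltjes_kernel.

(** The sequence may take the value u itself: a right endpoint of a cell can coincide with u, and a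
    time change can be constant to the right of u. *)
Lemma cvg_right_seq (R : realType) (p : R -> R) (u : R) (v : nat -> R) :
  p x @[x --> u^'+] --> p u -> (forall n, u <= v n) -> v @ \oo --> u ->
  (fun n => p (v n)) @ \oo --> p u.
Proof.
move=> pu uv vu; apply/cvgrPdist_lt => e e0.
have H : \forall x \near u, u < x -> `|p u - p x| < e.
  by move/cvgrPdist_lt : pu => /(_ _ e0).
near=> n; have K : u < v n -> `|p u - p (v n)| < e by near: n; exact: (vu _ H).
by have := uv n; rewrite le_eqVlt => /predU1P[<-|/K//]; rewrite subrr normr0.
Unshelve. all: by end_near. Qed.

(** * Left limits of time changes and grid approximations *)

Section left_limits.
Context {R : realType} (s : time_change R).

(** Left limit of the extended time change, which exists at every real point by monotonicity; on ]0,
    1] it agrees with [left_limit]. *)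
Definition left_extend01 (u : R) : R := lim (extend01 s v @[v --> u^'-]).

Lemma cvg_left_extend01 (u : R) : extend01 s v @[v --> u^'-] --> left_extend01 u.
Proof.
apply: nondecreasing_at_left_is_cvgr.
  by apply: nearW => v x y _ _; exact: extend01_nondecreasing.
by apply: nearW => v; exists (s 1) => _ [y _ <-]; exact: extend01_le.
Qed.

Lemma left_limitE (u : R) : 0 < u -> u <= 1 -> left_limit s u = left_extend01 u.
Proof.
move=> u0 u1; apply/cvg_lim => //; apply: cvg_trans (@cvg_left_extend01 u).
apply: near_eq_cvg; near=> v.
have v0 : 0 <= v by near: v; exact: nbhs_left_ge.
have vu : v < u by near: v; exact: nbhs_left_lt.
by rewrite extend01_id// ltW// (lt_le_trans vu).
Unshelve. all: by end_near. Qed.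

Lemma left_extend01_seq (u : R) (v : nat -> R) : (forall n, v n < u) -> v @ \oo --> u ->
  (fun n => extend01 s (v n)) @ \oo --> left_extend01 u.
Proof. by move=> vu cv; have /cvg_at_leftP := @cvg_left_extend01 u; apply. Qed.

Lemma cvg_subr_harmonic (u : R) : (fun n => u - n.+1%:R^-1) @ \oo --> u.
Proof.
rewrite -[X in _ --> X]subr0; apply: cvgB; first exact: cvg_cst.
exact: cvg_harmonic.
Qed.

Lemma cvg_extend01_subr_harmonic (u : R) :
  (fun n => extend01 s (u - n.+1%:R^-1)) @ \oo --> left_extend01 u.
Proof.
apply: left_extend01_seq; last exact: cvg_subr_harmonic.
by move=> n; rewrite ltrBlDr ltrDl.
Qed.

Lemma measurable_left_extend01 : measurable_fun setT left_extend01.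
Proof.
apply: (@measurable_fun_cvg _ _ _ setT (fun n (u : R) => extend01 s (u - n.+1%:R^-1))).
  move=> n; apply: nondecreasing_measurable => // x y xy.
  by apply: extend01_nondecreasing; rewrite lerD2r.
by move=> u _; exact: cvg_extend01_subr_harmonic.
Qed.

Lemma left_extend01_ge0 (u : R) : 0 <= left_extend01 u.
Proof.
rewrite -(cvg_lim _ (@cvg_extend01_subr_harmonic u))//; apply: limr_ge.
  by apply/cvg_ex; exists (left_extend01 u); exact: cvg_extend01_subr_harmonic.
by apply: nearW => n; exact: extend01_ge0.
Qed.

End left_limits.

Section grid_sequences.
Context {R : realType}.

Lemma grid_sequence (u : R) : 0 < u -> u <= 1 -> exists k : nat -> nat,
  [/\ forall n, (k n < n.+1)%N /\ cell n (k n) u,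
      (fun n => grid n (k n)) @ \oo --> u &
      (fun n => grid n (k n).+1) @ \oo --> u].
Proof.
move=> u0 u1.
have /choice[k Hk] : forall n, exists k, (k < n.+1)%N /\ cell n k u.
  by move=> n; have [k ku _] := grid_cell n u0 u1; exists k.
have lo : (fun n => grid n (k n)) @ \oo --> u.
  apply: (@squeeze_cvgr _ _ _ _ (fun n => u - n.+1%:R^-1) (cst u)).
  - apply: nearW => n; have [_] := Hk n; rewrite /cell/= in_itv/= gridS => /andP[a b].
    by rewrite lerBlDr b ltW.
  - exact: cvg_subr_harmonic.
  - exact: cvg_cst.
exists k; split=> //.
rewrite (_ : (fun n => _) = fun n => grid n (k n) + n.+1%:R^-1).
  by rewrite -[X in _ --> X]addr0; apply: cvgD => //; exact: cvg_harmonic.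
by apply/funext => n; exact: gridS.
Qed.

End grid_sequences.

(** * Time-changed paths and their discretizations *)

Section time_changed_paths.
Context {R : realType} (s t : time_change R).
Context (d : measure_display) (T : measurableType d) (P : probability T R).
Variables (X : R -> {RV P >-> R}) (Phi : R -> R[i]) (X' : R -> T -> R).
Hypotheses (levyX : levy_process X) (expX : characteristic_exponent X Phi).
Hypothesis regX : regular_version P X X'.
Local Notation D := (`]0%R, 1%R]%classic : set R).

Definition forward_path (z : R * T) : R := X' (left_extend01 s z.1) z.2.

Definition forward_sample N k (w : T) : R := X' (extend01 s (grid N k)) w.

Definition forward_step N (z : R * T) : R := step N ((forward_sample N) ^~ z.2) z.1.

Definition dual_path (z : R * T) : R := - X' (extend01 t z.1) z.2.

(* The forward path is sampled at left endpoints, which approach [s(w-)], and the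
   dual one at right endpoints, by right continuity; with this choice summation by
   parts matches the two discretized exponents. *)
Definition dual_sample N k (w : T) : R := - X' (extend01 t (grid N k.+1)) w.

Definition dual_step N (z : R * T) : R := step N ((dual_sample N) ^~ z.2) z.1.

Let mX' u : measurable_fun setT (X' u). Proof. by case: regX. Qed.

Let mXX' (g : R -> R) : measurable_fun setT g ->
  measurable_fun setT (fun z : R * T => X' (g z.1) z.2).
Proof.
move=> mg; apply: (@measurableT_comp _ _ _ _ _ _ (fun z : R * T => X' z.1 z.2) _
  (fun z : R * T => (g z.1, z.2))); first exact: regular_version_jointly_measurable regX.
apply: measurable_fun_pair => /=; last exact: measurable_snd.
by apply: (measurableT_comp mg); exact: measurable_fst.
Qed.

Lemma measurable_forward_path : measurable_fun setT forward_path.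
Proof. by apply: mXX'; exact: measurable_left_extend01. Qed.

Lemma measurable_forward_step N : measurable_fun setT (forward_step N).
Proof. by apply: measurable_step => k; exact: mX'. Qed.

Lemma measurable_dual_path : measurable_fun setT dual_path.
Proof.
apply: measurable_funN; apply: mXX'.
by apply: nondecreasing_measurable => //; exact: extend01_nondecreasing.
Qed.

Lemma measurable_dual_step N : measurable_fun setT (dual_step N).
Proof. by apply: measurable_step => k; apply: measurable_funN; exact: mX'. Qed.

Lemma sample_bounded (r : time_change R) w : exists M, forall u, `|X' (extend01 r u) w| <= M.
Proof.
case: regX => _ _ cX _; have [M HM] := cadlag_bounded 0 (r 1) (cX w).
by exists M => u; apply: HM; rewrite extend01_ge0 extend01_le.
Qed.

Lemma forward_step_bounded w : exists M, forall N u, D u -> `|forward_step N (u, w)| <= M.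
Proof.
have [M HM] := sample_bounded s w; exists M => N u; rewrite /= in_itv/= => /andP[u0 u1].
by have [k ku _] := grid_cell N u0 u1; rewrite /forward_step (step_cell _ (ltn_ord k) ku) HM.
Qed.

Lemma dual_step_bounded w : exists M, forall N u, D u -> `|dual_step N (u, w)| <= M.
Proof.
have [M HM] := sample_bounded t w; exists M => N u; rewrite /= in_itv/= => /andP[u0 u1].
have [k ku _] := grid_cell N u0 u1.
by rewrite /dual_step (step_cell _ (ltn_ord k) ku) normrN HM.
Qed.

(** The sampled times approach s(u-) from below, so a path with a jump there would yield its left
    limit instead of its value. For fixed u, [stochastic_continuity] excludes this almost surely;
    [ae_cvg_swap] then gives one exceptional set of paths, at the price of a null set of u. *)
Lemma forward_step_cvg : {ae P, forall w,
  {ae lebesgue_stieltjes_measure (extend01 t), forall u, D u ->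
    (fun N => forward_step N (u, w)) @ \oo --> forward_path (u, w)}}.
Proof.
apply: (@ae_cvg_swap _ _ _ _ _ (lebesgue_stieltjes_measure (extend01 t)) P D
  forward_step forward_path).
- exact: measurable_itv.
- exact: measurable_forward_step.
- exact: measurable_forward_path.
move=> u; rewrite /= in_itv/= => /andP[u0 u1].
apply: ae_imply (stochastic_continuity levyX expX regX (left_extend01 s u)) => w Xw.
have [k [Hk lo _]] := grid_sequence u0 u1.
have E N : forward_step N (u, w) = X' (extend01 s (grid N (k N))) w.
  by have [kN ku] := Hk N; rewrite /forward_step (step_cell _ kN ku).
under eq_fun do rewrite E.
apply: cvg_comp Xw; apply: left_extend01_seq lo => N.
by have [_] := Hk N; rewrite /cell/= in_itv/= => /andP[].
Qed.

Lemma dual_step_cvg w u : D u -> (fun N => dual_step N (u, w)) @ \oo --> dual_path (u, w).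
Proof.
rewrite /= in_itv/= => /andP[u0 u1].
have [k [Hk _ hi]] := grid_sequence u0 u1.
have E N : dual_step N (u, w) = - X' (extend01 t (grid N (k N).+1)) w.
  by have [kN ku] := Hk N; rewrite /dual_step (step_cell _ kN ku).
under eq_fun do rewrite E.
have uk N : u <= grid N (k N).+1.
  by have [_] := Hk N; rewrite /cell/= in_itv/= => /andP[].
case: regX => _ _ cX _; have [Xr _] := cX w (extend01 t u).
apply: cvgN; apply: (cvg_right_seq Xr) => [N|]; first exact: extend01_nondecreasing.
by apply: cvg_right_seq hi => //; exact: cumulative_is_right_continuous.
Qed.

Lemma forward_operatorE Psi f : forward_operator X Psi s t f =
  kernel_operator P (stieltjes_kernel t Psi forward_path) (X' (s 1)) f.
Proof.
apply/funext => x; apply: cintegral_negligible_congr; case: regX => _ _ _.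
apply: ae_imply => w XX' _; rewrite XX'; last first.
  by rewrite -(extend01_id s ler01 (lexx 1)) extend01_ge0.
congr (cexp (- _) * _); apply: eq_cintegral => u; rewrite inE/= in_itv/= => /andP[u0 u1].
by rewrite left_limitE// XX' ?left_extend01_ge0.
Qed.

Lemma dual_operatorE Psi f : dual_operator X Psi s t f =
  kernel_operator P (stieltjes_kernel s Psi dual_path) (fun w => - X' (t 1) w) f.
Proof.
apply/funext => x; apply: cintegral_negligible_congr; case: regX => _ _ _.
apply: ae_imply => w XX' _; rewrite XX'; last first.
  by rewrite -(extend01_id t ler01 (lexx 1)) extend01_ge0.
congr (cexp (- _) * _); apply: eq_cintegral => u; rewrite inE/= in_itv/= => /andP[u0 u1].
rewrite -(extend01_id t (ltW u0) u1) XX' ?extend01_ge0//.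
Qed.

End time_changed_paths.

(** * Duality *)

Section product_kernel.
Context d1 d2 (T1 : measurableType d1) (T2 : measurableType d2) (R : realType).
Variables (P : probability T1 R) (Q : probability T2 R).
Local Notation leb := (@lebesgue_measure R).
Variable B : R * (T1 * T2) -> R[i].
Hypotheses (mB : cmeas setT B) (B1 : forall z, normc (B z) <= 1).

(** A weight that is itself an average over the second space gives a kernel operator on the product
    space, whose displacement ignores the second coordinate. This lemma and its mirror image end in
    the same product measure, so the forward and dual sides can be compared integrand by
    integrand. *)
Lemma kernel_operator_inner_prodl (A : R * T1 -> R[i]) (E : T1 -> R) (f g : R -> R[i]) :
  (forall x w, A (x, w) = cintegral Q setT (fun w' => B (x, (w, w')))) ->
  measurable_fun setT E -> L2 f -> L2 g ->
  L2inner (kernel_operator P A E f) g = cintegral (P \x Q)%E setT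
    (fun z => L2inner (fun x => B (x, z) * f (x + E z.1)) g).
Proof.
move=> AB mE Lf Lg; have mE1 : measurable_fun setT (fun z : T1 * T2 => E z.1).
  by apply: (measurableT_comp mE); exact: measurable_fst.
rewrite -(kernel_operator_inner (P \x Q)%E mB B1 mE1 Lf Lg).
apply: L2inner_congr => //; last exact: aeW.
apply: ae_imply (ae_shifted_energy_fin (P \x Q)%E mE1 Lf) => x fx _.
have := cint_kernel mB B1 mE1 (L2_cmeas Lf) fx.
move=> ci; rewrite /kernel_operator -(cintegral_fubini1 ci).
apply: eq_cintegral => w _ /=; rewrite AB cintegralMr//.
apply: (@cint_bounded _ _ _ _ _ 1) => //.
by apply: (cmeas_comp mB); apply: measurable_fun_pair => //=.
Qed.

Lemma kernel_operator_inner_prodr (A : R * T2 -> R[i]) (E : T2 -> R) (f g : R -> R[i]) :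
  (forall x w', A (x, w') = cintegral P setT (fun w => B (x, (w, w')))) ->
  measurable_fun setT E -> L2 f -> L2 g ->
  L2inner (kernel_operator Q A E f) g = cintegral (P \x Q)%E setT
    (fun z => L2inner (fun x => B (x, z) * f (x + E z.2)) g).
Proof.
move=> AB mE Lf Lg; have mE2 : measurable_fun setT (fun z : T1 * T2 => E z.2).
  by apply: (measurableT_comp mE); exact: measurable_snd.
rewrite -(kernel_operator_inner (P \x Q)%E mB B1 mE2 Lf Lg).
apply: L2inner_congr => //; last exact: aeW.
apply: ae_imply (ae_shifted_energy_fin (P \x Q)%E mE2 Lf) => x fx _.
have := cint_kernel mB B1 mE2 (L2_cmeas Lf) fx.
move=> ci; rewrite /kernel_operator -(cintegral_fubini2 ci).
apply: eq_cintegral => w' _ /=; rewrite AB cintegralMr//.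
apply: (@cint_bounded _ _ _ _ _ 1) => //.
by apply: (cmeas_comp mB); apply: measurable_fun_pair => //=.
Qed.

End product_kernel.

(** * Duality for fixed sampled paths *)

Section discrete_duality.
Context {R : realType}.
Local Notation leb := (@lebesgue_measure R).
Implicit Types (p q : nat -> R) (x z : R) (n : nat).

Definition forward_phase p q n x : R := \sum_(k < n) (x + p k) * (q k.+1 - q k).

Definition dual_phase p q n z : R := \sum_(k < n) (z - q k.+1) * (p k.+1 - p k).

(** The part common to both phases: free of the space variable, it leaves the inner products as one
    unimodular constant. *)
Definition left_sum p q n : R := \sum_(k < n) p k * (q k.+1 - q k).

Lemma forward_phaseE p q n x : q 0%N = 0 ->
  forward_phase p q n x = left_sum p q n + x * q n.
Proof.
move=> q0; elim: n => [|n IH]; first by rewrite /forward_phase /left_sum !big_ord0 q0 mulr0 addr0.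
by rewrite /forward_phase /left_sum !big_ord_recr /= -/(forward_phase p q n x)
  -/(left_sum p q n) IH; ring.
Qed.

(* Summation by parts: [p n * q n] is the sum of the [p k * (q k.+1 - q k)] and of
   the [q k.+1 * (p k.+1 - p k)]. *)
Lemma dual_phaseE p q n z : p 0%N = 0 ->
  dual_phase p q n z = left_sum p q n + p n * (z - q n).
Proof.
move=> p0; elim: n => [|n IH]; first by rewrite /dual_phase /left_sum !big_ord0 p0 mul0r addr0.
by rewrite /dual_phase /left_sum !big_ord_recr /= -/(dual_phase p q n z)
  -/(left_sum p q n) IH; ring.
Qed.

Lemma L2innerZl (c : R[i]) (f g : R -> R[i]) : L2 f -> L2 g ->
  L2inner (fun x => c * f x) g = c * L2inner f g.
Proof.
move=> Lf Lg; rewrite /L2inner -cintegralMl//; last exact: cint_inner.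
by apply: eq_cintegral => x _; rewrite mulrA.
Qed.

Lemma cexp_iD x y : cexp ((x + y) *i) = cexp (x *i) * cexp (y *i) :> R[i].
Proof. by rewrite -cexpD; congr cexp; apply: complex_eqP; rewrite /= ?addr0. Qed.

Variable F : (R -> R[i]) -> R -> R[i].
Hypothesis fourierF : fourier_transform F.

Lemma fourier_phase p q n (f g : R -> R[i]) : p 0%N = 0 -> q 0%N = 0 -> L2 f -> L2 g ->
  L2inner (fun x => cexp ((forward_phase p q n x) *i) * f (x + p n)) g =
  L2inner (fun z => cexp ((dual_phase p q n z) *i) * F f (z - q n)) (F g).
Proof.
move=> p0 q0 Lf Lg; have LF h : L2 h -> L2 (F h) by case: fourierF => -[+ _ _ _] _; apply.
transitivity (cexp ((left_sum p q n) *i) * L2inner (weyl (p n) (q n) f) g).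
  rewrite -L2innerZl//; last exact: L2_weyl.
  congr L2inner; apply/funext => x.
  by rewrite forward_phaseE// cexp_iD /weyl mulrA.
rewrite -(fourier_inner fourierF (L2_weyl _ _ Lf) Lg).
transitivity (cexp ((left_sum p q n) *i) * L2inner (weyl_dual (p n) (q n) (F f)) (F g)).
  congr (_ * _); apply: L2inner_congr; first exact: fourier_weyl.
  exact: aeW.
rewrite -L2innerZl; [|by apply: L2_weyl_dual; exact: LF|exact: LF].
congr L2inner; apply/funext => z.
by rewrite dual_phaseE// cexp_iD /weyl_dual mulrA.
Qed.

End discrete_duality.

(** * Averaging over both processes and passage to the limit *)

Section duality.
Context {R : realType} (d d' : measure_display) (T : measurableType d) (T' : measurableType d')
  (P : probability T R) (Q : probability T' R).
Variables (X : R -> {RV P >-> R}) (Y : R -> {RV Q >-> R}) (Phi Psi : R -> R[i]).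
Variables (F : (R -> R[i]) -> R -> R[i]) (s t : time_change R).
Hypotheses (levyX : levy_process X) (levyY : levy_process Y).
Hypotheses (expX : characteristic_exponent X Phi) (expY : characteristic_exponent Y Psi).
Hypothesis fourierF : fourier_transform F.
Variables (X' : R -> T -> R) (Y' : R -> T' -> R).
Hypotheses (regX : regular_version P X X') (regY : regular_version Q Y Y').
Local Notation leb := (@lebesgue_measure R).

Let p n (w : T) k := X' (extend01 s (grid n k)) w.
Let q n (w : T') k := Y' (extend01 t (grid n k)) w.

Let mX' u : measurable_fun setT (X' u). Proof. by case: regX. Qed.
Let mY' u : measurable_fun setT (Y' u). Proof. by case: regY. Qed.

Let grid_extend_nd (r : time_change R) n :
  {homo (fun k => extend01 r (grid n k)) : i j / (i <= j)%N >-> i <= j}.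
Proof. by move=> i j ij; apply: extend01_nondecreasing; exact: grid_nd. Qed.

Let mp n k : measurable_fun setT (fun z : R * (T * T') => p n z.2.1 k).
Proof.
apply: (measurableT_comp (mX' _)); apply: measurableT_comp; first exact: measurable_fst.
exact: measurable_snd.
Qed.

Let mq n k : measurable_fun setT (fun z : R * (T * T') => q n z.2.2 k).
Proof.
apply: (measurableT_comp (mY' _)); apply: measurableT_comp; first exact: measurable_snd.
exact: measurable_snd.
Qed.

Let forward_weight n (z : R * (T * T')) : R[i] :=
  cexp ((forward_phase (p n z.2.1) (q n z.2.2) n.+1 z.1) *i).

Let dual_weight n (z : R * (T * T')) : R[i] :=
  cexp ((dual_phase (p n z.2.1) (q n z.2.2) n.+1 z.1) *i).

Let cmeas_forward_weight n : cmeas setT (forward_weight n).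
Proof.
apply: cmeas_cexp_i; apply: measurable_sum => k; apply: measurable_funM.
  by apply: measurable_funD => //; exact: measurable_fst.
exact: measurable_funB.
Qed.

Let cmeas_dual_weight n : cmeas setT (dual_weight n).
Proof.
apply: cmeas_cexp_i; apply: measurable_sum => k; apply: measurable_funM.
  by apply: measurable_funB => //; exact: measurable_fst.
exact: measurable_funB.
Qed.

Let forward_weightE n x w : stieltjes_kernel t Psi (forward_step s X' n) (x, w) =
  cintegral Q setT (fun w' => forward_weight n (x, (w, w'))).
Proof.
rewrite stieltjes_kernel_step.
by rewrite -(joint_charfun levyY expY regY (u := fun k => extend01 t (grid n k))
  (fun k => x + p n w k) _ (extend01_ge0 _ _)).
Qed.

Let dual_weightE n z w' : stieltjes_kernel s Phi (dual_step t Y' n) (z, w') =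
  cintegral P setT (fun w => dual_weight n (z, (w, w'))).
Proof.
rewrite stieltjes_kernel_step.
by rewrite -(joint_charfun levyX expX regX (u := fun k => extend01 s (grid n k))
  (fun k => z - q n w' k.+1) _ (extend01_ge0 _ _)).
Qed.

Let A_ n := kernel_operator P (stieltjes_kernel t Psi (forward_step s X' n)) (X' (s 1)).
Let B_ n := kernel_operator Q (stieltjes_kernel s Phi (dual_step t Y' n)) (fun w => - Y' (t 1) w).
Let A := kernel_operator P (stieltjes_kernel t Psi (forward_path s X')) (X' (s 1)).
Let B := kernel_operator Q (stieltjes_kernel s Phi (dual_path t Y')) (fun w => - Y' (t 1) w).

Let LF f : L2 f -> L2 (F f). Proof. by case: fourierF => -[+ _ _ _] _; apply. Qed.

Let p0 n w : p n w 0%N = 0.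
Proof. by case: regX => _ X0 _ _; rewrite /p grid0 extend01_le0// X0. Qed.

Let q0 n w : q n w 0%N = 0.
Proof. by case: regY => _ Y0 _ _; rewrite /q grid0 extend01_le0// Y0. Qed.

Let p_last n w : p n w n.+1 = X' (s 1) w.
Proof. by rewrite /p grid_last extend01_id. Qed.

Let q_last n w : q n w n.+1 = Y' (t 1) w.
Proof. by rewrite /q grid_last extend01_id. Qed.

Let discrete_duality n f g : L2 f -> L2 g ->
  L2inner (A_ n f) g = L2inner (B_ n (F f)) (F g).
Proof.
move=> Lf Lg.
rewrite (kernel_operator_inner_prodl P (cmeas_forward_weight n) _ (forward_weightE n))//; last first.
  by move=> z; rewrite normc_cexp_i.
rewrite (kernel_operator_inner_prodr Q (cmeas_dual_weight n) _ (dual_weightE n)); first last.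
- exact: LF.
- exact: LF.
- exact: measurable_funN.
- by move=> z; rewrite normc_cexp_i.
apply: eq_cintegral => -[w w'] _ /=.
have := fourier_phase fourierF n.+1 (p0 n w) (q0 n w') Lf Lg.
by rewrite p_last q_last.
Qed.

Let mPsi := exponent_cmeas expY regY.
Let mPhi := exponent_cmeas expX regX.
Let Psi1 (V : R * T -> R) z : normc (stieltjes_kernel t Psi V z) <= 1.
Proof. exact: normc_stieltjes_kernel_le1 (exponent_Re_ge0 expY) _ _. Qed.

Let Phi1 (V : R * T' -> R) z : normc (stieltjes_kernel s Phi V z) <= 1.
Proof. exact: normc_stieltjes_kernel_le1 (exponent_Re_ge0 expX) _ _. Qed.

Let cvg_A f g : L2 f -> L2 g -> ccvg (fun n => L2inner (A_ n f) g) (L2inner (A f) g).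
Proof.
apply: ccvg_kernel_operator_inner => //.
- by move=> n; apply: cmeas_stieltjes_kernel => //; exact: measurable_forward_step regX _.
- by apply: cmeas_stieltjes_kernel => //; exact: measurable_forward_path regX.
move=> x; apply: ae_imply (forward_step_cvg s t levyX expX regX) => w Hw.
have [M HM] := forward_step_bounded s regX w.
apply: (@ccvg_stieltjes_kernel _ _ _ _ _ mPsi (exponent_bounded expY regY)
  (ccvg_exponent expY regY) _ _ _ _ M) => //.
- by move=> n; exact: measurable_forward_step regX _.
- exact: measurable_forward_path regX.
Qed.

Let cvg_B f g : L2 f -> L2 g -> ccvg (fun n => L2inner (B_ n f) g) (L2inner (B f) g).
Proof.
apply: ccvg_kernel_operator_inner => //.
- by move=> n; apply: cmeas_stieltjes_kernel => //; exact: measurable_dual_step regY _.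
- by apply: cmeas_stieltjes_kernel => //; exact: measurable_dual_path regY.
- exact: measurable_funN.
move=> x; apply: aeW => w.
have [M HM] := dual_step_bounded t regY w.
apply: (@ccvg_stieltjes_kernel _ _ _ _ _ mPhi (exponent_bounded expX regX)
  (ccvg_exponent expX regX) _ _ _ _ M) => //.
- by move=> n; exact: measurable_dual_step regY _.
- exact: measurable_dual_path regY.
by apply: aeW => u; exact: dual_step_cvg regY _ _.
Qed.

Let duality f g : L2 f -> L2 g -> L2inner (A f) g = L2inner (B (F f)) (F g).
Proof.
move=> Lf Lg; apply: ccvg_unique (cvg_A Lf Lg) _.
under eq_fun do rewrite discrete_duality//.
by apply: cvg_B; exact: LF.
Qed.

Let LA f : L2 f -> L2 (A f).
Proof.
apply: L2_kernel_operator => //.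
by apply: cmeas_stieltjes_kernel => //; exact: measurable_forward_path regX.
Qed.

Let LB f : L2 f -> L2 (B f).
Proof.
apply: L2_kernel_operator => //; last exact: measurable_funN.
by apply: cmeas_stieltjes_kernel => //; exact: measurable_dual_path regY.
Qed.

Lemma forward_operator_extension : unique_continuous_L2_extension
  (forward_operator X Psi s t) (forward_operator X Psi s t).
Proof.
have -> : forward_operator X Psi s t = A by apply/funext => f; exact: forward_operatorE.
apply: kernel_operator_extension => //.
by apply: cmeas_stieltjes_kernel => //; exact: measurable_forward_path regX.
Qed.

Lemma dual_operator_extension : unique_continuous_L2_extension
  (dual_operator Y Phi s t) (dual_operator Y Phi s t).
Proof.
have -> : dual_operator Y Phi s t = B by apply/funext => f; exact: dual_operatorE.
apply: kernel_operator_extension => //; last exact: measurable_funN.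
by apply: cmeas_stieltjes_kernel => //; exact: measurable_dual_path regY.
Qed.

(** [duality] tests against functions of the form F g only. By surjectivity the defect h agrees
    almost everywhere with such a function, so it is orthogonal to itself. *)
Lemma dual_operator_fourier f : L2 f ->
  dual_operator Y Phi s t (F f) = F (forward_operator X Psi s t f) %[ae leb].
Proof.
move=> Lf; rewrite (forward_operatorE s t regX) (dual_operatorE s t regY) -/A -/B.
pose h x := B (F f) x - F (A f) x.
have LBF : L2 (B (F f)) by apply: LB; exact: LF.
have LFA : L2 (F (A f)) by apply: LF; exact: LA.
have Lh : L2 h by exact: L2B.
have [g Lg Fg] := fourier_onto fourierF Lh.
have h0 : L2inner h h = 0.
  rewrite -(L2inner_congr (f := h) (g := F g) _ Fg); last exact: aeW.
  rewrite /h L2innerB//; last exact: LF.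
  by rewrite -duality// (fourier_inner fourierF (LA Lf) Lg) subrr.
apply: ae_imply (L2inner_eq0 Lh h0) => x H _.
by apply/eqP; rewrite -subr_eq0; apply/eqP; exact: H.
Qed.

End duality.

Theorem proposition3p1 (R : realType)
    (d : measure_display) (T : measurableType d) (P : probability T R)
    (d' : measure_display) (T' : measurableType d') (Q : probability T' R)
    (X : R -> {RV P >-> R}) (Y : R -> {RV Q >-> R})
    (Phi Psi : R -> R[i]) (Fourier : (R -> R[i]) -> R -> R[i])
    (s t : time_change R)
    (levyX : levy_process X) (levyY : levy_process Y)
    (expX : characteristic_exponent X Phi)
    (expY : characteristic_exponent Y Psi)
    (fourierF : fourier_transform Fourier) :
  exists A B : (R -> R[i]) -> R -> R[i],
    [/\ unique_continuous_L2_extension (forward_operator X Psi s t) A,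
        unique_continuous_L2_extension (dual_operator Y Phi s t) B &
        forall f, L2 f ->
          [/\ L2 (A f), L2 (B (Fourier f)) &
              B (Fourier f) = Fourier (A f) %[ae @lebesgue_measure R]]].
Proof.
have [X' regX] := levy_regular_version levyX.
have [Y' regY] := levy_regular_version levyY.
have extA := forward_operator_extension (Psi := Psi) s t expY regX regY.
have extB := dual_operator_extension (Phi := Phi) s t expX regX regY.
exists (forward_operator X Psi s t), (dual_operator Y Phi s t); split => // f Lf.
have [[LF _ _ _] _] := fourierF; have [[LA _ _] _] := extA; have [[LB _ _] _] := extB.
split; [exact: LA|exact/LB/LF|].
exact: (dual_operator_fourier s t levyX levyY expX expY fourierF regX regY Lf).
Qed.
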